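(* Let $(X,d)$ be a geometrically doubling metric space equipped with an upper doubling measure $\mu$ with dominating function $\lambda$. Let $1<p<\infty$ and let $T$ be a linear operator bounded on $L^p(\mu)$ and from $L^\infty(\mu)$ into $\mathrm{RBMO}(\mu)$. Then $T$ extends to a bounded operator on $L^r(\mu)$ for $p<r<\infty$.
   Context: $B(x,r)=\{y: d(y,x)<r\}$. A ball $B$ has center $x_B$ and radius $r_B$, and $aB=B(x_B,ar_B)$. Geometrically doubling: there is $N\in\mathbb{N}$ such that every ball $B(x,r)$ can be covered by at most $N$ balls of radius $r/2$. Upper doubling: $\mu$ is a Borel measure and there is $\lambda:X\times(0,\infty)\to(0,\infty)$ such that $r\mapsto\lambda(x,r)$ is increasing for each $x$; $\lambda(x,2r)\le C_\lambda\lambda(x,r)$; $\mu(B(x,r))\le\lambda(x,r)$; and $\lambda(x,r)\approx\lambda(y,r)$ (uniform constants) whenever $d(x,y)\le r$. For balls $B\subset Q$, $K_{B,Q}=1+\int_{r_B\le d(x,x_B)\le r_Q}\frac{1}{\lambda(x_B,d(x,x_B))}\,d\mu(x)$. $\mathrm{RBMO}(\mu)$: fix $\rho>1$. A function $f\in L^1_{\mathrm{loc}}(\mu)$ is in $\mathrm{RBMO}(\mu)$ if there are a constant $C$ and, for every ball $B$, a number $f_B$ such that $\frac1{\mu(\rho B)}\int_B|f-f_B|\,d\mu\le C$ for every ball $B$ and $|f_B-f_{B_1}|\le C K_{B,B_1}$ for all balls $B\subset B_1$. The infimum of such $C$ is $\|f\|_{\mathrm{RBMO}(\mu)}$ (different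 $\rho>1$ give equivalent norms). *)

(* Defs.v *)
From HB Require Import structures.
From mathcomp Require Import all_boot all_order all_algebra.
From mathcomp Require Import all_classical all_reals all_analysis.

Set Implicit Arguments.
Unset Strict Implicit.
Unset Printing Implicit Defensive.

Import Order.TTheory GRing.Theory Num.Theory.
Import numFieldNormedType.Exports.

Local Open Scope classical_set_scope.
Local Open Scope ring_scope.

(* The metric and the sigma-algebra are unrelated here; they are tied together
   by [borel_sigma_algebra] below. *)
#[short(type="metricMeasurableType")]
HB.structure Definition MetricMeasurable (d : measure_display) (R : realType) :=
  { T of Metric R T & Measurable d T }.

Section metric_measure_space.
Context {R : realType} {d : measure_display}.

Definition borel_sigma_algebra (X : metricMeasurableType d R) : Prop :=
  @measurable d X = <<s [set U : set X | open U] >>.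

Definition geometrically_doubling (X : metricMeasurableType d R) : Prop :=
  exists N : nat, forall (x : X) (r : R), 0 < r ->
    exists2 s : seq X, (size s <= N)%N &
      ball x r `<=` \bigcup_(y in [set` s]) ball y (r / 2).

Context {X : metricMeasurableType d R}.

(* [lam x r] is only meaningful for [0 < r]. The last clause gives both
   inequalities of the comparability of [lam x r] and [lam y r], since the
   distance is symmetric. *)
Record upper_doubling (mu : {measure set X -> \bar R}) (lam : X -> R -> R) :
    Prop := UpperDoubling {
  dominating_gt0 : forall x r, 0 < r -> 0 < lam x r ;
  dominating_nondecreasing :
    forall x r s, 0 < r -> r <= s -> lam x r <= lam x s ;
  dominating_doubling :
    exists C : R, forall x r, 0 < r -> lam x (2 * r) <= C * lam x r ;
  dominating_measure :
    forall x r, 0 < r -> (mu (ball x r) <= (lam x r)%:E)%E ;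
  dominating_comparable :
    exists C : R, forall x y r, 0 < r -> mdist x y <= r ->
      lam x r <= C * lam y r
}.

(* A ball is represented by its centre and radius, which the underlying set
   does not determine. *)

(* [Kcoef mu lam x r s] is K_{B,Q} for B = B(x, r) and Q of radius s; it does
   not depend on the centre of Q. *)
Definition Kcoef (mu : {measure set X -> \bar R}) (lam : X -> R -> R)
    (x : X) (r s : R) : \bar R :=
  (1 + \int[mu]_(y in [set y | (r <= mdist x y <= s)%R])
         ((lam x (mdist x y))^-1)%:E)%E.

Definition L1loc (mu : {measure set X -> \bar R}) (f : X -> R) : Prop :=
  measurable_fun [set: X] f /\
  forall x r, 0 < r -> mu.-integrable (ball x r) (EFin \o f).

(* The mean oscillation condition is multiplied by mu(rho B), which is finite
   but may be zero; in that case both sides below vanish. Taking B = B_1 in the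
   second condition forces [0 <= C]. *)
Definition RBMO_bound (mu : {measure set X -> \bar R}) (lam : X -> R -> R)
    (rho : R) (f : X -> R) (C : R) : Prop :=
  exists fB : X -> R -> R,
    (forall x r, 0 < r ->
       (\int[mu]_(y in ball x r) `|f y - fB x r|%:E
          <= C%:E * mu (ball x (rho * r)))%E) /\
    (forall x r y s, 0 < r -> 0 < s -> ball x r `<=` ball y s ->
       (`|fB x r - fB y s|%:E <= C%:E * Kcoef mu lam x r s)%E).

Definition RBMO (mu : {measure set X -> \bar R}) (lam : X -> R -> R)
    (rho : R) (f : X -> R) : Prop :=
  L1loc mu f /\ exists C : R, RBMO_bound mu lam rho f C.

Definition RBMO_norm (mu : {measure set X -> \bar R}) (lam : X -> R -> R)
    (rho : R) (f : X -> R) : \bar R :=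
  ereal_inf [set C%:E | C in [set C : R | RBMO_bound mu lam rho f C]].

(* Operators act on functions rather than on classes of functions, and all
   identities between values are almost everywhere. That [T] respects almost
   everywhere equality follows from linearity and boundedness. *)
Definition bounded_linear_Lp (mu : {measure set X -> \bar R}) (p : R)
    (T : (X -> R) -> (X -> R)) : Prop :=
  [/\ forall f, f \in Lfun mu p%:E -> T f \in Lfun mu p%:E,
      forall (a : R) f g, f \in Lfun mu p%:E -> g \in Lfun mu p%:E ->
        {ae mu, forall x, T (fun y => a * f y + g y) x = a * T f x + T g x} &
      exists C : R, forall f, f \in Lfun mu p%:E ->
        ('N[mu]_p%:E [EFin \o T f] <= C%:E * 'N[mu]_p%:E [EFin \o f])%E].

(* Equality in RBMO: the RBMO norm is a seminorm that vanishes exactly on the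
   functions that are almost everywhere constant. *)
Definition eq_mod_cst (mu : {measure set X -> \bar R}) (f g : X -> R) : Prop :=
  exists c : R, {ae mu, forall x, f x = g x + c}.

Definition bounded_linear_Linfty_RBMO (mu : {measure set X -> \bar R})
    (lam : X -> R -> R) (rho : R) (T : (X -> R) -> (X -> R)) : Prop :=
  [/\ forall f, f \in Lfun mu +oo%E -> RBMO mu lam rho (T f),
      forall (a : R) f g, f \in Lfun mu +oo%E -> g \in Lfun mu +oo%E ->
        eq_mod_cst mu (T (fun y => a * f y + g y))
                      (fun x => a * T f x + T g x) &
      exists C : R, forall f, f \in Lfun mu +oo%E ->
        (RBMO_norm mu lam rho (T f) <= C%:E * 'N[mu]_+oo [EFin \o f])%E].

(* [S] extends [T], an operator on L^p and from L^oo into RBMO, to L^r: the two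
   agree wherever both are defined, in the space where [T] takes its values. *)
Definition extends_to_Lr (mu : {measure set X -> \bar R}) (p r : R)
    (T S : (X -> R) -> (X -> R)) : Prop :=
  (forall f, f \in Lfun mu p%:E -> f \in Lfun mu r%:E ->
     {ae mu, forall x, S f x = T f x}) /\
  (forall f, f \in Lfun mu +oo%E -> f \in Lfun mu r%:E ->
     eq_mod_cst mu (S f) (T f)).

End metric_measure_space.

(* Main.v *)
(* The operator is interpolated through a good-lambda inequality for the
   noncentred maximal function over doubling balls. Split f at height gam * t into
   f0 + f1 with f0 bounded: T f0 has RBMO constant O(gam * t), and T f1 is controlled
   in L^p. Since any ball has a doubling dilate with bounded coefficient K, the
   oscillation of T f0 can be compared between neighbouring scales, which gives
     mu {M(T f) > 5 t} <= O(gam) mu {M(T f) > t}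
                          + O(t^-p) \int_{|f| > gam t} |f|^p.
   Multiplying by t^r, summing over t = t0 5^k and absorbing the first term for gam
   small gives the L^r bound for T on L^p and L^r functions. They are dense in L^r,
   with approximants that may be chosen uniformly close, so T extends to L^r; the
   uniform closeness also makes the extension agree with T modulo constants on
   bounded functions, since a function whose mean oscillation vanishes on all balls
   is almost everywhere constant. *)

Require Import Defs.
From HB Require Import structures.
From mathcomp Require Import all_boot all_order all_algebra.
From mathcomp Require Import all_classical all_reals all_analysis.
From mathcomp Require Import measurable_realfun ess_sup_inf zify ring lra.

Set Implicit Arguments.
Unset Strict Implicit.
Unset Printing Implicit Defensive.

Import Order.TTheory GRing.Theory Num.Theory.
Import numFieldNormedType.Exports.

Local Open Scope classical_set_scope.
Local Open Scope ring_scope.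

(** The obstacle is that [mu] need not be doubling, so averages over arbitrary balls escape covering
    arguments. Doubling balls restore [mu (3 B) <= beta * mu B] exactly where a Vitali selection
    needs it; in exchange, their existence at large and at small scales has to be proved. Each scale
    puts one condition on [beta]: [2 * Ca <= beta] makes some dilate of a ball doubling, through the
    growth of [lam], and [2 * N ^ m <= beta] gives small doubling balls around almost every point,
    through the counting of net points. The second obstacle is a priori finiteness. If [mu] is
    finite, the radii of the balls with average above a low level may be unbounded, so the levels
    start at a height t0 depending on [f]. It is chosen with t0^q times the integral of |f|^p
    comparable to the integral of |f|^(p+q), where r = p + q; the part of [T f] below t0 is then
    controlled by the L^p bound alone. The sum over levels is cut after K terms, each finite by the
    weak type estimate, so that absorption takes place between real numbers before K tends to
    infinity. *)

(** * Level sets, power integrals and elementary inequalities *)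

Section real_functions.
Context {R : realType} {d : measure_display} {X : measurableType d}.
Context (mu : {measure set X -> \bar R}).
Implicit Types (x : X) (r s t : R).

Lemma measure_bigsetU_seq_le (nu : {measure set X -> \bar R}) (I : Type)
    (s : seq I) (F : I -> set X) : (forall i, measurable (F i)) ->
  (nu (\big[setU/set0]_(i <- s) F i) <= \sum_(i <- s) nu (F i))%E.
Proof.
move=> mF; elim: s => [|i s IH]; first by rewrite !big_nil measure0.
rewrite !big_cons; apply: le_trans (measureU2 _ _ _) (leeD2l _ IH) => //.
exact: bigsetU_measurable.
Qed.

Lemma sum_measure_trivIset (nu : {measure set X -> \bar R}) (I : choiceType)
    (s : seq I) (F : I -> set X) : uniq s -> (forall i, measurable (F i)) ->
  trivIset [set` s] F ->
  (\sum_(i <- s) nu (F i) = nu (\big[setU/set0]_(i <- s) F i))%E.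
Proof.
by move=> us mF tF; rewrite fsbig_seq// -measure_fin_bigcup// bigcup_seq.
Qed.

(** Both integrals are suprema over the simple functions below the integrand, so monotonicity holds
    for nonnegative functions, measurable or not. *)
Lemma le_integral_ge0 (D : set X) (f g : X -> \bar R) :
  (forall x, D x -> 0 <= f x)%E -> (forall x, D x -> f x <= g x)%E ->
  (\int[mu]_(x in D) f x <= \int[mu]_(x in D) g x)%E.
Proof.
move=> f0 fg; rewrite !ge0_integralE//; last first.
  by move=> x Dx; apply: le_trans (fg x Dx); exact: f0.
apply: ereal_sup_le => _ [h hf <-]; exists h => //= x; apply: le_trans (hf x) _.
by rewrite /patch; case: ifPn => // /set_mem; exact: fg.
Qed.

Lemma measurable_EFin (f : X -> R) (D : set X) : measurable_fun [set: X] f ->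
  measurable_fun D ((EFin \o f) : X -> \bar R).
Proof. by move=> mf; apply: measurable_funTS; exact/measurable_EFinP. Qed.

Lemma measurable_ge_set (f : X -> R) t : measurable_fun [set: X] f ->
  measurable [set x | t <= f x].
Proof.
move=> mf; rewrite (_ : [set x | _] = f @^-1` `[t, +oo[).
  by rewrite -[X in measurable X]setTI; apply: mf => //; exact: measurable_itv.
by apply/seteqP; split=> x /=; rewrite in_itv/= andbT.
Qed.

Lemma measurable_gt_set (f : X -> R) t : measurable_fun [set: X] f ->
  measurable [set x | t < f x].
Proof.
move=> mf; rewrite (_ : [set x | _] = f @^-1` `]t, +oo[).
  by rewrite -[X in measurable X]setTI; apply: mf => //; exact: measurable_itv.
by apply/seteqP; split=> x /=; rewrite in_itv/= andbT.
Qed.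

Lemma measurable_le_set (f : X -> R) t : measurable_fun [set: X] f ->
  measurable [set x | f x <= t].
Proof.
move=> mf; rewrite (_ : [set x | _] = ~` [set x | t < f x]).
  by apply: measurableC; exact: measurable_gt_set.
by apply/seteqP; split=> x /=; [move=> ft; rewrite ltNge ft|move/negP; rewrite -leNgt].
Qed.

Lemma measurable_norm (f : X -> R) : measurable_fun [set: X] f ->
  measurable_fun [set: X] (fun x => `|f x|).
Proof. by move=> mf; exact: measurableT_comp. Qed.

Lemma measurable_norm_powR (p : R) (f : X -> R) : measurable_fun [set: X] f ->
  measurable_fun [set: X] (fun x => `|f x| `^ p).
Proof.
move=> mf; apply: (measurableT_comp (measurable_powR p)) => //.
exact: measurableT_comp.
Qed.

(** The [p]-th power of the L^p norm. Interpolation works with these powers, for which the estimates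
    stay linear in the integrals; the norms return only in the translation to [Lfun]. *)
Definition Lp_integral (p : R) (f : X -> R) : \bar R :=
  (\int[mu]_x (`|f x| `^ p)%:E)%E.

Lemma Lp_integral_ae_eq (p : R) (f g : X -> R) : measurable_fun [set: X] f ->
  measurable_fun [set: X] g -> {ae mu, forall x, f x = g x} ->
  Lp_integral p f = Lp_integral p g.
Proof.
move=> mf mg fg; apply: ge0_ae_eq_integral => //.
- exact/measurable_EFin/measurable_norm_powR.
- exact/measurable_EFin/measurable_norm_powR.
- by apply: filterS fg => x + _ => ->.
Qed.

Lemma Lp_integral_ge0 (p : R) (f : X -> R) : (0 <= Lp_integral p f)%E.
Proof. by apply: integral_ge0 => x _; rewrite lee_fin powR_ge0. Qed.

Lemma Lp_integral_eq0_ae (p : R) (f : X -> R) : measurable_fun [set: X] f ->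
  Lp_integral p f = 0%E -> {ae mu, forall x, f x = 0}.
Proof.
move=> mf If0.
have /(ae_eq_integral_abs mu measurableT) : measurable_fun [set: X]
    (EFin \o (fun x => `|f x| `^ p) : X -> \bar R).
  exact/measurable_EFin/measurable_norm_powR.
rewrite (_ : (\int[mu]_(x in _) _)%E = Lp_integral p f); last first.
  by apply: eq_integral => x _; rewrite gee0_abs// lee_fin powR_ge0.
move=> [/(_ If0) h _]; apply: filterS h => x /(_ I)/= [/powR_eq0_eq0].
by move/eqP; rewrite normr_eq0 => /eqP.
Qed.

Lemma Lp_integral_eq0 (p : R) (f : X -> R) : p != 0 -> measurable_fun [set: X] f ->
  {ae mu, forall x, f x = 0} -> Lp_integral p f = 0%E.
Proof.
move=> p0 mf f0; rewrite (@Lp_integral_ae_eq p f (fun=> 0))//.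
by rewrite /Lp_integral; under eq_integral do rewrite normr0 powR0//; rewrite integral0.
Qed.

Lemma powR_split_le (v s p q : R) : 0 <= v -> 0 < s -> 0 < p -> 0 < q ->
  v `^ p <= s `^ p + v `^ (p + q) / s `^ q.
Proof.
move=> v0 s0 p0 q0; have [vs|sv] := leP v s.
  rewrite ler_wpDr ?divr_ge0 ?powR_ge0// ge0_ler_powR ?nnegrE ?(ltW p0)//.
  exact: ltW.
rewrite ler_wpDl ?powR_ge0// ler_pdivlMr ?powR_gt0// powRD; last first.
  by rewrite gt_eqF// addr_gt0.
rewrite ler_wpM2l ?powR_ge0// ge0_ler_powR ?nnegrE ?(ltW q0)// ltW//.
Qed.

(** Serves to bound [mu setT] from below: if [s] makes the last term half of the left side, then
    [s ^ p * mu setT] carries the other half. *)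
Lemma Lp_integral_split_le (p q s : R) (f : X -> R) : measurable_fun [set: X] f ->
  0 < s -> 0 < p -> 0 < q ->
  (Lp_integral p f <= (s `^ p)%:E * mu setT +
     (s `^ q)^-1%:E * Lp_integral (p + q) f)%E.
Proof.
move=> mf s0 p0 q0.
rewrite -integral_cst// /Lp_integral -ge0_integralZl_EFin//; last 2 first.
- exact/measurable_EFin/measurable_norm_powR.
- by rewrite invr_ge0 powR_ge0.
rewrite -ge0_integralD//; last 3 first.
- by move=> x _; rewrite /= lee_fin powR_ge0.
- by move=> x _; rewrite -EFinM lee_fin mulr_ge0 ?invr_ge0 ?powR_ge0.
- by apply: measurable_funeM; exact/measurable_EFin/measurable_norm_powR.
apply: le_integral_ge0 => x _; first by rewrite lee_fin powR_ge0.
by rewrite /= -EFinM -EFinD lee_fin [X in _ + X]mulrC; exact: powR_split_le.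
Qed.

Lemma Lp_integral_restrict (a : R) (f : X -> R) (A : set X) : a != 0 ->
  Lp_integral a (fun x => f x * \1_A x) = (\int[mu]_(x in A) (`|f x| `^ a)%:E)%E.
Proof.
move=> a0; rewrite /Lp_integral [RHS]integral_mkcond; apply: eq_integral => x _.
rewrite /patch indicE; case: ifPn => _; rewrite ?mulr1//.
by rewrite mulr0 normr0 powR0.
Qed.

Lemma Lp_integral_restrict_le (a : R) (f : X -> R) (A : set X) : a != 0 ->
  (Lp_integral a (fun x => (f x * \1_A x)%R) <= Lp_integral a f)%E.
Proof.
move=> a0; apply: le_integral_ge0 => x _; first by rewrite lee_fin powR_ge0.
rewrite lee_fin indicE; case: (x \in A); rewrite ?mulr1//.
by rewrite mulr0 normr0 powR0// powR_ge0.
Qed.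

(** A substitute for Hoelder's inequality on a ball: the constant [s] integrates to a multiple of
    the measure of the ball, the other term to an L^p integral. *)
Lemma le_add_powR (u s p : R) : 0 <= u -> 0 < s -> 1 <= p ->
  u <= s + u `^ p / s `^ (p - 1).
Proof.
move=> u0 s0 p1; have [us|su] := leP u s.
  by rewrite ler_wpDr// divr_ge0// powR_ge0.
rewrite ler_wpDl//; first exact: ltW.
rewrite ler_pdivlMr ?powR_gt0//.
rewrite -(@mulr_powRB1 _ u p)//; last by rewrite (lt_le_trans ltr01).
by rewrite ler_wpM2l// ge0_ler_powR// ?nnegrE ?subr_ge0// ltW.
Qed.

Lemma lt_exp2_ex (c : R) : exists k : nat, c < 2 ^+ k.
Proof.
exists (Num.bound `|c|).
apply: (lt_trans (le_lt_trans (ler_norm c) (archi_boundP (normr_ge0 c)))).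
by rewrite -natrX ltr_nat ltn_expl.
Qed.

End real_functions.

(** * Nets, the Lindelof property and Vitali selection *)

Section metric_balls.
Context {R : realType} {d : measure_display} {X : metricMeasurableType d R}.
Implicit Types (x y z : X) (r s : R).

Lemma ballE x r y : ball x r y = (mdist x y < r) :> Prop.
Proof. by rewrite ballEmdist. Qed.

Lemma sub_ball x y r s : mdist x y + r <= s -> ball y r `<=` ball x s.
Proof.
move=> rs z; rewrite !ballE => yz.
by rewrite (le_lt_trans (metric_triangle x y z))// (lt_le_trans _ rs)// ltrD2l.
Qed.

Lemma bigcup_ball x : \bigcup_n ball x n%:R = [set: X].
Proof.
apply/seteqP; split=> // y _; exists (Num.bound (mdist x y)) => //.
by rewrite ballE; apply: archi_boundP; exact: mdist_ge0.
Qed.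

Lemma open_ball_metric x r : open (ball x r : set X).
Proof.
rewrite openE => y; rewrite ballE => xy; apply/nbhs_ballP.
exists (r - mdist x y) => /=; first by rewrite subr_gt0.
by apply: sub_ball; rewrite addrC subrK.
Qed.

Lemma openP_ball (U : set X) x : open U -> U x ->
  exists2 e : R, 0 < e & ball x e `<=` U.
Proof.
by rewrite openE => /(_ x) /[apply] /nbhs_ballP[e e0 eU]; exists e.
Qed.

Lemma finite_net (doublingX : geometrically_doubling X) :
  exists N : nat, forall (k : nat) x r, 0 < r ->
    exists2 s : seq X, (size s <= N ^ k)%N &
      ball x r `<=` \bigcup_(y in [set` s]) ball y (r / 2 ^+ k).
Proof.
have [N H] := doublingX; exists N; elim=> [|k IH] x r r0.
  exists [:: x]; first by [].
  by move=> y xy; exists x; rewrite /= ?mem_head// expr0 divr1.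
have [s sN cov] := IH x r r0.
have r1 : 0 < r / 2 ^+ k by rewrite divr_gt0// exprn_gt0.
have /choice[g gP] : forall y, exists t : seq X, (size t <= N)%N /\
    ball y (r / 2 ^+ k) `<=` \bigcup_(z in [set` t]) ball z (r / 2 ^+ k.+1).
  move=> y; have [t tN tP] := H y _ r1; exists t; split=> //.
  by rewrite exprSr invfM mulrA.
exists (flatten [seq g y | y <- s]).
  rewrite expnS mulnC; apply: leq_trans (leq_mul sN (leqnn N)).
  elim: s {sN cov} => //= y s IHs.
  by rewrite size_cat mulSn leq_add// (gP y).1.
move=> y /cov[z /= zs /(gP z).2[w /= wg yw]]; exists w => //=.
by apply/flatten_mapP; exists z.
Qed.

(* A geometrically doubling space is separable, hence Lindelof. *)
Lemma measure_bigcup_open_le (doublingX : geometrically_doubling X)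
    (nu : {measure set X -> \bar R}) (borelX : borel_sigma_algebra X)
    (I : choiceType) (D : set I) (U : I -> set X) (M : \bar R) :
  (forall i, open (U i)) ->
  (forall s : seq I, (forall i, i \in s -> D i) ->
     (nu (\big[setU/set0]_(i <- s) U i) <= M)%E) ->
  (nu (\bigcup_(i in D) U i) <= M)%E.
Proof.
move=> oU sM.
have mU i : measurable (U i).
  by rewrite borelX; apply: sub_sigma_algebra; exact: oU.
have [->|/set0P[x0 _]] := eqVneq (\bigcup_(i in D) U i) set0.
  by have := sM [::]; rewrite big_nil; apply.
have [N net] := finite_net doublingX.
have /choice[s sP] : forall nk : nat * nat, exists s : seq X,
    ball x0 nk.1.+1%:R `<=` \bigcup_(y in [set` s]) ball y (nk.1.+1%:R / 2 ^+ nk.2).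
  by move=> [n k]; have [//|s _ sP] := net k x0 n.+1%:R; exists s.
pose c (t : nat * nat * nat) := nth x0 (s t.1) t.2.
pose rad (t : nat * nat * nat) : R := t.1.1.+1%:R / 2 ^+ t.1.2.
(* Every code [m] of a net ball selects one index of [D] whose open set contains that ball, if there
   is one. The selected countable subfamily has the same union. *)
have /choice[g gP] : forall m : nat, exists o : option I,
    (forall i, o = Some i -> D i) /\
    (forall t i, unpickle m = Some t -> D i -> ball (c t) (rad t) `<=` U i ->
      exists2 j, o = Some j & ball (c t) (rad t) `<=` U j).
  move=> m; case mt : (unpickle m) => [t|]; last first.
    by exists None; split.
  have [[i [Di iU]]|no] :=
      pselect (exists i, D i /\ ball (c t) (rad t) `<=` U i).
    exists (Some i); split=> [j [<-]//|t' j [<-] Dj jU].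
    by exists i.
  exists None; split=> // t' j [<-] Dj jU.
  by exfalso; apply: no; exists j.
pose F m := if g m is Some i then U i else set0.
have FU : \bigcup_(i in D) U i = \bigcup_m F m.
  apply/seteqP; split=> [x [i Di Uix]|x [m _]]; last first.
    rewrite /F; case gm : (g m) => [i|//] Uix; exists i => //.
    exact: (gP m).1 _ gm.
  have [e e0 eU] := openP_ball (oU i) Uix.
  have [n xn] : exists n : nat, ball x0 n.+1%:R x.
    have [n _ xn] : (\bigcup_n ball x0 n%:R) x by rewrite bigcup_ball.
    by exists n; apply: le_ball xn; rewrite ler_nat.
  have [k] := lt_exp2_ex (n.+1%:R / (e / 2)).
  rewrite ltr_pdivrMr ?divr_gt0// mulrC -ltr_pdivrMr ?exprn_gt0// => ke.
  have [y /= ys yx] := sP (n, k) x xn.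
  have [j js yj] : exists2 j, (j < size (s (n, k)))%N & nth x0 (s (n, k)) j = y.
    by exists (index y (s (n, k))); rewrite ?index_mem// nth_index.
  have [|j' gj jU] := (gP (pickle (n, k, j))).2 (n, k, j) i (pickleK _) Di.
    apply: subset_trans eU; rewrite /c /rad/= yj; apply: sub_ball.
    move: yx; rewrite ballE metric_sym => yx.
    by rewrite (splitr e) lerD// ltW// (lt_trans yx).
  exists (pickle (n, k, j)) => //; rewrite /F gj; apply: jU.
  by rewrite /c/= yj.
have mF m : measurable (F m) by rewrite /F; case: (g m).
rewrite FU -bigcup_bigsetU_bigcup.
have cv : nu (\big[setU/set0]_(m < n.+1) F m) @[n --> \oo] -->
    nu (\bigcup_n \big[setU/set0]_(m < n.+1) F m).
  apply: nondecreasing_cvg_mu.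
  - by move=> n; exact: bigsetU_measurable.
  - by apply: bigcup_measurable => n _; exact: bigsetU_measurable.
  - apply/nondecreasing_seqP => n; rewrite [leRHS]big_ord_recr/=.
    by apply/subsetPset; exact: subsetUl.
rewrite -(cvg_lim _ cv)//.
apply: lime_le.
  by apply/cvg_ex; eexists; exact: cv.
apply: nearW => n /=.
pose t := pmap g (iota 0 n.+1).
apply: le_trans (sM t _); last first.
  by move=> i; rewrite mem_pmap => /mapP[m _ /esym]; exact: (gP m).1.
apply: le_measure; rewrite ?inE.
- exact: bigsetU_measurable.
- exact: bigsetU_measurable.
rewrite -(big_mkord xpredT F) -!bigcup_seq.
move=> x [m /= mn]; rewrite /F; case gm : (g m) => [i|//] Uix.
exists i => //=; rewrite mem_pmap; apply/mapP; exists m => //.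
Qed.

(** Greedy selection: keep a ball of largest radius, discard the balls that meet it, and recurse.
    The comparison of radii is recorded because [measure_cover_le] uses sets that grow with the
    radius. *)
Lemma vitali_finite (s : seq (X * R)) : (forall q, q \in s -> 0 < q.2) ->
  exists t : seq (X * R), [/\ uniq t, {subset t <= s},
    trivIset [set` t] (fun q => ball q.1 q.2 : set X) &
    forall q, q \in s -> exists2 q', q' \in t &
      q.2 <= q'.2 /\ ball q.1 q.2 `<=` ball q'.1 (3 * q'.2)].
Proof.
move: {2}(size s) (leqnn (size s)) => n; elim: n s => [|n IH] s.
  by rewrite leqn0 size_eq0 => /eqP-> _; exists [::]; split.
have [->|s0] := eqVneq s [::]; first by move=> _ _; exists [::]; split.
move=> sn spos.
have [m ms mmax] : exists2 m, m \in s & forall q, q \in s -> q.2 <= m.2.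
  elim: s {sn spos IH} s0 => // a s IHs _.
  have [->|/IHs[m ms mmax]] := eqVneq s [::].
    exists a; rewrite ?mem_head// => q.
    by rewrite inE => /eqP->.
  have [am|/ltW ma] := leP a.2 m.2.
    exists m; rewrite ?inE ?ms ?orbT// => q.
    by rewrite inE => /orP[/eqP->//|/mmax].
  exists a; rewrite ?mem_head// => q; rewrite inE => /orP[/eqP->//|/mmax qm].
  exact: le_trans ma.
pose dj (q : X * R) := `[< ball q.1 q.2 `&` ball m.1 m.2 = set0 :> set X >].
have mm : ~~ dj m.
  apply/asboolPn => /seteqP[+ _] => /(_ m.1); apply.
  by rewrite setIid ballE mdistxx; exact: spos.
have [||t [ut ts tt tP]] := IH [seq q <- s | dj q].
- rewrite -ltnS; apply: leq_trans sn; rewrite size_filter.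
  rewrite -(count_predC dj s) -[ltnLHS]addn0 ltn_add2l -has_count.
  by apply/hasP; exists m.
- by move=> q; rewrite mem_filter => /andP[_ /spos].
have tdj q : q \in t -> ball q.1 q.2 `&` ball m.1 m.2 = set0 :> set X.
  by move=> /ts; rewrite mem_filter => /andP[/asboolP].
exists (m :: t); split.
- rewrite /= ut andbT; apply/negP => /ts.
  by rewrite mem_filter (negbTE mm).
- move=> q; rewrite inE => /orP[/eqP->//|/ts]; rewrite mem_filter.
  by move=> /andP[].
- move=> q q' /=; rewrite !inE => /orP[/eqP->|qt] /orP[/eqP->|q't]//.
  + by rewrite setIC tdj// => -[].
  + by rewrite tdj// => -[].
  + exact: tt.
move=> q qs; have [qdj|/asboolPn qndj] := boolP (dj q).
  have [|q' q't q'P] := tP q; first by rewrite mem_filter qdj.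
  by exists q'; rewrite // inE q't orbT.
exists m; rewrite ?mem_head//; split; first exact: mmax.
have /set0P[z [qz mz]] : ball q.1 q.2 `&` ball m.1 m.2 != set0 :> set X.
  exact/eqP.
apply: sub_ball; move: qz mz; rewrite !ballE => qz mz.
have := metric_triangle m.1 z q.1; rewrite (metric_sym z) => mq.
have := mmax _ qs; lra.
Qed.

(** The sets [E r] tie what is measured in a ball to its scale. A discarded ball has a smaller
    radius than the selected ball that absorbs it, so monotonicity of [E] moves its piece into the
    piece of the selected ball. The general [nu] allows [mu] restricted to the complement of an
    exceptional set. *)
Lemma measure_cover_le (doublingX : geometrically_doubling X)
    (nu : {measure set X -> \bar R}) (borelX : borel_sigma_algebra X)
    (P : set (X * R)) (E : R -> set X) (M : \bar R) :
  (forall q, P q -> 0 < q.2) ->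
  (forall r, open (E r)) -> (forall r s, r <= s -> E r `<=` E s) ->
  (forall t : seq (X * R), uniq t -> (forall q, q \in t -> P q) ->
     trivIset [set` t] (fun q => ball q.1 q.2 : set X) ->
     (\sum_(q <- t) nu (ball q.1 (3 * q.2) `&` E q.2) <= M)%E) ->
  (nu (\bigcup_(q in P) (ball q.1 q.2 `&` E q.2)) <= M)%E.
Proof.
move=> P0 oE ndE H.
have mo (U : set X) : open U -> measurable U.
  by move=> oU; rewrite borelX; exact: sub_sigma_algebra.
apply: measure_bigcup_open_le => //.
  by move=> q; apply: openI => //; exact: open_ball_metric.
move=> s sP; have [|t [ut ts tt tP]] := @vitali_finite s.
  by move=> q /sP/P0.
apply: le_trans (H t ut _ tt); last by move=> q /ts/sP.
apply: le_trans (measure_bigsetU_seq_le _ _ _); last first.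
  by move=> q; apply: mo; apply: openI => //; exact: open_ball_metric.
have mU (u : seq (X * R)) (f : X * R -> R) : measurable
    (\big[setU/set0]_(q <- u) (ball q.1 (f q) `&` E q.2) : set X).
  apply: bigsetU_measurable => q _.
  by apply: mo; apply: openI => //; exact: open_ball_metric.
apply: le_measure; rewrite ?inE//.
rewrite -!bigcup_seq => x [q /= qs [qx Ex]].
have [q' q't [qq' sub]] := tP q qs; exists q' => //=; split; first exact: sub.
exact: ndE Ex.
Qed.

End metric_balls.

(** * Doubling balls and the maximal function over them *)

Section doubling_balls.
Context {R : realType} {d : measure_display} {X : metricMeasurableType d R}.
Context (mu : {measure set X -> \bar R}).
Context (borelX : borel_sigma_algebra X) (doublingX : geometrically_doubling X).
Implicit Types (x y z : X) (r s t : R) (q : X * R).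

Lemma measurable_open_set (U : set X) : open U -> measurable U.
Proof. by move=> oU; rewrite borelX; exact: sub_sigma_algebra. Qed.

Lemma measurable_metric_ball x r : measurable (ball x r : set X).
Proof. by apply: measurable_open_set; exact: open_ball_metric. Qed.
Hint Resolve measurable_metric_ball : core.


Context (alpha beta : R).

(* A pair (x, r) stands for the ball B(x, r). With [alpha] a power of 2 and [beta]
   large, as assumed further down, mu-almost every point is the centre of
   arbitrarily small doubling balls and every ball of positive measure has a
   doubling dilate. *)
Definition doubling_ball q : Prop :=
  0 < q.2 /\ (mu (ball q.1 (alpha * q.2)) <= beta%:E * mu (ball q.1 q.2))%E.

Definition average_gt (phi : X -> R) t q : Prop :=
  (t%:E * mu (ball q.1 q.2) < \int[mu]_(y in ball q.1 q.2) (phi y)%:E)%E.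

(* The set where the noncentred maximal function over doubling balls of radius
   at most [r] exceeds [t]. *)
Definition maximal_gt_upto (phi : X -> R) t r : set X :=
  \bigcup_(q in [set q | [/\ doubling_ball q, average_gt phi t q & q.2 <= r]])
    ball q.1 q.2.

Definition maximal_gt (phi : X -> R) t : set X :=
  \bigcup_(q in [set q | doubling_ball q /\ average_gt phi t q]) ball q.1 q.2.

Lemma open_maximal_gt phi t : open (maximal_gt phi t).
Proof. by apply: bigcup_open => q _; exact: open_ball_metric. Qed.

Lemma open_maximal_gt_upto phi t r : open (maximal_gt_upto phi t r).
Proof. by apply: bigcup_open => q _; exact: open_ball_metric. Qed.

Lemma measurable_maximal_gt phi t : measurable (maximal_gt phi t).
Proof. by apply: measurable_open_set; exact: open_maximal_gt. Qed.
Hint Resolve measurable_maximal_gt : core.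

Context (alpha_ge3 : 3 <= alpha) (beta_gt0 : 0 < beta).

Lemma measure_triple_doubling_ball q : doubling_ball q ->
  (mu (ball q.1 (3 * q.2)) <= beta%:E * mu (ball q.1 q.2))%E.
Proof.
move=> [q0 dq]; apply: le_trans dq.
apply: le_measure; rewrite ?inE//; apply: le_ball.
by rewrite ler_wpM2r// ltW.
Qed.

(** Vitali selection: tripling a selected ball costs [beta], its measure is at most [t^-1] times the
    integral of [phi] over it, and disjointness adds the integrals up. The radii may be unbounded,
    since the Lindelof property reduces to finite families first. *)
Lemma weak_type_maximal (phi : X -> R) t : measurable_fun [set: X] phi ->
  (forall x, 0 <= phi x) -> 0 < t ->
  (mu (maximal_gt phi t) <= (beta / t)%:E * \int[mu]_x (phi x)%:E)%E.
Proof.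
move=> mphi phi0 t0.
have -> : maximal_gt phi t = \bigcup_(q in [set q | doubling_ball q /\
    average_gt phi t q]) (ball q.1 q.2 `&` setT).
  by apply: eq_bigcupr => q _; rewrite setIT.
apply: (@measure_cover_le _ _ _ doublingX mu borelX _ (fun=> setT)) => //.
- by move=> q [[]].
- by move=> _; exact: openT.
move=> s us sP ts.
apply: (@le_trans _ _ (\sum_(q <- s) (beta / t)%:E *
    \int[mu]_(y in ball q.1 q.2) (phi y)%:E)%E).
  rewrite big_seq [leRHS]big_seq; apply: lee_sum => q /sP[dq aq].
  rewrite setIT; apply: (le_trans (measure_triple_doubling_ball dq)).
  rewrite EFinM -muleA; apply: lee_wpmul2l; first by rewrite lee_fin ltW.
  by rewrite lee_pdivlMl//; exact: ltW.
rewrite -ge0_sume_distrr; last by move=> q _; apply: integral_ge0 => y _; rewrite lee_fin.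
apply: lee_wpmul2l; first by rewrite lee_fin divr_ge0// ltW.
rewrite -(@ge0_integral_bigsetU _ _ _ mu _ (fun q : X * R => ball q.1 q.2 : set X))//=; last 2 first.
- exact: measurable_EFin.
- by move=> x _; rewrite lee_fin.
apply: ge0_subset_integral => //.
- exact: bigsetU_measurable.
- exact: measurable_EFin.
- by move=> x _; rewrite lee_fin.
Qed.



(** Jensen's inequality up to a factor 2 in the level: [le_add_powR] with [s = t / 2] spends one
    half of [t] on the constant term. *)
Lemma average_gt_powR (p t : R) (f : X -> R) q :
  measurable_fun [set: X] f -> 1 <= p -> 0 < t ->
  (mu (ball q.1 q.2) < +oo)%E -> average_gt (fun x => `|f x|) t q ->
  average_gt (fun x => `|f x| `^ p) ((t / 2) `^ p) q.
Proof.
move=> mf p1 t0 fq; rewrite /average_gt => ft.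
have t20 : 0 < t / 2 by rewrite divr_gt0.
have p0 : 0 < p by rewrite (lt_le_trans ltr01).
have : (t%:E * mu (ball q.1 q.2) < (t / 2)%:E * mu (ball q.1 q.2) +
    ((t / 2) `^ (p - 1))^-1%:E * \int[mu]_(y in ball q.1 q.2) (`|f y| `^ p)%:E)%E.
  apply: lt_le_trans ft _.
  rewrite -integral_cst// -ge0_integralZl_EFin//; last 2 first.
  - exact/measurable_EFin/measurable_norm_powR.
  - by rewrite invr_ge0 powR_ge0.
  rewrite -ge0_integralD//; last 3 first.
  - by move=> x _; rewrite lee_fin ltW.
  - by move=> x _; rewrite -EFinM lee_fin mulr_ge0// ?invr_ge0 powR_ge0.
  - under eq_fun do rewrite -EFinM.
    by apply: measurable_EFin; apply: measurable_funM => //; exact: measurable_norm_powR.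
  apply: le_integral_ge0 => x _; first by rewrite lee_fin.
  by rewrite /= -EFinM -EFinD lee_fin [X in _ + X]mulrC; exact: le_add_powR.
have mf_fin : mu (ball q.1 q.2) \is a fin_num by rewrite ge0_fin_numE.
rewrite -(fineK mf_fin) -!EFinM.
set I := (\int[mu]_(_ in _) _)%E => h.
have -> : (t / 2) `^ p = (t / 2) * (t / 2) `^ (p - 1).
  by rewrite mulr_powRB1// ltW.
move: h; set m := fine _.
have s0 : 0 < (t / 2) `^ (p - 1) by rewrite powR_gt0.
have I0 : (0 <= I)%E by apply: integral_ge0 => y _; rewrite lee_fin powR_ge0.
case: I I0 => [i||] //= i0; last by move=> _; rewrite ltry.
rewrite -EFinM -EFinD !lte_fin => h.
have : t / 2 * m < (((t / 2) `^ (p - 1))^-1 * i) by lra.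
by rewrite [X in _ < X -> _]mulrC ltr_pdivlMr// mulrAC.
Qed.

Lemma weak_type_maximal_powR (p t : R) (f : X -> R) :
  measurable_fun [set: X] f -> 1 <= p -> 0 < t ->
  (forall q, (mu (ball q.1 q.2) < +oo)%E) ->
  (mu (maximal_gt (fun x => `|f x|%R) t) <=
     (beta / (t / 2) `^ p)%:E * Lp_integral mu p f)%E.
Proof.
move=> mf p1 t0 fin.
apply: le_trans (weak_type_maximal _ _ _); last 3 first.
- exact: measurable_norm_powR.
- by move=> x; rewrite powR_ge0.
- by rewrite powR_gt0// divr_gt0.
apply: le_measure; rewrite ?inE//.
move=> x [q [dq aq] qx]; exists q => //; split=> //.
exact: average_gt_powR.
Qed.

Context (ball_fin : forall x r, (mu (ball x r) < +oo)%E).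

Definition ball_measure x r : R := fine (mu (ball x r)).

Lemma ball_measureE x r : mu (ball x r) = (ball_measure x r)%:E.
Proof. by rewrite fineK// ge0_fin_numE. Qed.

Lemma ball_measure_ge0 x r : 0 <= ball_measure x r.
Proof. exact: fine_ge0. Qed.

Lemma le_ball_measure x y r s : ball x r `<=` ball y s ->
  ball_measure x r <= ball_measure y s.
Proof.
by move=> xy; rewrite -lee_fin -!ball_measureE; apply: le_measure; rewrite ?inE.
Qed.

Context (lam : X -> R -> R) (ud : upper_doubling mu lam).

Lemma dominating_dilate (k : nat) : exists C : R, 1 <= C /\
  forall x r, 0 < r -> lam x (2 ^+ k * r) <= C * lam x r.
Proof.
have [C0 HC] := dominating_doubling ud.
exists (Num.max 1 C0 ^+ k); split; first by rewrite exprn_ege1// le_max lexx.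
move=> x r r0; elim: k => [|k IH]; first by rewrite !expr0 !mul1r.
rewrite exprS -mulrA; apply: le_trans (HC _ _ _) _.
  by rewrite mulr_gt0// exprn_gt0.
rewrite exprS -mulrA; apply: ler_pM => //.
- have := HC x r r0; have := dominating_gt0 ud x r0.
  have := @dominating_gt0 _ _ _ _ _ ud x (2 * r).
  rewrite mulr_gt0// => /(_ isT) l2 l1 h.
  by rewrite -(pmulr_lge0 _ l1) (le_trans (ltW l2)).
- by rewrite ltW// (dominating_gt0 ud)// mulr_gt0// exprn_gt0.
- by rewrite le_max lexx orbT.
Qed.

Context (Ca : R) (Ca_ge1 : 1 <= Ca) (beta_large : 2 * Ca <= beta)
  (lam_dilate : forall x r, 0 < r -> lam x (alpha * r) <= Ca * lam x r).

Lemma ball_measure_le_lam x r : 0 < r -> ball_measure x r <= lam x r.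
Proof. by move=> r0; rewrite -lee_fin -ball_measureE; exact: dominating_measure. Qed.

(* As long as the dilates of a ball by powers of [alpha] are not doubling, their
   measure grows by a factor [2 * Ca] at each step and [lam] by at most [Ca]; so
   mu / lam at least doubles, the process stops, and the annuli in Kcoef
   contribute a geometric series. *)
Lemma doubling_dilate_exists z s : 0 < s -> (0 < mu (ball z s))%E ->
  exists j : nat, doubling_ball (z, alpha ^+ j * s) /\
    (Kcoef mu lam z s (alpha ^+ j * s) <= (1 + 3 * Ca)%:E)%E.
Proof.
move=> s0; rewrite ball_measureE lte_fin => ms0.
have a0 : 0 < alpha by rewrite (lt_le_trans _ alpha_ge3).
have Ca0 : 0 < Ca by rewrite (lt_le_trans _ Ca_ge1).
pose rad i := alpha ^+ i * s.
have rad0 i : 0 < rad i by rewrite mulr_gt0// exprn_gt0.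
have radS i : rad i.+1 = alpha * rad i by rewrite /rad exprS mulrA.
pose a i := ball_measure z (rad i); pose L i := lam z (rad i).
have L0 i : 0 < L i by exact: (dominating_gt0 ud).
have aL i : a i <= L i by exact: ball_measure_le_lam.
have LS i : L i.+1 <= Ca * L i by rewrite /L radS lam_dilate.
have notdbl i : ~ doubling_ball (z, rad i) -> 2 * Ca * a i <= a i.+1.
  move=> nd; rewrite leNgt; apply/negP => lt; apply: nd; split=> //=.
  rewrite -radS !ball_measureE -EFinM lee_fin -/(a i.+1) -/(a i) ltW//.
  apply: (lt_le_trans lt); rewrite ler_wpM2r//; exact: ball_measure_ge0.
have Lpow i k : L (i + k)%N <= Ca ^+ k * L i.
  elim: k => [|k IH]; first by rewrite addn0 expr0 mul1r.
  rewrite addnS; apply: (le_trans (LS _)); rewrite exprS -mulrA.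
  by rewrite ler_wpM2l// ltW.
have apow i k : (forall l, (l < k)%N -> ~ doubling_ball (z, rad (i + l)%N)) ->
    (2 * Ca) ^+ k * a i <= a (i + k)%N.
  elim: k => [|k IH] nd; first by rewrite addn0 expr0 mul1r.
  rewrite addnS exprS -mulrA; apply: le_trans (notdbl _ _); last exact: nd.
  rewrite ler_wpM2l ?mulr_ge0 ?(ltW Ca0)//.
  by apply: IH => l lk; apply: nd; exact: ltnW.
(* By [apow] and [Lpow], [(2 Ca)^k a i <= a (i + k) <= L (i + k) <= Ca^k L i]; now cancel [Ca^k]. *)
have expow i k : (forall l, (l < k)%N -> ~ doubling_ball (z, rad (i + l)%N)) ->
    2 ^+ k * a i <= L i.
  move=> /apow h; rewrite -(ler_pM2l (exprn_gt0 k Ca0)).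
  apply: le_trans (Lpow i k); apply: le_trans (aL _); apply: le_trans h.
  by rewrite exprMn mulrA [X in X * _]mulrC.
have ex : exists j, `[< doubling_ball (z, rad j) >].
  apply: contrapT => nex.
  have [k] := lt_exp2_ex (L 0%N / a 0%N).
  have a00 : 0 < a 0%N by rewrite /a /rad expr0 mul1r.
  rewrite ltr_pdivrMr// ltNge => /negP; apply; apply: expow => l _ dl.
  by apply: nex; exists (0 + l)%N; apply/asboolP.
pose j := ex_minn ex; exists j.
have [dj minj] : doubling_ball (z, rad j) /\
    forall l, (l < j)%N -> ~ doubling_ball (z, rad l).
  rewrite /j; case: ex_minnP => k /asboolP dk kmin; split=> // l lk /asboolP dl.
  by have := kmin _ dl; rewrite leqNgt lk.
split=> //.
rewrite /Kcoef EFinD; apply: leeD2l.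
(* On the annulus between [rad i] and [rad i.+1] the integrand is at most [(L i)^-1], and enlarging
   the annulus to the full ball is affordable. There are [j.+1] terms because the domain of Kcoef
   contains the outer sphere of radius [rad j]. *)
pose g i (y : X) := (((L i)^-1)%:E * (\1_(ball z (rad i.+1) : set X) y)%:E)%E.
have g0 i y : (0 <= g i y)%E.
  by rewrite /g -EFinM lee_fin mulr_ge0// invr_ge0 ltW.
apply: (@le_trans _ _ (\int[mu]_y (\sum_(i <- iota 0 j.+1) g i y))%E).
  rewrite integral_mkcond; apply: le_integral_ge0 => y _.
    rewrite /patch; case: ifPn => // /set_mem/= /andP[sy _].
    by rewrite lee_fin invr_ge0 ltW// (dominating_gt0 ud)// (lt_le_trans s0).
  rewrite /patch; case: ifPn => [/set_mem/= /andP[sy ys]|_]; last first.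
    by apply: sume_ge0 => i _.
  have exi : exists i, mdist z y < rad i.+1.
    exists j; apply: (le_lt_trans ys); rewrite -/(rad j) radS.
    by rewrite ltr_pMl// (lt_le_trans _ alpha_ge3)// ltr1n.
  pose i := ex_minn exi.
  have [yi imin] : mdist z y < rad i.+1 /\
     forall l, mdist z y < rad l.+1 -> (i <= l)%N by rewrite /i; case: ex_minnP.
  have ij : (i < j.+1)%N.
    rewrite ltnS; apply: imin; apply: (le_lt_trans ys); rewrite -/(rad j) radS.
    by rewrite ltr_pMl// (lt_le_trans _ alpha_ge3)// ltr1n.
  have iy : rad i <= mdist z y.
    move: imin; case: (i) => [_|i' imin]; first by rewrite /rad expr0 mul1r.
    by rewrite leNgt; apply/negP => /imin; rewrite ltnn.
  have imem : i \in iota 0 j.+1 by rewrite mem_iota.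
  rewrite (big_rem i imem)/=.
  rewrite -[leLHS]adde0; apply: leeD; last by apply: sume_ge0 => l _.
  rewrite /g indicE mem_set ?mule1/=; last by rewrite ballE.
  rewrite lee_fin lef_pV2 ?posrE ?(dominating_nondecreasing ud)//.
  by rewrite (dominating_gt0 ud)// (lt_le_trans s0).
rewrite ge0_integral_sum//; last first.
  by move=> i; apply: measurable_funeM; exact/measurable_EFin/measurable_indic.
have Eg i : (\int[mu]_y g i y = (a i.+1 / L i)%:E)%E.
  rewrite ge0_integralZl_EFin//; last 2 first.
  - exact/measurable_EFin/measurable_indic.
  - by rewrite invr_ge0 ltW.
  by rewrite integral_indic// setIT ball_measureE -EFinM mulrC.
under eq_bigr do rewrite Eg.
rewrite sumEFin lee_fin.
(* No dilate before the [j]-th is doubling, so [2 ^ (j - i.+1) * a i.+1 <= L i.+1 <= Ca * L i]. *)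
have term i : (i < j)%N -> a i.+1 / L i <= Ca * 2 ^+ i.+1 / 2 ^+ j.
  move=> ij; rewrite ler_pdivrMr//.
  have h := @expow i.+1 (j - i.+1)%N _.
  have {h} h1 : 2 ^+ (j - i.+1) * a i.+1 <= L i.+1.
    apply: h => l lj; apply: minj; move: lj; rewrite ltn_subRL; lia.
  have e2 : 2 ^+ j = 2 ^+ (j - i.+1) * 2 ^+ i.+1 :> R by rewrite -exprD subnK.
  have e20 : (0 : R) < 2 ^+ (j - i.+1) by rewrite exprn_gt0.
  have e30 : (0 : R) < 2 ^+ i.+1 by rewrite exprn_gt0.
  have := LS i; move: e2 e20 e30 h1.
  set u := 2 ^+ (j - i.+1); set v := 2 ^+ i.+1 => -> u0 v0 h1 h2.
  have -> : Ca * v / (u * v) * L i = Ca * L i / u by field; rewrite !gt_eqF.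
  by rewrite ler_pdivlMr// mulrC (le_trans h1).
rewrite -{1}[j.+1]addn1 iotaD big_cat/= big_seq1.
(* The geometric sum over [i < j] gives at most [2 * Ca]; the last term [i = j] gives at most
   [Ca]. *)
have -> : 3 * Ca = 2 * Ca + Ca by ring.
apply: lerD; last first.
  rewrite add0n ler_pdivrMr//; apply: le_trans (aL _) _; exact: LS.
apply: (@le_trans _ _ (\sum_(i <- iota 0 j) Ca * 2 ^+ i.+1 / 2 ^+ j)).
  rewrite big_seq [leRHS]big_seq; apply: ler_sum => i.
  by rewrite mem_iota => /term.
rewrite -mulr_suml -mulr_sumr ler_pdivrMr ?exprn_gt0// mulrAC mulrC.
rewrite ler_wpM2r ?(ltW Ca0)//.
have -> : \sum_(i <- iota 0 j) 2 ^+ i.+1 = 2 * 2 ^+ j - 2 :> R.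
  elim: (j) => [|k IH]; first by rewrite /= big_nil expr0 mulr1 subrr.
  rewrite -{1}[k.+1]addn1 iotaD big_cat/= big_seq1 IH add0n !exprS; ring.
by rewrite lerBlDr lerDl.
Qed.

(** * Outer regularity, small doubling balls and differentiation *)

(** The sets squeezed between a closed and an open set up to small measure form a sigma-algebra
    containing the open sets. The closed set is carried along to make the property stable under
    complements. *)
Lemma outer_regular_finite (nu : {measure set X -> \bar R}) (A : set X) (e : R) :
  (nu setT < +oo)%E -> measurable A -> 0 < e ->
  exists U : set X, [/\ open U, A `<=` U & (nu (U `\` A) <= e%:E)%E].
Proof.
move=> nufin mA e0.
pose reg (A : set X) := forall e : R, 0 < e -> exists F U : set X,
  [/\ closed F, open U, F `<=` A, A `<=` U & (nu (U `\` F) <= e%:E)%E].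
suff : reg A.
  move=> /(_ e e0)[F [U [cF oU FA AU FU]]]; exists U; split=> //.
  apply: le_trans FU; apply: le_measure; rewrite ?inE.
  - by apply: measurableD => //; exact: measurable_open_set.
  - apply: measurableD; first exact: measurable_open_set.
    by rewrite -(setCK F); apply: measurableC; apply: measurable_open_set; exact: closed_openC.
  - by apply: setDS.
have mD (U F : set X) : open U -> closed F -> measurable (U `\` F).
  move=> oU cF; apply: measurableD; first exact: measurable_open_set.
  by rewrite -(setCK F); apply: measurableC; apply: measurable_open_set; exact: closed_openC.
move: {e e0} A mA; rewrite borelX; apply: smallest_sub.
  split.
  - move=> e e0; exists set0, set0; split=> //; first exact: closed0.
      exact: open0.
    by rewrite set0D measure0 lee_fin ltW.
  - move=> A rA e /rA[F [U [cF oU FA AU FU]]]; exists (~` U), (~` F); split.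
    + exact: open_closedC.
    + exact: closed_openC.
    + by rewrite setTD; exact: subsetC.
    + by rewrite setTD; exact: subsetC.
    + by rewrite setDE setCK setIC -setDE.
  - move=> A rA e e0.
    have /choice[F /choice[U FU]] : forall n, exists F U : set X,
        [/\ closed F, open U, F `<=` A n, A n `<=` U &
            (nu (U `\` F) <= (e / 2 / (2 ^ n.+1)%:R)%:E)%E].
      by move=> n; apply: rA; rewrite !divr_gt0// ltr0n expn_gt0.
    have cF n : closed (F n) by case: (FU n).
    have oU n : open (U n) by case: (FU n).
    have FA n : F n `<=` A n by case: (FU n).
    have AU n : A n `<=` U n by case: (FU n).
    have nuFU n : (nu (U n `\` F n) <= (e / 2 / (2 ^ n.+1)%:R)%:E)%E by case: (FU n).
    (* A countable union of closed sets need not be closed; a finite one is, and continuity from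
       above makes the loss fit in the remaining [e / 2]. *)
    pose UU := \bigcup_n U n; pose G n := \big[setU/set0]_(i < n.+1) F i.
    have oUU : open UU by apply: bigcup_open.
    have cG n : closed (G n) by apply: closed_bigsetU => i _; exact: cF.
    have h1 : (nu (UU `\` \bigcup_n F n) <= (e / 2)%:E)%E.
      have mFi : measurable (\bigcup_n F n).
        apply: bigcup_measurable => n _.
        by rewrite -(setCK (F n)); apply: measurableC; apply: measurable_open_set; exact: closed_openC.
      apply: le_trans (_ : (\sum_(0 <= n <oo) nu (U n `\` F n) <= _)%E).
        apply: measure_sigma_subadditive => [n||].
        - exact: mD.
        - by apply: measurableD => //; exact: measurable_open_set.
        - move=> x [[n _ Ux] nF]; exists n => //; split=> // Fx.
          by apply: nF; exists n.
      have := @epsilon_trick R (fun=> 0%E) (e / 2) xpredT (fun=> lexx _) _.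
      rewrite ltW ?divr_gt0// => /(_ isT).
      rewrite [X in (_ <= X + _)%E]eseries0// add0e; apply: le_trans.
      by apply: lee_nneseries => n _; rewrite ?add0e.
    have cv : nu (UU `\` G n) @[n --> \oo] --> nu (\bigcap_n (UU `\` G n)).
      apply: nonincreasing_cvg_mu.
      - apply: le_lt_trans nufin; apply: le_measure; rewrite ?inE//; exact: mD.
      - by move=> n; exact: mD.
      - by apply: bigcap_measurable => // n _; exact: mD.
      - apply/nonincreasing_seqP => n; apply/subsetPset; apply: setDS.
        by rewrite /G [X in _ `<=` X]big_ord_recr/=; exact: subsetUl.
    have capE : \bigcap_n (UU `\` G n) = UU `\` \bigcup_n F n.
      rewrite -(bigcup_bigsetU_bigcup F).
      apply/seteqP; split=> [x h|x [Ux nF] n _]; last first.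
        by split=> // Gx; apply: nF; exists n.
      by split=> [|[n _ Fx]]; have [] := h 0%N I => //; have [] := h n I.
    rewrite capE in cv.
    have [n hn] : exists n, (nu (UU `\` G n) <= e%:E)%E.
      apply: contrapT => nex.
      have : (e%:E <= nu (UU `\` \bigcup_n F n))%E.
        rewrite -(cvg_lim _ cv)//; apply: lime_ge; first by apply/cvg_ex; eexists; exact: cv.
        apply: nearW => n; rewrite leNgt; apply/negP => h; apply: nex.
        by exists n; exact: ltW.
      rewrite leNgt => /negP; apply; apply: (le_lt_trans h1).
      by rewrite lte_fin gtr_pMr// invf_lt1// ltr1n.
    exists (G n), UU; split=> //.
    + move=> x; rewrite /G -bigcup_mkord => -[i _ Fx]; exists i => //.
      exact: FA.
    + by move=> x [i _ Ax]; exists i => //; exact: AU.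
move=> V oV e e0.
(* The points of [V] at distance at least [n.+1%:R^-1] from its complement; these closed sets
   exhaust the open set [V]. *)
pose F n := ~` (\bigcup_(z in ~` V) ball z n.+1%:R^-1) : set X.
have cF n : closed (F n).
  by apply: open_closedC; apply: bigcup_open => z _; exact: open_ball_metric.
have FV n : F n `<=` V.
  move=> x nx; apply: contrapT => Vx; apply: nx; exists x => //.
  by rewrite ballE mdistxx.
have cv : nu (V `\` F n) @[n --> \oo] --> nu (\bigcap_n (V `\` F n)).
  apply: nonincreasing_cvg_mu.
  - apply: le_lt_trans nufin; apply: le_measure; rewrite ?inE//; exact: mD.
  - by move=> n; exact: mD.
  - by apply: bigcap_measurable => // n _; exact: mD.
  - apply/nonincreasing_seqP => n; apply/subsetPset; apply: setDS.
    apply: subsetC; apply: subset_bigcup => z _; apply: le_ball.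
    by rewrite lef_pV2 ?posrE// ler_nat.
have cap0 : \bigcap_n (V `\` F n) = set0.
  apply/seteqP; split=> // x h; have [Vx _] := h 0%N I.
  have [r r0 rV] := openP_ball oV Vx.
  have [n nr] : exists n : nat, n.+1%:R^-1 < r.
    exists (Num.bound r^-1); rewrite -[ltRHS]invrK ltf_pV2 ?posrE ?invr_gt0//.
    apply: (lt_trans (archi_boundP _)); rewrite ?invr_ge0 ?(ltW r0)//.
    by rewrite ltr_nat.
  have [_ nF] := h n I; apply: nF => -[z nVz zx]; apply: nVz; apply: rV.
  by move: zx; rewrite !ballE metric_sym => /lt_trans; apply.
rewrite cap0 measure0 in cv.
have [n hn] : exists n, (nu (V `\` F n) <= e%:E)%E.
  apply: contrapT => nex.
  have : (e%:E <= 0)%E.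
    rewrite -(cvg_lim _ cv)//; apply: lime_ge; first by apply/cvg_ex; eexists; exact: cv.
    apply: nearW => n; rewrite leNgt; apply/negP => h; apply: nex.
    by exists n; exact: ltW.
  by rewrite lee_fin leNgt e0.
by exists (F n), V; split.
Qed.

Context (N m : nat) (alphaE : alpha = 2 ^+ m) (beta_large_N : 2 * N%:R ^+ m <= beta)
  (net : forall (k : nat) x r, 0 < r -> exists2 s : seq X, (size s <= N ^ k)%N &
      ball x r `<=` \bigcup_(y in [set` s]) ball y (r / 2 ^+ k)).

(* A ball is covered by about N^(m i) balls of radius alpha^-i; those meeting the
   set have measure O(beta^-i), and 2 N^m <= beta. *)
Lemma negligible_small_growth (x0 : X) (J l : nat) :
  mu.-negligible [set x | mdist x0 x < 2 ^+ l /\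
    forall i : nat, beta ^+ i * ball_measure x (alpha ^- (J + i)) <= 2 ^+ l].
Proof.
set E := [set x | _].
have a0 : 0 < alpha by rewrite (lt_le_trans _ alpha_ge3).
have /choice[A AP] : forall i : nat, exists A : set X, [/\ measurable A, E `<=` A &
    (mu A <= (N%:R ^+ (l + m * J.+1) * 2 ^+ l / 2 ^+ i)%:E)%E].
  move=> i.
  have [s sN cov] := @net (l + m * (J + i).+1)%N x0 (2 ^+ l) (exprn_gt0 _ (ltr0Sn _ _)).
  have radE : 2 ^+ l / 2 ^+ (l + m * (J + i).+1) = alpha ^- (J + i).+1 :> R.
    by rewrite exprD invfM mulrA divff ?mul1r ?expf_neq0// alphaE -exprM.
  rewrite radE in cov.
  (* The net is one step finer than the balls in [E]: a net ball through a point of [E] lies in the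
     ball of radius [alpha ^- (J + i)] about that point, because [2 <= alpha], and so passes this
     filter. *)
  pose s' := [seq y <- s | `[< (mu (ball y (alpha ^- (J + i).+1)) <=
    (2 ^+ l / beta ^+ i)%:E)%E >]].
  exists (\big[setU/set0]_(y <- s') (ball y (alpha ^- (J + i).+1) : set X)); split.
  - by apply: bigsetU_measurable.
  - move=> x [xl hx]; rewrite -bigcup_seq.
    have [|y /= ys yx] := cov x; first by rewrite ballE.
    exists y => //=; rewrite mem_filter ys andbT; apply/asboolP.
    rewrite ball_measureE lee_fin ler_pdivlMr ?exprn_gt0// mulrC.
    apply: le_trans (hx i); rewrite ler_wpM2l ?exprn_ge0 ?(ltW beta_gt0)//.
    apply: le_ball_measure; apply: sub_ball; move: yx; rewrite ballE metric_sym.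
    move=> /ltW xy; apply: le_trans (lerD xy (lexx _)) _.
    rewrite -mulr2n -mulr_natl exprS invfM mulrA ler_piMl ?invr_ge0 ?exprn_ge0 ?(ltW a0)//.
    by rewrite ler_pdivrMr// mul1r (le_trans _ alpha_ge3)// ler_nat.
  - apply: le_trans (measure_bigsetU_seq_le _ _ _) _ => //.
    apply: (@le_trans _ _ (\sum_(y <- s') (2 ^+ l / beta ^+ i)%:E)%E).
      rewrite big_seq [leRHS]big_seq; apply: lee_sum => y.
      by rewrite mem_filter => /andP[/asboolP].
    rewrite sumEFin lee_fin big_const_seq iter_addr addr0 count_predT.
    apply: (@le_trans _ _ ((2 ^+ l / beta ^+ i) *+ (N ^ (l + m * (J + i).+1)))).
      rewrite ler_wpMn2l ?divr_ge0 ?exprn_ge0 ?(ltW beta_gt0)//.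
      by apply: leq_trans sN; rewrite size_filter count_size.
    rewrite -mulr_natl natrX.
    have -> : (l + m * (J + i).+1 = l + m * J.+1 + m * i)%N by lia.
    rewrite exprD exprM -!mulrA ler_wpM2l ?exprn_ge0// mulrCA ler_wpM2l ?exprn_ge0//.
    rewrite ler_pdivrMr ?exprn_gt0// mulrC ler_pdivlMr ?exprn_gt0//.
    rewrite mulrC -exprMn; apply: lerXn2r beta_large_N.
      by rewrite nnegrE mulr_ge0// exprn_ge0.
    by rewrite nnegrE ltW.
exists (\bigcap_i A i); split.
- by apply: bigcap_measurable => // i _; case: (AP i).
- apply/eqP; rewrite eq_le measure_ge0 andbT.
  apply/lee_addgt0Pr => e e0; rewrite add0e.
  have [i ie] := lt_exp2_ex (N%:R ^+ (l + m * J.+1) * 2 ^+ l / e).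
  have [mAi _ hAi] := AP i.
  apply: (@le_trans _ _ (mu (A i))).
    apply: le_measure; rewrite ?inE//; last by move=> x; apply.
    by apply: bigcap_measurable => // k _; case: (AP k).
  apply: (le_trans hAi); rewrite lee_fin ltW//.
  by rewrite ltr_pdivrMr ?exprn_gt0// [X in _ < X]mulrC -ltr_pdivrMr.
- by move=> x Ex i _; case: (AP i) => _ + _; apply.
Qed.

(** Without doubling balls of radius below [e], every division of the radius by [alpha] divides the
    measure by at least [beta]. [J] encodes [e], and [l] the position of the point and the measure
    of its first ball, so countably many of the preceding null sets cover the exceptional points. *)
Lemma ae_small_doubling_ball :
  mu.-negligible [set x | exists2 e : R, 0 < e &
    forall r, 0 < r -> r < e -> ~ doubling_ball (x, r)].
Proof.
have m_gt0 : (0 < m)%N.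
  rewrite lt0n; apply/eqP => m0; move: alpha_ge3; rewrite alphaE m0 expr0.
  by rewrite leNgt ltr1n.
have [->|/set0P[x0 _]] := eqVneq [set x | exists2 e : R, 0 < e &
    forall r, 0 < r -> r < e -> ~ doubling_ball (x, r)] set0.
  exact: negligible_set0.
pose E J l := [set x | mdist x0 x < 2 ^+ l /\
    forall i : nat, beta ^+ i * ball_measure x (alpha ^- (J + i)) <= 2 ^+ l].
apply: (@negligibleS _ _ _ mu (\bigcup_J \bigcup_l E J l)); last first.
  apply: negligible_bigcup => J; apply: negligible_bigcup => l.
  exact: negligible_small_growth.
have a0 : 0 < alpha by rewrite (lt_le_trans _ alpha_ge3).
move=> x [e e0 nd].
have [J Je] : exists J : nat, alpha ^- J < e.
  have [J] := lt_exp2_ex e^-1; exists J.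
  rewrite -[ltRHS]invrK ltf_pV2 ?posrE ?invr_gt0 ?exprn_gt0//.
  apply: (lt_le_trans p); rewrite alphaE; apply: lerXn2r; rewrite ?nnegrE ?exprn_ge0//.
  by apply: ler_eXnr => //; rewrite ler1n.
have [l1 hl1] := lt_exp2_ex (mdist x0 x).
have [l2 hl2] := lt_exp2_ex (ball_measure x (alpha ^- J)).
exists J => //; exists (l1 + l2)%N => //; split.
  by apply: (lt_le_trans hl1); rewrite ler_weXn2l ?ler1n// leq_addr.
move=> i; apply: (@le_trans _ _ (2 ^+ l2)); last first.
  by rewrite ler_weXn2l ?ler1n// leq_addl.
apply: le_trans (ltW hl2).
elim: i => [|i IH]; first by rewrite addn0 expr0 mul1r.
apply: le_trans IH; rewrite exprSr -mulrA ler_wpM2l ?exprn_ge0 ?(ltW beta_gt0)//.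
rewrite leNgt; apply/negP => lt; apply: (nd (alpha ^- (J + i.+1))).
- by rewrite invr_gt0 exprn_gt0.
- apply: le_lt_trans Je; rewrite lef_pV2 ?posrE ?exprn_gt0//.
  by rewrite ler_weXn2l ?leq_addr// (le_trans _ alpha_ge3)// ler1n.
split=> /=; first by rewrite invr_gt0 exprn_gt0.
rewrite !ball_measureE -EFinM lee_fin.
have -> : alpha * alpha ^- (J + i.+1) = alpha ^- (J + i).
  by rewrite addnS exprS invfM mulrA divff ?mul1r ?gt_eqF.
exact: ltW.
Qed.

(* Stands in for the Lebesgue differentiation theorem: on a doubling ball whose
   average of [phi] is at most [t], a definite fraction of the measure lies
   outside any set where [phi >= t + e]. *)
Lemma doubling_ball_complement (phi : X -> R) t e q (A : set X) :
  measurable_fun [set: X] phi -> (forall x, 0 <= phi x) -> 0 <= t -> 0 < e ->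
  measurable A -> (forall x, A x -> t + e <= phi x) -> ~ average_gt phi t q ->
  (mu (ball q.1 q.2) <= ((t + e) / e)%:E * mu (ball q.1 q.2 `\` A))%E.
Proof.
move=> mphi phi0 t0 e0 mA hA /negP; rewrite -leNgt => nav.
have te0 : 0 < t + e by rewrite ltr_wpDl.
have fin (B : set X) : measurable B -> B `<=` ball q.1 q.2 -> mu B \is a fin_num.
  move=> mB sB; rewrite ge0_fin_numE//; apply: le_lt_trans (ball_fin q.1 q.2).
  by apply: le_measure; rewrite ?inE.
have mBA : measurable (ball q.1 q.2 `&` A) by exact: measurableI.
have mBD : measurable (ball q.1 q.2 `\` A) by exact: measurableD.
have h : ((t + e)%:E * mu (ball q.1 q.2 `&` A) <= t%:E * mu (ball q.1 q.2))%E.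
  apply: le_trans nav; rewrite -integral_cst//.
  apply: (@le_trans _ _ (\int[mu]_(y in ball q.1 q.2 `&` A) (phi y)%:E)%E).
    apply: le_integral_ge0 => x [_ Ax]; first by rewrite lee_fin ltW.
    by rewrite lee_fin; exact: hA.
  apply: ge0_subset_integral => //.
  - exact: measurable_EFin.
  - by move=> x _; rewrite lee_fin.
have -> : mu (ball q.1 q.2) = (mu (ball q.1 q.2 `&` A) + mu (ball q.1 q.2 `\` A))%E.
  by rewrite [LHS](measureDI mu _ mA)// addeC.
have hB : mu (ball q.1 q.2) = (mu (ball q.1 q.2 `&` A) + mu (ball q.1 q.2 `\` A))%E.
  by rewrite [LHS](measureDI mu _ mA)// addeC.
rewrite hB in h; move: h.
rewrite -(fineK (fin _ mBA _)); last by apply: subIsetl.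
rewrite -(fineK (fin _ mBD _)); last by apply: subDsetl.
rewrite -!EFinD -!EFinM !lee_fin; set a := fine _; set b := fine _ => h.
rewrite mulrAC ler_pdivlMr//; nra.
Qed.

(** Almost every point of [A] is the centre of doubling balls inside an open [V] with [V] minus [A]
    tiny. Such centres lie outside [maximal_gt], so the averages are at most [t] and
    [doubling_ball_complement] leaves a fixed fraction of each ball outside [A]. After Vitali
    selection these fractions are disjoint subsets of [V] minus [A]. *)
Lemma measure_level_diff_maximal (phi : X -> R) t e x0 l :
  measurable_fun [set: X] phi -> (forall x, 0 <= phi x) -> 0 <= t -> 0 < e ->
  mu ((ball x0 l `&` [set x | t + e <= phi x]) `\` maximal_gt phi t) = 0%E.
Proof.
move=> mphi phi0 t0 e0; set A := _ `\` _.
have te0 : 0 < t + e by rewrite ltr_wpDl.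
have mA : measurable A.
  apply: measurableD => //; apply: measurableI => //.
  exact: measurable_ge_set.
have [N0 [mN0 N00 badN0]] := ae_small_doubling_ball.
(* Restriction to a ball makes the measure finite, as [outer_regular_finite] demands. *)
pose nu := mrestr mu (measurable_metric_ball x0 l) : {measure set X -> \bar R}.
apply/eqP; rewrite eq_le measure_ge0 andbT; apply/lee_addgt0Pr => e' e'0.
rewrite add0e; pose k := beta * ((t + e) / e).
have k0 : 0 < k by rewrite !mulr_gt0// invr_gt0.
have nufin : (nu setT < +oo)%E by rewrite /nu/= /mrestr setTI ball_fin.
have [U [oU AU nuU]] := outer_regular_finite nufin mA (divr_gt0 e'0 k0).
pose V := U `&` ball x0 l.
have oV : open V by apply: openI => //; exact: open_ball_metric.
have mV : measurable V by exact: measurable_open_set.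
have VA : (mu (V `\` A) <= (e' / k)%:E)%E.
  rewrite (_ : V `\` A = (U `\` A) `&` ball x0 l)//.
  by apply/seteqP; split=> x [[Ux bx] nA].
pose P := [set q | [/\ A q.1, doubling_ball q & ball q.1 q.2 `<=` V]].
have cover : (mu (\bigcup_(q in P) (ball q.1 q.2 `&` setT)) <= e'%:E)%E.
  apply: (@measure_cover_le _ _ _ doublingX mu borelX P (fun=> setT)) => //.
  - by move=> q [_ []].
  - by move=> _; exact: openT.
  move=> s us sP ts.
  apply: (@le_trans _ _ (\sum_(q <- s) k%:E * mu (ball q.1 q.2 `\` A))%E).
    rewrite big_seq [leRHS]big_seq; apply: lee_sum => q /sP[Aq dq qV].
    rewrite setIT; apply: (le_trans (measure_triple_doubling_ball dq)).
    rewrite EFinM -muleA; apply: lee_wpmul2l; first by rewrite lee_fin ltW.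
    apply: (@doubling_ball_complement phi) => //.
      by move=> x [[_]].
    move=> aq; have [_] := Aq; apply; exists q => //.
    by rewrite ballE mdistxx; case: dq.
  rewrite -ge0_sume_distrr; last by [].
  rewrite (@sum_measure_trivIset _ _ _ mu _ s (fun q => ball q.1 q.2 `\` A))//; last 2 first.
  - by move=> q; exact: measurableD.
  - move=> q q' qs q's [x [[qx _] [q'x _]]]; apply: (ts q q' qs q's).
    by exists x.
  have -> : e'%:E = (k%:E * (e' / k)%:E)%E by rewrite -EFinM mulrC divfK ?lt0r_neq0.
  apply: lee_wpmul2l.
    by rewrite lee_fin ltW.
  apply: le_trans VA; apply: le_measure; rewrite ?inE.
  - by apply: bigsetU_measurable => q _; exact: measurableD.
  - exact: measurableD.
  - rewrite -bigcup_seq => x [q /= /sP[_ _ qV] [qx nA]].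
    by split=> //; exact: qV.
apply: (@le_trans _ _ (mu (\bigcup_(q in P) (ball q.1 q.2 `&` setT) `|` N0))).
  apply: le_measure; rewrite ?inE//.
    apply: measurableU => //; apply: measurable_open_set; apply: bigcup_open => q _.
    by rewrite setIT; exact: open_ball_metric.
  move=> x Ax; have [bad|nbad] := pselect ([set x | exists2 e : R, 0 < e &
    forall r, 0 < r -> r < e -> ~ doubling_ball (x, r)] x).
    by right; exact: badN0.
  left; have Vx : V x by split; [exact: AU|case: Ax => [[]]].
  have [r r0 rV] := openP_ball oV Vx.
  have [r' [r'0 r'r dr']] : exists r', [/\ 0 < r', r' < r & doubling_ball (x, r')].
    apply: contrapT => nr; apply: nbad; exists r => // r' r'0 r'r dr'.
    by apply: nr; exists r'.
  exists (x, r'); last by split=> //; rewrite ballE mdistxx.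
  by split=> //; apply: subset_trans rV; apply: le_ball; exact: ltW.
apply: le_trans (measureU2 _ _ _) _ => //.
  apply: measurable_open_set; apply: bigcup_open => q _.
  by rewrite setIT; exact: open_ball_metric.
by rewrite -[leRHS]adde0 -[X in (_ <= _ + X)%E]N00; exact: leeD.
Qed.

(** The part of the level set outside [maximal_gt] is a countable union of null sets, one for each
    gap [n.+1%:R^-1] above [t] and each ball of radius [l] about a fixed point. *)
Lemma le_measure_maximal_gt (phi : X -> R) t :
  measurable_fun [set: X] phi -> (forall x, 0 <= phi x) -> 0 <= t ->
  (mu [set x | (t < phi x)%R] <= mu (maximal_gt phi t))%E.
Proof.
move=> mphi phi0 t0.
have mA : measurable [set x | t < phi x].
  exact: measurable_gt_set.
have [->|/set0P[x0 _]] := eqVneq [set x | t < phi x] set0.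
  by rewrite measure0.
pose A n l := (ball x0 l%:R `&` [set x | t + n.+1%:R^-1 <= phi x]) `\` maximal_gt phi t.
have mAnl n l : measurable (A n l).
  apply: measurableD => //; apply: measurableI => //.
  exact: measurable_ge_set.
have mAA : measurable (\bigcup_n \bigcup_l A n l).
  by apply: bigcup_measurable => n _; apply: bigcup_measurable.
have AA0 : mu (\bigcup_n \bigcup_l A n l) = 0%E.
  apply/negligibleP => //; apply: negligible_bigcup => n; apply: negligible_bigcup => l.
  apply/negligibleP => //; apply: measure_level_diff_maximal => //.
apply: (@le_trans _ _ (mu (maximal_gt phi t `|` \bigcup_n \bigcup_l A n l))).
  apply: le_measure; rewrite ?inE//; first exact: measurableU.
  move=> x /= tx; have [|nOm] := pselect (maximal_gt phi t x); first by left.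
  right; exists (Num.bound (phi x - t)^-1) => //.
  have [l _ xl] : (\bigcup_n ball x0 n%:R) x by rewrite bigcup_ball.
  exists l => //; split=> //; split=> //=.
  rewrite -lerBrDl -[leRHS]invrK lef_pV2 ?posrE ?invr_gt0 ?subr_gt0//.
  rewrite ltW// (lt_trans (archi_boundP _))// ?invr_ge0 ?subr_ge0 1?ltW//.
  by rewrite ltr_nat.
apply: le_trans (measureU2 _ _ _) _ => //.
by rewrite -[leRHS]adde0 -[X in (_ <= _ + X)%E]AA0.
Qed.

(** * The good-lambda inequality *)

Context (rho : R) (rho_ge1 : 1 <= rho) (alpha_ge : 7 * rho <= alpha).

Lemma average_gt_measure_gt0 (phi : X -> R) t q : measurable_fun [set: X] phi ->
  (forall x, 0 <= phi x) -> average_gt phi t q -> 0 < ball_measure q.1 q.2.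
Proof.
move=> mphi phi0; rewrite lt_neqAle ball_measure_ge0 andbT; apply: contraPN => /eqP e0.
have m0 : mu (ball q.1 q.2) = 0%E by rewrite ball_measureE -e0.
rewrite /average_gt m0 mule0; apply/negP; rewrite -leNgt.
rewrite (_ : (\int[mu]_(y in _) _)%E = (\int[mu]_(y in ball q.1 q.2) `|(phi y)%:E|)%E).
  by rewrite integral_abs_eq0//; exact: measurable_EFin.
by apply: eq_integral => y _; rewrite gee0_abs// lee_fin.
Qed.

(* To be used with g = T f and h = T f0, where f0 is f cut off at a small multiple
   of t, so that h has a small RBMO constant [c]. *)
Section good_lambda.
Context (g h : X -> R) (hB : X -> R -> R) (c t : R).
Context (mg : measurable_fun [set: X] g) (mh : measurable_fun [set: X] h).
Context (t_gt0 : 0 < t) (c_ge0 : 0 <= c) (c_small : c * (beta + (1 + 3 * Ca)) <= t).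
Context (osc_h : forall x r, 0 < r -> (\int[mu]_(y in ball x r) `|h y - hB x r|%:E
  <= c%:E * mu (ball x (rho * r)))%E).
Context (diff_h : forall x r y s, 0 < r -> 0 < s -> ball x r `<=` ball y s ->
  (`|hB x r - hB y s|%:E <= c%:E * Kcoef mu lam x r s)%E).

Let ng (x : X) : R := `|g x|.
Let nb (x : X) : R := `|g x - h x|.

Let mng : measurable_fun [set: X] ng.
Proof. exact: measurable_norm. Qed.

Let mnb : measurable_fun [set: X] nb.
Proof. by apply: measurable_norm; exact: measurable_funB. Qed.

Let mnh (a : R) : measurable_fun [set: X] (fun y => `|h y - a|).
Proof. by apply: measurable_norm; exact: measurable_funB. Qed.

Let ng_ge0 x : 0 <= ng x. Proof. exact: normr_ge0. Qed.
Let nb_ge0 x : 0 <= nb x. Proof. exact: normr_ge0. Qed.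

(** Average [|hB| <= |h - hB| + |g| + |g - h|] over the ball. The first term costs [c * beta], since
    the ball is doubling and [rho <= alpha]; the other two cost [t] each. *)
Lemma average_dilate_le z r : 0 < r -> doubling_ball (z, r) ->
  0 < ball_measure z r -> ~ average_gt ng t (z, r) -> ~ average_gt nb t (z, r) ->
  `|hB z r| <= c * beta + 2 * t.
Proof.
move=> r0 [_ /= dr] m0 /negP; rewrite -leNgt /= => gt /negP; rewrite -leNgt /= => bt.
rewrite -(ler_pM2r m0) -lee_fin EFinM -ball_measureE -integral_cst//.
apply: (@le_trans _ _ (\int[mu]_(y in ball z r)
    (`|h y - hB z r|%:E + ((ng y)%:E + (nb y)%:E)))%E).
  apply: le_integral_ge0 => y _; first by rewrite lee_fin.
  rewrite -!EFinD lee_fin /ng /nb.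
  have -> : `|hB z r| = `|- (h y - hB z r) + g y - (g y - h y)|.
    by congr (`|_|); ring.
  apply: le_trans (ler_normB _ _) _; rewrite addrA lerD2r.
  by apply: le_trans (ler_normD _ _) _; rewrite normrN.
rewrite ge0_integralD//; last 3 first.
- exact: measurable_EFin.
- by move=> y _; rewrite -EFinD lee_fin addr_ge0.
- by apply: emeasurable_funD; exact: measurable_EFin.
rewrite ge0_integralD//; last 4 first.
- by move=> y _; rewrite lee_fin.
- exact: measurable_EFin.
- by move=> y _; rewrite lee_fin.
- exact: measurable_EFin.
have -> : ((c * beta + 2 * t) * ball_measure z r)%:E =
  (c%:E * (beta%:E * mu (ball z r)) + (t%:E * mu (ball z r) + t%:E * mu (ball z r)))%E.
  by rewrite ball_measureE -!EFinM -!EFinD; congr EFin; ring.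
apply: leeD; last exact: leeD.
apply: (le_trans (osc_h _ r0)); apply: lee_wpmul2l; first by rewrite lee_fin.
apply: le_trans dr; apply: le_measure; rewrite ?inE//.
apply: le_ball; rewrite ler_wpM2r ?(ltW r0)// (le_trans _ alpha_ge)//.
by rewrite ler_peMl// ?ler1n// (le_trans _ rho_ge1).
Qed.

(** The factor 5 is 1 + 3 + 1: where [|g|] averages more than [5 * t], the average of [|g - h|] is
    at most [t] and the constant [hB] at most [3 * t], so [|h - hB|] averages more than [t]. The
    weak type estimate for that oscillation concludes. *)
Lemma maximal_gt_local z r : 0 < r -> doubling_ball (z, r) -> `|hB z (7 * r)| <= 3 * t ->
  (mu (ball z (3 * r) `&` maximal_gt_upto ng (5 * t) (2 * r) `&` ~` maximal_gt nb t)
    <= (beta ^+ 2 * c / t)%:E * mu (ball z r))%E.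
Proof.
move=> r0 [_ /= dr] ha.
pose phi (y : X) : R := `|h y - hB z (7 * r)| * \1_(ball z (7 * r) : set X) y.
have mphi : measurable_fun [set: X] phi.
  by apply: measurable_funM => //; exact: measurable_indic.
have phi0 y : 0 <= phi y by rewrite mulr_ge0.
apply: (@le_trans _ _ (mu (maximal_gt phi t))).
  apply: le_measure; rewrite ?inE//.
    apply: measurableI; last exact: measurableC.
    apply: measurableI => //; apply: measurable_open_set.
    exact: open_maximal_gt_upto.
  move=> x [[zx [[w s] /= [dw aw s2] wx]] nb_x].
  have s0 : 0 < s by case: dw.
  (* Here 7 = 3 + 2 + 2: the ball has radius at most [2 * r] and meets [ball z (3 * r)]. *)
  have sub : ball w s `<=` ball z (7 * r).
    apply: sub_ball; move: zx wx; rewrite !ballE => zx wx.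
    have := metric_triangle z x w; rewrite (metric_sym x) => zw.
    lra.
  have nbw : (\int[mu]_(y in ball w s) (nb y)%:E <= t%:E * mu (ball w s))%E.
    rewrite leNgt; apply/negP => aw'; apply: nb_x; exists (w, s) => //.
  exists (w, s) => //; split=> //; rewrite /average_gt/=.
  have : ((5 * t)%:E * mu (ball w s) < (t%:E * mu (ball w s)) +
      (\int[mu]_(y in ball w s) (phi y)%:E + (3 * t)%:E * mu (ball w s)))%E.
    apply: (lt_le_trans aw) => /=.
    apply: (@le_trans _ _ (\int[mu]_(y in ball w s)
      ((nb y)%:E + ((phi y)%:E + cst (3 * t)%:E y)))%E).
      apply: le_integral_ge0 => y wy; first by rewrite lee_fin.
      rewrite /= -!EFinD lee_fin /phi indicE mem_set ?mulr1; last exact: sub.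
      rewrite /ng /nb.
      have -> : `|g y| = `|(g y - h y) + ((h y - hB z (7 * r)) + hB z (7 * r))|.
        by congr (`|_|); ring.
      apply: le_trans (ler_normD _ _) _; rewrite lerD2l.
      by apply: le_trans (ler_normD _ _) _; rewrite lerD2l.
    rewrite ge0_integralD//; last 4 first.
    - by move=> y _; rewrite lee_fin.
    - exact: measurable_EFin.
    - by move=> y _; rewrite -EFinD lee_fin addr_ge0// mulr_ge0// ltW.
    - by apply: emeasurable_funD; [exact: measurable_EFin|exact: measurable_cst].
    rewrite ge0_integralD//; last 3 first.
    - by move=> y _; rewrite lee_fin.
    - exact: measurable_EFin.
    - by move=> y _; rewrite lee_fin mulr_ge0// ltW.
    by rewrite integral_cst//; exact: leeD.
  rewrite ball_measureE -!EFinM; set m' := ball_measure w s.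
  have : (0 <= \int[mu]_(y in ball w s) (phi y)%:E)%E.
    by apply: integral_ge0 => y _; rewrite lee_fin.
  case: (\int[mu]_(y in ball w s) (phi y)%:E)%E => [i||]//= _; last by move=> _; rewrite ltry.
  rewrite -!EFinD !lte_fin; lra.
apply: (le_trans (weak_type_maximal mphi phi0 t_gt0)).
have -> : (\int[mu]_x (phi x)%:E =
    \int[mu]_(x in ball z (7 * r)) `|h x - hB z (7 * r)|%:E)%E.
  rewrite [RHS]integral_mkcond; apply: eq_integral => y _.
  rewrite /phi /patch indicE; case: ifPn => _; rewrite ?mulr1//.
  by rewrite mulr0.
have r70 : 0 < 7 * r by rewrite mulr_gt0.
have bt0 : 0 <= beta / t by rewrite divr_ge0// ltW.
apply: (@le_trans _ _ ((beta / t)%:E * (c%:E * (beta%:E * mu (ball z r))))%E).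
  apply: lee_wpmul2l; first by rewrite lee_fin.
  apply: (le_trans (osc_h _ r70)); apply: lee_wpmul2l; first by rewrite lee_fin.
  apply: le_trans dr; apply: le_measure; rewrite ?inE//.
  by apply: le_ball; rewrite mulrA ler_wpM2r ?(ltW r0)// mulrC.
rewrite ball_measureE -!EFinM lee_fin le_eqVlt; apply/orP; left; apply/eqP.
by ring.
Qed.

(* The radius of [q] is within a factor 2 of the supremum of the radii of the
   doubling balls through [x] on which the average of [ng] exceeds [t]. *)
Definition near_maximal q : Prop := [/\ doubling_ball q, average_gt ng t q &
  exists2 x, ball q.1 q.2 x & forall q', doubling_ball q' -> ball q'.1 q'.2 x ->
    2 * q.2 <= q'.2 -> ~ average_gt ng t q'].

(* The first doubling dilate B(z, s) of B(z, 7 r) is too large to have an average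
   above [t]; this bounds hB z s, and the Kcoef estimate carries the bound
   back to hB z (7 * r). *)
Lemma near_maximal_local q : near_maximal q ->
  (mu (ball q.1 (3 * q.2) `&` maximal_gt_upto ng (5 * t) (2 * q.2) `&`
     ~` maximal_gt nb t) <=
   (beta ^+ 2 * c / t)%:E * mu (ball q.1 q.2) +
     beta%:E * mu (ball q.1 q.2 `&` maximal_gt nb t))%E.
Proof.
case: q => z r /= [dq aq [x /= zx xmax]].
have r0 : 0 < r by case: dq.
have m0 : 0 < ball_measure z r by exact: (average_gt_measure_gt0 mng _ aq).
have r70 : 0 < 7 * r by rewrite mulr_gt0.
have r7 : r <= 7 * r by rewrite ler_peMl ?(ltW r0)// ler1n.
have m70 : (0 < mu (ball z (7 * r)))%E.
  rewrite ball_measureE lte_fin (lt_le_trans m0)//.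
  by apply: le_ball_measure; exact: le_ball.
have [j [dj Kj]] := doubling_dilate_exists r70 m70.
set s := alpha ^+ j * (7 * r) in dj Kj.
have s7 : 7 * r <= s.
  rewrite /s ler_peMl ?(ltW r70)// exprn_ege1// (le_trans _ alpha_ge3)//.
  by rewrite ler1n.
have s0 : 0 < s by rewrite (lt_le_trans r70).
have rs : r <= s by rewrite (le_trans r7).
have ngs : ~ average_gt ng t (z, s).
  apply: (xmax (z, s)) => //=; first exact: le_ball zx.
  by apply: le_trans s7; rewrite ler_wpM2r ?(ltW r0)// ler_nat.
(* If [|g - h|] has a large average on the dilate, the whole of [ball z r] lies in
   [maximal_gt nb t], and the doubling bound on the triple ball suffices. *)
have [bad|good] := pselect (average_gt nb t (z, s)).
  apply: (@le_trans _ _ (beta%:E * mu (ball z r `&` maximal_gt nb t))%E); last first.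
    rewrite -[leLHS]add0e; apply: leeD => //.
    by rewrite mule_ge0// lee_fin divr_ge0 ?mulr_ge0 ?exprn_ge0 ?(ltW beta_gt0)// ltW.
  have -> : ball z r `&` maximal_gt nb t = ball z r.
    apply/setIidPl => y zy; exists (z, s); first by split.
    exact: le_ball zy.
  apply: le_trans (measure_triple_doubling_ball dq).
  apply: le_measure; rewrite ?inE//.
    apply: measurableI; last exact: measurableC.
    apply: measurableI => //; apply: measurable_open_set.
    exact: open_maximal_gt_upto.
  by move=> y [[]].
apply: (@le_trans _ _ ((beta ^+ 2 * c / t)%:E * mu (ball z r))%E); last first.
  by rewrite -[leLHS]adde0; apply: leeD => //; rewrite mule_ge0// lee_fin ltW.
apply: maximal_gt_local => //.
have ms0 : 0 < ball_measure z s.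
  by apply: (lt_le_trans m0); apply: le_ball_measure; exact: le_ball.
have h1 := average_dilate_le s0 dj ms0 ngs good.
have h2 : `|hB z (7 * r) - hB z s| <= c * (1 + 3 * Ca).
  rewrite -lee_fin; apply: le_trans (diff_h r70 s0 _) _.
    exact: le_ball.
  by rewrite EFinM; apply: lee_wpmul2l; rewrite ?lee_fin.
have := ler_normD (hB z (7 * r) - hB z s) (hB z s); rewrite subrK => h3.
(* The dilate gives [c * beta + 2 * t] and the change of scale [c * (1 + 3 * Ca)]; by [c_small] the
   total is at most [3 * t]. *)
move: c_small; rewrite mulrDr => h4; lra.
Qed.

(** Through each point take a ball whose radius exceeds half of the supremum of the admissible
    radii, finite by assumption. A ball witnessing level [5 * t] is admissible too, so its radius is
    at most twice the chosen one; hence [maximal_gt_upto] at [2 * q.2]. *)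
Lemma maximal_gt_cover :
  (forall x, exists r0, forall q, doubling_ball q -> average_gt ng t q ->
     ball q.1 q.2 x -> q.2 <= r0) ->
  maximal_gt ng (5 * t) `<=` \bigcup_(q in near_maximal)
    (ball q.1 q.2 `&` maximal_gt_upto ng (5 * t) (2 * q.2)).
Proof.
move=> rad x [q5 [dq5 aq5] xq5].
have [r0 r0P] := rad x.
have aq5t : average_gt ng t q5.
  apply: le_lt_trans aq5; apply: lee_wpmul2r => //.
  by rewrite lee_fin ler_peMl ?(ltW t_gt0)// ler1n.
pose S := [set q.2 | q in [set q | [/\ doubling_ball q, average_gt ng t q &
  ball q.1 q.2 x]]].
have Sq5 : S q5.2 by exists q5.
have supS : has_sup S.
  split; first by exists q5.2.
  by exists r0 => _ [q [dq aq xq] <-]; exact: r0P.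
have q5sup : q5.2 <= sup S by apply: sup_ubound => //; case: supS.
have sup0 : 0 < sup S by apply: lt_le_trans q5sup; case: dq5.
have [_ [q [dq aq xq] <-]] := sup_adherent (divr_gt0 sup0 (ltr0Sn R 1)) supS.
move=> supq; have supq2 : sup S < 2 * q.2 by lra.
exists q.
  split=> //; exists x => // q' dq' xq' qq' aq'.
  have : q'.2 <= sup S by apply: sup_ubound; [case: supS|exists q'].
  by move=> /(le_trans qq'); rewrite leNgt supq2.
split=> //; exists q5 => //; split=> //.
by rewrite ltW// (le_lt_trans q5sup).
Qed.

(** The local estimate is summed over a Vitali selection for [mu] restricted to the complement of
    [maximal_gt nb t]. In [1 + beta], the 1 pays for the removed set and [beta] for the balls whose
    dilate has a large average of [nb]. *)
Lemma good_lambda_maximal :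
  (forall x, exists r0, forall q, doubling_ball q -> average_gt ng t q ->
     ball q.1 q.2 x -> q.2 <= r0) ->
  (mu (maximal_gt ng (5 * t)) <= (beta ^+ 2 * c / t)%:E * mu (maximal_gt ng t)
     + (1 + beta)%:E * mu (maximal_gt nb t))%E.
Proof.
move=> rad.
have mC : measurable (~` maximal_gt nb t) by exact: measurableC.
pose nu := mrestr mu mC : {measure set X -> \bar R}.
pose A := \bigcup_(q in near_maximal)
    (ball q.1 q.2 `&` maximal_gt_upto ng (5 * t) (2 * q.2)).
have k0 : 0 <= beta ^+ 2 * c / t.
  by rewrite divr_ge0 ?mulr_ge0 ?exprn_ge0 ?(ltW beta_gt0)// ltW.
have nuA : (nu A <= (beta ^+ 2 * c / t)%:E * mu (maximal_gt ng t)
     + beta%:E * mu (maximal_gt nb t))%E.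
  apply: (@measure_cover_le _ _ _ doublingX nu borelX near_maximal
    (fun r => maximal_gt_upto ng (5 * t) (2 * r))).
  - by move=> q [[]].
  - by move=> r; exact: open_maximal_gt_upto.
  - move=> r s rs x [q [dq aq qr] xq]; exists q => //; split=> //.
    by apply: (le_trans qr); rewrite ler_wpM2l.
  move=> s us sP ts.
  apply: (@le_trans _ _ (\sum_(q <- s) ((beta ^+ 2 * c / t)%:E * mu (ball q.1 q.2) +
     beta%:E * mu (ball q.1 q.2 `&` maximal_gt nb t)))%E).
    rewrite big_seq [leRHS]big_seq; apply: lee_sum => q /sP.
    exact: near_maximal_local.
  rewrite big_split/= -!ge0_sume_distrr//; apply: leeD.
    apply: lee_wpmul2l; first by rewrite lee_fin.
    rewrite (@sum_measure_trivIset _ _ _ mu _ s (fun q => ball q.1 q.2))//.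
    apply: le_measure; rewrite ?inE//; first exact: bigsetU_measurable.
    rewrite -bigcup_seq => x [q /= /sP[dq aq _] xq].
    by exists q.
  apply: lee_wpmul2l; first by rewrite lee_fin ltW.
  rewrite (@sum_measure_trivIset _ _ _ mu _ s (fun q => ball q.1 q.2 `&` maximal_gt nb t))//; last 2 first.
  - by move=> q; exact: measurableI.
  - move=> q q' qs q's [x [[qx _] [q'x _]]]; apply: (ts q q' qs q's).
    by exists x.
  apply: le_measure; rewrite ?inE//.
    by apply: bigsetU_measurable => q _; exact: measurableI.
  by rewrite -bigcup_seq => x [q /= _ []].
have mA : measurable A.
  apply: measurable_open_set; apply: bigcup_open => q _; apply: openI.
    exact: open_ball_metric.
  exact: open_maximal_gt_upto.
apply: (@le_trans _ _ (mu ((A `&` ~` maximal_gt nb t) `|` maximal_gt nb t))).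
  apply: le_measure; rewrite ?inE//.
    by apply: measurableU => //; exact: measurableI.
  move=> x /(maximal_gt_cover rad) Ax.
  by have [|] := pselect (maximal_gt nb t x); [right|left].
apply: le_trans (measureU2 _ _ _) _ => //; first exact: measurableI.
have -> : ((1 + beta)%:E * mu (maximal_gt nb t) =
    beta%:E * mu (maximal_gt nb t) + mu (maximal_gt nb t))%E.
  by rewrite EFinD ge0_muleDl ?lee_fin ?(ltW beta_gt0)// mul1e addeC.
by rewrite addeA; exact: leeD.
Qed.

End good_lambda.

(* The hypothesis says that mu(X) exceeds what the weak type estimate allows for
   a single ball; it holds automatically when mu(X) is infinite, and for t
   large when mu(X) is finite. *)
Lemma bounded_maximal_radius (p t : R) (g : X -> R) :
  measurable_fun [set: X] g -> 1 <= p -> 0 < t ->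
  ((beta / (t / 2) `^ p)%:E * Lp_integral mu p g < mu setT)%E ->
  forall x, exists r0, forall q, doubling_ball q ->
    average_gt (fun x => `|g x|) t q -> ball q.1 q.2 x -> q.2 <= r0.
Proof.
move=> mg p1 t0 small x.
have cv : mu (ball x n%:R) @[n --> \oo] --> mu setT.
  rewrite -(bigcup_ball x); apply: nondecreasing_cvg_mu => //.
    by rewrite bigcup_ball.
  apply/nondecreasing_seqP => n; apply/subsetPset; apply: le_ball.
  by rewrite ler_nat.
have [n hn] : exists n : nat,
    ((beta / (t / 2) `^ p)%:E * Lp_integral mu p g < mu (ball x n%:R))%E.
  apply: contrapT => nex.
  have : (mu setT <= (beta / (t / 2) `^ p)%:E * Lp_integral mu p g)%E.
    rewrite -(cvg_lim _ cv)//; apply: lime_le.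
      by apply/cvg_ex; eexists; exact: cv.
    apply: nearW => n; rewrite leNgt; apply/negP => h; apply: nex.
    by exists n.
  by rewrite leNgt small.
exists n%:R => q dq aq xq; rewrite leNgt; apply/negP => nq.
move: hn; rewrite ltNge => /negP; apply.
have [q0 dq2] := dq.
(* [q] contains [x] and has radius above [n], so its [alpha] dilate contains [ball x n]; being
   doubling, [q] would carry more measure than its average allows. *)
apply: (@le_trans _ _ (mu (ball q.1 (alpha * q.2)))).
  apply: le_measure; rewrite ?inE//; apply: sub_ball.
  have : 2 * q.2 <= alpha * q.2.
    by rewrite ler_wpM2r ?(ltW q0)// (le_trans _ alpha_ge3)// ler_nat.
  by move: xq; rewrite ballE; lra.
apply: (le_trans dq2); rewrite EFinM -muleA; apply: lee_wpmul2l.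
  by rewrite lee_fin ltW.
have := average_gt_powR mg p1 t0 (ball_fin _ _) aq.
rewrite /average_gt lee_pdivlMl ?powR_gt0 ?divr_gt0// => /ltW/le_trans; apply.
apply: ge0_subset_integral => //.
- exact/measurable_EFin/measurable_norm_powR.
Qed.

(** * Summation over geometric levels *)

Lemma sum_powR_below_le (t q v : R) (K : nat) : 0 < t -> 0 < q -> 0 <= v ->
  (5 `^ q - 1) * \sum_(k < K) (t * 5 ^+ k) `^ q * (t * 5 ^+ k < v)%R%:R <=
  (5 * v) `^ q.
Proof.
move=> t0 q0 v0.
have u0 k : 0 < t * 5 ^+ k by rewrite mulr_gt0// exprn_gt0.
(* The induction needs the sharper bound with a minimum: the sum telescopes while the levels stay
   below [v] and is constant afterwards. *)
suff : (5 `^ q - 1) * \sum_(k < K) (t * 5 ^+ k) `^ q * (t * 5 ^+ k < v)%R%:R <=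
    Num.min (t * 5 ^+ K) (5 * v) `^ q.
  move=> /le_trans; apply; apply: ge0_ler_powR; rewrite ?nnegrE ?(ltW q0)//.
  - by rewrite le_min (ltW (u0 _)) mulr_ge0.
  - by rewrite mulr_ge0.
  - by rewrite ge_min lexx orbT.
elim: K => [|K IH]; first by rewrite big_ord0 mulr0 powR_ge0.
rewrite big_ord_recr/= mulrDr; have [uv|vu] := ltP (t * 5 ^+ K) v; last first.
  rewrite mulr0 mulr0 addr0; apply: (le_trans IH).
  apply: ge0_ler_powR; rewrite ?nnegrE ?(ltW q0)//.
  - by rewrite le_min (ltW (u0 _)) mulr_ge0.
  - by rewrite le_min (ltW (u0 _)) mulr_ge0.
  - rewrite le_min2// exprS mulrCA ler_peMl ?(ltW (u0 _))// ler1n//.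
have -> : Num.min (t * 5 ^+ K.+1) (5 * v) = 5 * (t * 5 ^+ K).
  by rewrite exprS mulrCA; apply/min_idPl; rewrite ler_wpM2l// ltW.
move: IH; have -> : Num.min (t * 5 ^+ K) (5 * v) = t * 5 ^+ K.
  by apply/min_idPl; rewrite (le_trans (ltW uv))// ler_peMl// ler1n.
rewrite mulr1 (@powRM _ 5) ?(ltW (u0 _))//; lra.
Qed.

Lemma powR_le_sum_above (t r v : R) (K : nat) : 0 < t -> 0 < r -> 0 <= v ->
  t < v -> v <= t * 5 ^+ K ->
  v `^ r <= \sum_(k < K) (t * 5 ^+ k.+1) `^ r * (t * 5 ^+ k < v)%R%:R.
Proof.
move=> t0 r0 v0 tv; elim: K => [|K IH].
  by rewrite expr0 mulr1 => /(lt_le_trans tv); rewrite ltxx.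
rewrite big_ord_recr/= => vK; have [|Kv] := leP v (t * 5 ^+ K).
  by move=> /IH/le_trans; apply; rewrite mulr0 addr0.
rewrite mulr1 ler_wpDl//; first by apply: sumr_ge0 => k _; rewrite mulr_ge0 ?powR_ge0.
by apply: ge0_ler_powR; rewrite ?nnegrE ?(ltW r0)// mulr_ge0 ?(ltW t0)// exprn_ge0.
Qed.

(** A discrete layer-cake bound whose ratio 5 is the growth of the level in the good-lambda
    inequality. The cap [t * 5 ^+ K] keeps the number of levels finite. *)
Lemma sum_distribution_lt (r t : R) (g : X -> R) (K : nat) :
  measurable_fun [set: X] g -> 0 < t -> 0 < r ->
  (\int[mu]_(x in [set x | (t < `|g x|)%R /\ (`|g x| <= t * 5 ^+ K)%R])
      (`|g x| `^ r)%:E <=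
   \sum_(k < K) ((t * 5 ^+ k.+1) `^ r)%:E *
      mu (maximal_gt (fun x => `|g x|%R) (t * 5 ^+ k)))%E.
Proof.
move=> mg t0 r0.
have mng := measurable_norm mg.
have u0 k : 0 < t * 5 ^+ k by rewrite mulr_gt0// exprn_gt0.
pose B k := [set x | t * 5 ^+ k < `|g x|].
have mB k : measurable (B k) by exact: measurable_gt_set.
apply: (@le_trans _ _ (\int[mu]_x (\sum_(k < K) ((t * 5 ^+ k.+1) `^ r)%:E * (\1_(B k) x)%:E))%E).
  rewrite integral_mkcond; apply: le_integral_ge0 => x _.
    by rewrite /patch; case: ifPn => _; rewrite ?lee_fin ?powR_ge0.
  under eq_bigr do rewrite -EFinM.
  rewrite sumEFin /patch; case: ifPn => [/set_mem/= [tx xK]|_].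
    rewrite lee_fin; apply: le_trans (powR_le_sum_above t0 r0 _ tx xK) _ => //.
    apply: ler_sum => k _; rewrite indicE.
    have [kx|_] := boolP (t * 5 ^+ k < `|g x|); last by rewrite mulr0 mulr_ge0 ?powR_ge0.
    by rewrite mem_set.
  by rewrite lee_fin; apply: sumr_ge0 => k _; rewrite mulr_ge0 ?powR_ge0.
rewrite ge0_integral_sum//; last 2 first.
- by move=> k; apply: measurable_funeM; exact/measurable_EFin/measurable_indic.
- by move=> k x _; rewrite -EFinM lee_fin mulr_ge0 ?powR_ge0.
apply: lee_sum => k _; rewrite ge0_integralZl_EFin ?powR_ge0//; last first.
  exact/measurable_EFin/measurable_indic.
rewrite integral_indic// setIT; apply: lee_wpmul2l; first by rewrite lee_fin powR_ge0.
by apply: le_measure_maximal_gt => //; exact: ltW.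
Qed.

(** After exchanging sum and integral, the weights at a point form a geometric progression stopped
    at [|f| / gam], comparable to its last term. This raises the exponent from [p] to [p + q]. *)
Lemma sum_truncated_le (p q t gam : R) (f : X -> R) (K : nat) :
  measurable_fun [set: X] f -> 0 < t -> 0 < p -> 0 < q -> 0 < gam ->
  (\sum_(k < K) ((t * 5 ^+ k) `^ q)%:E *
     \int[mu]_(x in [set x | (gam * (t * 5 ^+ k) < `|f x|)%R]) (`|f x| `^ p)%:E <=
   ((5 / gam) `^ q / (5 `^ q - 1))%:E * Lp_integral mu (p + q) f)%E.
Proof.
move=> mf t0 p0 q0 gam0.
have mnf := measurable_norm mf.
have u0 k : 0 < t * 5 ^+ k by rewrite mulr_gt0// exprn_gt0.
have c0 : (0 : R) < 5 `^ q - 1.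
  rewrite subr_gt0 -[ltLHS](_ : 1 `^ q = 1); last by rewrite powR1.
  by apply: gt0_ltr_powR; rewrite ?in_itv/= ?nnegrE// ltr1n.
pose B k := [set x | gam * (t * 5 ^+ k) < `|f x|].
have mB k : measurable (B k) by exact: measurable_gt_set.
have mfp := measurable_norm_powR p mf.
apply: (@le_trans _ _ (\int[mu]_x (\sum_(k < K)
    ((t * 5 ^+ k) `^ q)%:E * (`|f x| `^ p * \1_(B k) x)%:E))%E).
  rewrite ge0_integral_sum//; last 2 first.
  - move=> k; apply: measurable_funeM; apply: measurable_EFin.
    by apply: measurable_funM => //; exact: measurable_indic.
  - by move=> k x _; rewrite -EFinM lee_fin !mulr_ge0 ?powR_ge0.
  apply: lee_sum => k _; rewrite ge0_integralZl_EFin ?powR_ge0//; last first.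
    by apply: measurable_EFin; apply: measurable_funM => //; exact: measurable_indic.
  apply: lee_wpmul2l; first by rewrite lee_fin powR_ge0.
  rewrite [leLHS]integral_mkcond; apply: (@le_integral_ge0 _ _ _ mu setT) => x _.
    by rewrite /patch; case: ifPn => _; rewrite ?lee_fin ?powR_ge0.
  rewrite /patch indicE; case: ifPn => _; rewrite ?mulr1//.
  by rewrite mulr0.
rewrite /Lp_integral -ge0_integralZl_EFin//; last 2 first.
- exact/measurable_EFin/measurable_norm_powR.
- by rewrite divr_ge0 ?powR_ge0// ltW.
apply: le_integral_ge0 => x _.
  by apply: sume_ge0 => k _; rewrite -EFinM lee_fin !mulr_ge0 ?powR_ge0.
under eq_bigr do rewrite -EFinM.
rewrite sumEFin -EFinM lee_fin.
have -> : \sum_(k < K) (t * 5 ^+ k) `^ q * (`|f x| `^ p * \1_(B k) x) =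
    `|f x| `^ p * \sum_(k < K) (t * 5 ^+ k) `^ q * (t * 5 ^+ k < `|f x| / gam)%R%:R.
  rewrite mulr_sumr; apply: eq_bigr => k _; rewrite mulrCA; congr (_ * (_ * _)).
  rewrite indicE; congr ((nat_of_bool _)%:R); rewrite ltr_pdivlMr// mulrC.
  by apply/idP/idP => [/set_mem//|h]; rewrite ?mem_set.
have v0 : 0 <= `|f x| / gam by rewrite divr_ge0// ltW.
have := sum_powR_below_le K t0 q0 v0; rewrite -ler_pdivlMl// => h.
apply: le_trans (ler_wpM2l (powR_ge0 _ _) h) _.
have -> : 5 * (`|f x| / gam) = (5 / gam) * `|f x| by ring.
rewrite powRM ?divr_ge0 ?(ltW gam0)// powRD; last by rewrite gt_eqF// addr_gt0.
rewrite le_eqVlt; apply/orP; left; apply/eqP; ring.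
Qed.

(* Absorption: a good-lambda recursion between consecutive levels bounds the
   weighted sum of the level measures. *)
Lemma good_lambda_sum_le (w G J : nat -> R) (a e : R) (K : nat) :
  (forall k, 0 <= w k) -> (forall k, 0 <= G k) -> (forall k, 0 <= J k) ->
  0 <= a -> 0 <= e -> e <= 2^-1 ->
  (forall k, w k.+1 * G k.+1 <= e * (w k * G k) + a * J k) ->
  \sum_(k < K) w k * G k <= 2 * (w 0%N * G 0%N + a * \sum_(k < K) J k).
Proof.
move=> w0 G0 J0 a0 e0 e2 rec.
have S0 : 0 <= \sum_(k < K) w k * G k by apply: sumr_ge0 => k _; rewrite mulr_ge0.
have JS0 : 0 <= \sum_(k < K) J k by apply: sumr_ge0.
have h : \sum_(k < K) w k * G k <= w 0%N * G 0%N + e * (\sum_(k < K) w k * G k) +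
    a * \sum_(k < K) J k.
  case: K S0 JS0 => [|K] S0 JS0.
    by rewrite !big_ord0 !mulr0 !addr0 mulr_ge0.
  rewrite [leLHS]big_ord_recl/= -addrA; apply: lerD => //.
  apply: (@le_trans _ _ (\sum_(k < K) (e * (w k * G k) + a * J k))).
    by apply: ler_sum => k _; exact: rec.
  rewrite big_split/= -!mulr_sumr; apply: lerD.
    by rewrite ler_wpM2l// [leRHS]big_ord_recr/= ler_wpDr// mulr_ge0.
  by rewrite ler_wpM2l// [leRHS]big_ord_recr/= ler_wpDr.
nra.
Qed.

Lemma Lp_integral_le_levels (r t : R) (g : X -> R) (M1 M2 : \bar R) :
  measurable_fun [set: X] g -> 0 < t ->
  (forall K : nat, \int[mu]_(x in [set x | (t < `|g x|)%R /\ (`|g x| <= t * 5 ^+ K)%R])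
      (`|g x| `^ r)%:E <= M1)%E ->
  (\int[mu]_(x in [set x | (`|g x| <= t)%R]) (`|g x| `^ r)%:E <= M2)%E ->
  (Lp_integral mu r g <= M2 + M1)%E.
Proof.
move=> mg t0 h1 h2.
have mng := measurable_norm mg.
pose F K := [set x | (t < `|g x|)%R /\ (`|g x| <= t * 5 ^+ K)%R].
have mle (c : R) : measurable [set x | `|g x| <= c].
  exact: (measurable_le_set _ mng).
have mF K : measurable (F K).
  rewrite (_ : F K = [set x | t < `|g x|] `&` [set x | `|g x| <= t * 5 ^+ K])//.
  by apply: measurableI => //; exact: (measurable_gt_set _ mng).
have mgr (A : set X) : measurable_fun A ((EFin \o (fun x => `|g x| `^ r)) : X -> \bar R).
  exact/measurable_EFin/measurable_norm_powR.
have cupF : \bigcup_K F K = [set x | t < `|g x|].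
  apply/seteqP; split=> [x [K _ []]//|x /= tx].
  have [K] := lt_exp2_ex (`|g x| / t); rewrite ltr_pdivrMr// => xK.
  exists K => //; split=> //; apply: (le_trans (ltW xK)); rewrite mulrC.
  rewrite ler_wpM2l ?(ltW t0)//; apply: lerXn2r; rewrite ?nnegrE ?ler_nat//.
have cv : (\int[mu]_(x in F K) (`|g x| `^ r)%:E)%E @[K --> \oo] -->
    (\int[mu]_(x in \bigcup_K F K) (`|g x| `^ r)%:E)%E.
  apply: ge0_nondecreasing_set_cvg_integral => //.
  - apply/nondecreasing_seqP => K; apply/subsetPset => x [tx xK]; split=> //.
    apply: (le_trans xK); rewrite exprS mulrCA ler_peMl ?ler1n//.
    by rewrite mulr_ge0 ?(ltW t0)// exprn_ge0.
rewrite /Lp_integral (_ : setT = [set x | `|g x| <= t] `|` \bigcup_K F K); last first.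
  by rewrite cupF; apply/seteqP; split=> x //= _; case: (leP `|g x| t); [left|right].
rewrite ge0_integral_setU//; last 2 first.
- exact: bigcup_measurable.
- by rewrite cupF; apply/disj_setPS => x [/= xt]; rewrite ltNge xt.
apply: leeD => //.
rewrite -(cvg_lim _ cv)//; apply: lime_le; first by apply/cvg_ex; eexists; exact: cv.
by apply: nearW => K; exact: h1.
Qed.

(** * The L^r bound on functions in L^p and L^r *)

Section interpolation.
Context (T : (X -> R) -> (X -> R)) (p Cp Cinf : R).
Context (p_ge1 : 1 <= p) (Cp_ge0 : 0 <= Cp) (Cinf_gt0 : 0 < Cinf).
Context (T_measurable : forall f : X -> R, measurable_fun [set: X] f ->
  (Lp_integral mu p f < +oo)%E -> measurable_fun [set: X] (T f)).
Context (T_bound : forall f : X -> R, measurable_fun [set: X] f ->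
  (Lp_integral mu p f < +oo)%E -> (Lp_integral mu p (T f) <= Cp%:E * Lp_integral mu p f)%E).
Context (T_add : forall f1 f2 : X -> R, measurable_fun [set: X] f1 ->
  measurable_fun [set: X] f2 ->
  (Lp_integral mu p f1 < +oo)%E -> (Lp_integral mu p f2 < +oo)%E ->
  {ae mu, forall x, T (fun y => f1 y + f2 y) x = T f1 x + T f2 x}).
Context (T_RBMO : forall (f : X -> R) s, 0 < s -> measurable_fun [set: X] f ->
  (forall x, `|f x| <= s) -> RBMO_bound mu lam rho (T f) (Cinf * s)).

Lemma good_lambda_operator (t gam : R) (f : X -> R) : measurable_fun [set: X] f ->
  (Lp_integral mu p f < +oo)%E -> 0 < t -> 0 < gam ->
  Cinf * gam * (beta + (1 + 3 * Ca)) <= 1 ->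
  ((beta / (t / 2) `^ p)%:E * (Cp%:E * Lp_integral mu p f) < mu setT)%E ->
  (mu (maximal_gt (fun x => `|T f x|%R) (5 * t)) <=
    (beta ^+ 2 * (Cinf * gam))%:E * mu (maximal_gt (fun x => `|T f x|%R) t) +
    ((1 + beta) * (beta / (t / 2) `^ p) * Cp)%:E *
      \int[mu]_(x in [set x | (gam * t < `|f x|)%R]) (`|f x| `^ p)%:E)%E.
Proof.
move=> mf If t0 gam0 small tlarge.
have p0 : 0 < p by rewrite (lt_le_trans ltr01).
have pn0 : p != 0 by rewrite gt_eqF.
have mnf := measurable_norm mf.
pose A := [set x | gam * t < `|f x|].
have mA : measurable A by exact: measurable_gt_set.
pose f1 x := f x * \1_A x; pose f0 x := f x * \1_(~` A) x.
have mf1 : measurable_fun [set: X] f1.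
  by apply: measurable_funM => //; exact: measurable_indic.
have mf0 : measurable_fun [set: X] f0.
  by apply: measurable_funM => //; apply: measurable_indic; exact: measurableC.
have If1 : (Lp_integral mu p f1 < +oo)%E.
  exact: le_lt_trans (Lp_integral_restrict_le mu f A pn0) If.
have If0 : (Lp_integral mu p f0 < +oo)%E.
  exact: le_lt_trans (Lp_integral_restrict_le mu f (~` A) pn0) If.
have fE : f = (fun y => f1 y + f0 y).
  apply/funext => y; rewrite /f1 /f0 -mulrDr !indicE in_setC.
  by case: (y \in A); rewrite ?addr0 ?add0r mulr1.
have f0b x : `|f0 x| <= gam * t.
  rewrite /f0 indicE in_setC; have [|] := boolP (x \in A).
    by rewrite mulr0 normr0 mulr_ge0// ltW.
  by move/negP; rewrite inE /A/= mulr1 => /negP; rewrite -leNgt.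
have gt0 : 0 < gam * t by rewrite mulr_gt0.
have [hB [osc diff]] := T_RBMO gt0 mf0 f0b.
have mTf := T_measurable mf If; have mTf0 := T_measurable mf0 If0.
have mTf1 := T_measurable mf1 If1.
have c0 : 0 <= Cinf * (gam * t) by rewrite mulr_ge0// ltW.
have csmall : Cinf * (gam * t) * (beta + (1 + 3 * Ca)) <= t.
  rewrite mulrA mulrAC -[leRHS]mul1r ler_wpM2r// ltW//.
have := good_lambda_maximal mTf mTf0 t0 c0 csmall osc diff.
(* The L^p bound turns the condition on [f] in [tlarge] into the one on [T f] that bounds the
   radii. *)
have rad : (forall x, exists r0, forall q, doubling_ball q ->
    average_gt (fun x => `|T f x|) t q -> ball q.1 q.2 x -> q.2 <= r0).
  apply: (@bounded_maximal_radius p t (T f)) => //.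
  apply: le_lt_trans tlarge; apply: lee_wpmul2l.
    by rewrite lee_fin divr_ge0 ?powR_ge0// ltW.
  exact: T_bound.
move=> /(_ rad)/le_trans; apply.
have -> : beta ^+ 2 * (Cinf * (gam * t)) / t = beta ^+ 2 * (Cinf * gam).
  by field; rewrite gt_eqF.
apply: leeD => //; rewrite !EFinM -!muleA; apply: lee_wpmul2l.
  by rewrite lee_fin addr_ge0// ltW.
have mdiff : measurable_fun [set: X] (fun x => T f x - T f0 x).
  exact: measurable_funB.
apply: (le_trans (weak_type_maximal_powR mdiff p_ge1 t0 (fun q => ball_fin q.1 q.2))).
rewrite EFinM -muleA; apply: lee_wpmul2l; first by rewrite lee_fin ltW.
apply: lee_wpmul2l; first by rewrite lee_fin invr_ge0 powR_ge0.
rewrite (@Lp_integral_ae_eq _ _ _ mu p _ (T f1))//; last first.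
  have := T_add mf1 mf0 If1 If0; rewrite -fE; apply: filterS => x ->.
  by rewrite addrK.
by apply: (le_trans (T_bound mf1 If1)); rewrite /f1 Lp_integral_restrict.
Qed.

(** The value of [gam]. Multiplied by the sum in parentheses it gives 1/2, so each summand is
    controlled: the first makes the absorbed coefficient at most 1/2, with [5 ^ r] the growth of the
    weights per level, and the second yields [c_small]. *)
Let goodconst r : R := (2 * (5 `^ r * beta ^+ 2 * Cinf + Cinf * (beta + (1 + 3 * Ca))))^-1.

(** The starting level will be [kap * s], with [a / 2 <= s ^ p * mu setT] for [a] the L^p integral
    of [f]. Since [kap / 2] exceeds [2 * beta * Cp], the weak type bound at that level stays below
    [mu setT]. *)
Let kap : R := 2 * (1 + 2 * beta * Cp).

Lemma interpolation_levels (q t a b : R) (f : X -> R) : measurable_fun [set: X] f ->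
  0 < q -> 0 < t -> Lp_integral mu p f = a%:E -> Lp_integral mu (p + q) f = b%:E ->
  0 <= a -> 0 <= b -> ((beta / (t / 2) `^ p)%:E * (Cp%:E * a%:E) < mu setT)%E ->
  let gam := goodconst (p + q) in
  forall K, (\int[mu]_(x in [set x | (t < `|T f x|)%R /\ (`|T f x| <= t * 5 ^+ K)%R])
      (`|T f x| `^ (p + q))%:E <=
   (5 `^ (p + q) * (2 * (beta * 2 `^ p * Cp * (t `^ q * a) +
     5 `^ (p + q) * ((1 + beta) * beta * 2 `^ p * Cp) *
       ((5 / gam) `^ q / (5 `^ q - 1) * b))))%:E)%E.
Proof.
move=> mf q0 t0 Ia Ib a0 b0 tlarge gam K.
have p0 : 0 < p by rewrite (lt_le_trans ltr01).
have pq0 : 0 < p + q by rewrite addr_gt0.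
have Ifin : (Lp_integral mu p f < +oo)%E by rewrite Ia ltry.
have mTf := T_measurable mf Ifin.
have gam_den : 0 < 5 `^ (p + q) * beta ^+ 2 * Cinf + Cinf * (beta + (1 + 3 * Ca)).
  have Ca0 : 0 < Ca by rewrite (lt_le_trans ltr01).
  by rewrite addr_gt0// !mulr_gt0 ?powR_gt0 ?exprn_gt0// !addr_gt0// mulr_gt0.
have gam0 : 0 < gam by rewrite /gam /goodconst invr_gt0 mulr_gt0.
have gamE : gam * (5 `^ (p + q) * beta ^+ 2 * Cinf + Cinf * (beta + (1 + 3 * Ca))) = 2^-1.
  rewrite /gam /goodconst; move: gam_den; set D := _ + _ => D0; field.
  by rewrite gt_eqF.
have term1 : 0 <= gam * (5 `^ (p + q) * beta ^+ 2 * Cinf).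
  by rewrite !mulr_ge0 ?powR_ge0 ?exprn_ge0 ?ltW.
have term2 : 0 <= gam * (Cinf * (beta + (1 + 3 * Ca))).
  have Ca0 : 0 < Ca by rewrite (lt_le_trans ltr01).
  by rewrite ltW// !mulr_gt0// !addr_gt0// mulr_gt0.
have small : Cinf * gam * (beta + (1 + 3 * Ca)) <= 1.
  by move: gamE; rewrite mulrDr mulrAC [_ * gam]mulrC; lra.
have eta2 : 5 `^ (p + q) * (beta ^+ 2 * (Cinf * gam)) <= 2^-1.
  rewrite (_ : _ * _ = gam * (5 `^ (p + q) * beta ^+ 2 * Cinf)); last by ring.
  by move: gamE; rewrite mulrDr; lra.
have u0 k : 0 < t * 5 ^+ k by rewrite mulr_gt0// exprn_gt0.
have tu k : t <= t * 5 ^+ k by rewrite ler_peMr ?(ltW t0)// exprn_ege1// ler1n.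
have ge0u k : 0 <= t * 5 ^+ k by exact: ltW.
pose G k := mu (maximal_gt (fun x => `|T f x|) (t * 5 ^+ k)).
(* These a priori bounds make each level measure a real number, which legitimises the absorption;
   the case [k = 0] also supplies the initial term [t ^ q * a]. *)
have weakG k : (G k <= (beta / (t * 5 ^+ k / 2) `^ p * (Cp * a))%:E)%E.
  apply: le_trans (weak_type_maximal_powR mTf p_ge1 (u0 k) (fun q => ball_fin q.1 q.2)) _.
  rewrite [leRHS]EFinM; apply: lee_wpmul2l; first by rewrite lee_fin divr_ge0 ?powR_ge0// ltW.
  by apply: le_trans (T_bound mf Ifin) _; rewrite Ia.
have Gfin k : G k \is a fin_num.
  by rewrite ge0_fin_numE//; apply: le_lt_trans (weakG k) _; rewrite ltry.
pose J k := (\int[mu]_(x in [set x | (gam * (t * 5 ^+ k) < `|f x|)%R]) (`|f x| `^ p)%:E)%E.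
have J0 k : (0 <= J k)%E by apply: integral_ge0 => x _; rewrite lee_fin powR_ge0.
have Jfin k : J k \is a fin_num.
  rewrite ge0_fin_numE//; apply: le_lt_trans Ifin.
  apply: ge0_subset_integral => //.
  - exact: (measurable_gt_set _ (measurable_norm mf)).
  - exact/measurable_EFin/measurable_norm_powR.
have rec k : (G k.+1 <= (beta ^+ 2 * (Cinf * gam))%:E * G k +
    ((1 + beta) * (beta / (t * 5 ^+ k / 2) `^ p) * Cp)%:E * J k)%E.
  rewrite /G exprS mulrCA; apply: good_lambda_operator => //.
  apply: le_lt_trans tlarge; rewrite Ia -!EFinM lee_fin.
  rewrite ler_wpM2r ?mulr_ge0// ler_wpM2l ?(ltW beta_gt0)//.
  rewrite lef_pV2 ?posrE ?powR_gt0 ?divr_gt0//.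
  apply: ge0_ler_powR; rewrite ?nnegrE ?(ltW p0) ?divr_ge0 ?(ltW t0)//.
  by rewrite ler_wpM2r.
have half k : (t * 5 ^+ k / 2) `^ p = (t * 5 ^+ k) `^ p / 2 `^ p.
  by rewrite powRM ?invr_ge0// -powR_inv1// powRAC powR_inv1 ?powR_ge0.
have u_pq k : (t * 5 ^+ k) `^ (p + q) = (t * 5 ^+ k) `^ p * (t * 5 ^+ k) `^ q.
  by rewrite powRD// gt_eqF.
have upn0 k : (t * 5 ^+ k) `^ p != 0 by rewrite gt_eqF// powR_gt0.
have twopn0 : (2 : R) `^ p != 0 by rewrite gt_eqF// powR_gt0.
apply: (le_trans (sum_distribution_lt K mTf t0 pq0)).
under eq_bigr => k _ do rewrite -/(G k) -(fineK (Gfin k)) -EFinM.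
rewrite sumEFin lee_fin.
under eq_bigr => k _ do rewrite exprS mulrCA (powRM _ (ler0n _ 5) (ge0u k)) -mulrA.
rewrite -mulr_sumr ler_wpM2l ?powR_ge0//.
apply: le_trans (@good_lambda_sum_le (fun k => (t * 5 ^+ k) `^ (p + q)) (fine \o G)
  (fun k => (t * 5 ^+ k) `^ q * fine (J k))
  (5 `^ (p + q) * ((1 + beta) * beta * 2 `^ p * Cp))
  (5 `^ (p + q) * (beta ^+ 2 * (Cinf * gam))) K _ _ _ _ _ _ _) _.
- by move=> k; exact: powR_ge0.
- by move=> k; exact: fine_ge0.
- by move=> k; rewrite mulr_ge0 ?powR_ge0// fine_ge0.
- by rewrite !mulr_ge0 ?powR_ge0 ?addr_ge0// ltW.
- by rewrite !mulr_ge0 ?powR_ge0 ?exprn_ge0 ?ltW.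
- exact: eta2.
- move=> k /=; have := rec k.
  rewrite -(fineK (Gfin k)) -(fineK (Gfin k.+1)) -(fineK (Jfin k)) -!EFinM -EFinD lee_fin.
  set g1 := fine _; set g0 := fine _; set j := fine _ => h.
  have := ler_wpM2l (powR_ge0 (t * 5 ^+ k.+1) (p + q)) h.
  move=> /le_trans; apply; rewrite exprS mulrCA (powRM _ (ler0n _ 5) (ge0u k)).
  rewrite half u_pq /= le_eqVlt; apply/orP; left; apply/eqP; field.
  by rewrite twopn0 upn0.
rewrite ler_wpM2l//; apply: lerD.
  rewrite expr0 mulr1 /=; have := weakG 0%N; rewrite -(fineK (Gfin 0%N)) lee_fin => h.
  apply: le_trans (ler_wpM2l (powR_ge0 _ _) h) _.
  have := half 0%N; have := u_pq 0%N; have := upn0 0%N; rewrite expr0 mulr1 => un0 -> ->.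
  rewrite le_eqVlt; apply/orP; left; apply/eqP; field.
  by rewrite twopn0 un0.
apply: ler_wpM2l; first by rewrite !mulr_ge0 ?powR_ge0 ?addr_ge0// ltW.
have := @sum_truncated_le p q t gam f K mf t0 p0 q0 gam0.
rewrite Ib -EFinM; under eq_bigr => k _ do rewrite -/(J k) -(fineK (Jfin k)) -EFinM.
by rewrite sumEFin lee_fin.
Qed.

Lemma interpolation_bound (q : R) : 0 < q -> exists C : R, 0 <= C /\
  forall f, measurable_fun [set: X] f -> (Lp_integral mu p f < +oo)%E ->
    (Lp_integral mu (p + q) f < +oo)%E ->
    (Lp_integral mu (p + q) (T f) <= C%:E * Lp_integral mu (p + q) f)%E.
Proof.
move=> q0.
have p0 : 0 < p by rewrite (lt_le_trans ltr01).
have pq0 : 0 < p + q by rewrite addr_gt0.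
have kap2 : 1 <= kap / 2.
  by rewrite /kap mulrC mulKf// lerDl !mulr_ge0// ltW.
have kap0 : 0 < kap by lra.
pose gam := goodconst (p + q).
have gam0 : 0 <= gam.
  have Ca0 : 0 < Ca by rewrite (lt_le_trans ltr01).
  rewrite /gam /goodconst invr_ge0 mulr_ge0// ltW//.
  by rewrite addr_gt0// !mulr_gt0 ?powR_gt0 ?exprn_gt0// !addr_gt0// mulr_gt0.
have c50 : (0 : R) < 5 `^ q - 1.
  rewrite subr_gt0 -[ltLHS](_ : 1 `^ q = 1); last by rewrite powR1.
  by apply: gt0_ltr_powR; rewrite ?in_itv/= ?nnegrE// ltr1n.
pose C1 := 2 * kap `^ q.
pose C2 := 5 `^ (p + q) * (2 * (beta * 2 `^ p * Cp * C1 +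
     5 `^ (p + q) * ((1 + beta) * beta * 2 `^ p * Cp) *
       ((5 / gam) `^ q / (5 `^ q - 1)))).
have C10 : 0 <= C1 by rewrite mulr_ge0 ?powR_ge0.
have C20 : 0 <= C2.
  have b1 : 0 <= 1 + beta by rewrite addr_ge0// ltW.
  rewrite /C2 mulr_ge0 ?powR_ge0// mulr_ge0// addr_ge0//.
    by rewrite !mulr_ge0 ?powR_ge0// ltW.
  by rewrite !mulr_ge0 ?powR_ge0// ?invr_ge0 ltW.
exists (Cp * C1 + C2); split; first by rewrite addr_ge0// mulr_ge0.
move=> f mf Ip Ir; have mTf := T_measurable mf Ip.
have ITf := T_bound mf Ip.
(* The scale [s] divides by this integral; if it vanishes, the L^p bound makes [T f] null. *)
have [I0|In0] := eqVneq (Lp_integral mu p f) 0%E.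
  have -> : Lp_integral mu (p + q) (T f) = 0%E; last first.
    by rewrite mule_ge0 ?Lp_integral_ge0// lee_fin addr_ge0// mulr_ge0.
  apply: Lp_integral_eq0 => //; first by rewrite gt_eqF.
  apply: (@Lp_integral_eq0_ae _ _ _ mu p) => //; apply/eqP.
  by rewrite eq_le Lp_integral_ge0 andbT; move: ITf; rewrite I0 mule0.
have afin : Lp_integral mu p f \is a fin_num by rewrite ge0_fin_numE// Lp_integral_ge0.
have bfin : Lp_integral mu (p + q) f \is a fin_num.
  by rewrite ge0_fin_numE// Lp_integral_ge0.
set a := fine (Lp_integral mu p f); set b := fine (Lp_integral mu (p + q) f).
have Ia : Lp_integral mu p f = a%:E by rewrite fineK.
have Ib : Lp_integral mu (p + q) f = b%:E by rewrite fineK.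
have a0 : 0 < a.
  by rewrite lt_neqAle fine_ge0 ?Lp_integral_ge0// andbT eq_sym -eqe -Ia.
have b0 : 0 < b.
  rewrite lt_neqAle fine_ge0 ?Lp_integral_ge0// andbT eq_sym -eqe -Ib.
  apply: contra In0 => /eqP Ib0; apply/eqP; apply: Lp_integral_eq0 => //.
    by rewrite gt_eqF.
  exact: Lp_integral_eq0_ae Ib0.
(* This makes the tail in [Lp_integral_split_le] equal to [a / 2], and turns [t ^ q * a] into a
   multiple of [b], which eliminates the L^p integral from the final estimate. *)
pose s := (2 * b / a) `^ q^-1.
have ba0 : 0 < 2 * b / a by rewrite divr_gt0// mulr_gt0.
have s0 : 0 < s by rewrite powR_gt0.
have sq : s `^ q = 2 * b / a.
  by rewrite /s -powRrM mulVf ?gt_eqF// powRr1// ltW.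
have Mcase : mu setT = +oo%E \/ exists2 M : R, 0 <= M & mu setT = M%:E.
  have [->|nty] := eqVneq (mu setT) +oo%E; [by left|right].
  by exists (fine (mu setT)); rewrite ?fine_ge0// fineK// ge0_fin_numE// ltey.
have aM : ((a / 2)%:E <= (s `^ p)%:E * mu setT)%E.
  have := Lp_integral_split_le mu mf s0 p0 q0; rewrite Ia Ib sq -EFinM.
  have -> : (2 * b / a)^-1 * b = a / 2 by field; rewrite !gt_eqF.
  case: Mcase => [->|[M _ ->]].
    by rewrite gt0_muley ?leey// lte_fin powR_gt0.
  by rewrite -EFinM -EFinD !lee_fin; lra.
pose t := kap * s.
have t0 : 0 < t by rewrite mulr_gt0.
have tqa : t `^ q * a = C1 * b.
  rewrite powRM ?(ltW kap0) ?(ltW s0)// sq /C1; field; rewrite gt_eqF//.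
have tlarge : ((beta / (t / 2) `^ p)%:E * (Cp%:E * a%:E) < mu setT)%E.
  rewrite -!EFinM; case: Mcase => [->|[M M0 ME]]; first by rewrite ltry.
  move: aM; rewrite ME -EFinM lee_fin => aM; rewrite lte_fin.
  have sp0 : 0 < s `^ p by rewrite powR_gt0.
  have kp : kap / 2 <= (kap / 2) `^ p by apply: le1r_powR.
  have kp0 : 0 < (kap / 2) `^ p by rewrite powR_gt0// divr_gt0.
  have -> : t / 2 = (kap / 2) * s by rewrite /t; ring.
  rewrite powRM ?divr_ge0 ?(ltW kap0) ?(ltW s0)//.
  rewrite mulrAC ltr_pdivrMr ?mulr_gt0//.
  have M1 : 0 < M.
    rewrite -(pmulr_rgt0 _ sp0); apply: lt_le_trans aM; rewrite divr_gt0//.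
  apply: (@le_lt_trans _ _ (beta * (Cp * (2 * (s `^ p * M))))).
    rewrite ler_wpM2l ?(ltW beta_gt0)// ler_wpM2l//; lra.
  have -> : beta * (Cp * (2 * (s `^ p * M))) = (2 * beta * Cp) * (M * s `^ p) by ring.
  have -> : M * ((kap / 2) `^ p * s `^ p) = ((kap / 2) `^ p) * (M * s `^ p) by ring.
  rewrite ltr_pM2r ?mulr_gt0//; apply: lt_le_trans kp.
  by rewrite /kap; lra.
have lev := interpolation_levels mf q0 t0 Ia Ib (ltW a0) (ltW b0) tlarge.
rewrite Ib -EFinM mulrDl EFinD.
apply: (Lp_integral_le_levels mTf t0 (M1 := (C2 * b)%:E)).
  move=> K; apply: (le_trans (lev K)); rewrite tqa lee_fin le_eqVlt.
  by apply/orP; left; apply/eqP; rewrite /C2 -/gam; ring.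
(* Below the starting level, [|T f| ^ (p + q) <= t ^ q * |T f| ^ p]. *)
apply: (@le_trans _ _ ((t `^ q)%:E * Lp_integral mu p (T f))%E).
  rewrite /Lp_integral -ge0_integralZl_EFin ?powR_ge0//; last first.
    exact/measurable_EFin/measurable_norm_powR.
  rewrite [leLHS]integral_mkcond; apply: (@le_integral_ge0 _ _ _ mu setT) => x _.
    by rewrite /patch; case: ifPn => _; rewrite ?lee_fin ?powR_ge0.
  rewrite /patch -EFinM; case: ifPn => [/set_mem/= xt|_]; last first.
    by rewrite lee_fin mulr_ge0 ?powR_ge0.
  rewrite lee_fin powRD; last by rewrite gt_eqF.
  rewrite mulrC ler_wpM2r ?powR_ge0// ge0_ler_powR ?nnegrE ?(ltW q0) ?(ltW t0)//.
rewrite -mulrA -tqa mulrCA EFinM; apply: lee_wpmul2l; first by rewrite lee_fin powR_ge0.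
by apply: (le_trans ITf); rewrite Ia.
Qed.

End interpolation.

End doubling_balls.

Lemma mule_EFin_le {R : realDomainType} (k e : R) (I : \bar R) : 0 <= k ->
  (I <= e%:E)%E -> (k%:E * I <= (k * e)%:E)%E.
Proof. by move=> k0 Ie; rewrite EFinM; apply: lee_wpmul2l; rewrite ?lee_fin. Qed.

(** * Approximation in L^r and almost everywhere convergence *)

Section lp_density.
Context {R : realType} {d : measure_display} {X : measurableType d}.
Context (mu : {measure set X -> \bar R}).
Implicit Types (f g h : X -> R) (p q r : R).

Lemma powR_normD_le r (a b : R) : 0 < r ->
  `|a + b| `^ r <= 2 `^ r * (`|a| `^ r + `|b| `^ r).
Proof.
move=> r0; wlog ab : a b / `|a| <= `|b|.
  move=> H; have [/H//|/ltW/H] := leP `|a| `|b|.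
  by rewrite addrC [X in _ * X]addrC.
apply: (@le_trans _ _ ((2 * `|b|) `^ r)).
  apply: ge0_ler_powR; rewrite ?nnegrE ?(ltW r0) ?mulr_ge0//.
  by apply: le_trans (ler_normD _ _) _; lra.
by rewrite powRM// ler_wpM2l ?powR_ge0// ler_wpDl ?powR_ge0.
Qed.

Lemma Lp_integralD_le r f g : 0 < r -> measurable_fun [set: X] f ->
  measurable_fun [set: X] g ->
  (Lp_integral mu r (fun x => (f x + g x)%R) <=
   (2 `^ r)%:E * (Lp_integral mu r f + Lp_integral mu r g))%E.
Proof.
move=> r0 mf mg; rewrite /Lp_integral -ge0_integralD//; last 2 first.
- exact/measurable_EFin/measurable_norm_powR.
- exact/measurable_EFin/measurable_norm_powR.
rewrite -ge0_integralZl_EFin ?powR_ge0//; last 2 first.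
- by move=> x _; rewrite -EFinD lee_fin addr_ge0 ?powR_ge0.
- by apply: emeasurable_funD; exact/measurable_EFin/measurable_norm_powR.
apply: le_integral_ge0 => x _; first by rewrite lee_fin powR_ge0.
by rewrite -EFinD -EFinM lee_fin; exact: powR_normD_le.
Qed.

Lemma Lp_integralZ r a f : measurable_fun [set: X] f ->
  Lp_integral mu r (fun x => a * f x) = ((`|a| `^ r)%:E * Lp_integral mu r f)%E.
Proof.
move=> mf; rewrite /Lp_integral -ge0_integralZl_EFin ?powR_ge0//; last first.
  exact/measurable_EFin/measurable_norm_powR.
by apply: eq_integral => x _; rewrite normrM powRM// EFinM.
Qed.

Lemma Lp_integralB_le r f g : 0 < r -> measurable_fun [set: X] f ->
  measurable_fun [set: X] g ->
  (Lp_integral mu r (fun x => (f x - g x)%R) <=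
   (2 `^ r)%:E * (Lp_integral mu r f + Lp_integral mu r g))%E.
Proof.
move=> r0 mf mg.
have mNg : measurable_fun [set: X] (fun x => -1 * g x).
  exact: measurable_funM.
have := Lp_integralD_le r0 mf mNg; rewrite Lp_integralZ// normrN1 powR1 mul1e.
apply: le_trans; rewrite le_eqVlt; apply/orP; left; apply/eqP.
by congr Lp_integral; apply/funext => x; rewrite mulN1r.
Qed.

Lemma Lp_integral_lincomb_fin r (a : R) (f g : X -> R) : 0 < r -> measurable_fun [set: X] f ->
  measurable_fun [set: X] g ->
  (Lp_integral mu r f < +oo)%E -> (Lp_integral mu r g < +oo)%E ->
  (Lp_integral mu r (fun y => (a * f y + g y)%R) < +oo)%E.
Proof.
move=> r0 mf mg If Ig.
have maf : measurable_fun [set: X] (fun y => a * f y) by exact: measurable_funM.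
apply: (le_lt_trans (Lp_integralD_le r0 maf mg)).
apply: lte_mul_pinfty; rewrite ?lee_fin ?powR_ge0//.
apply: lte_add_pinfty; last exact: Ig.
rewrite Lp_integralZ; last exact: mf.
by apply: lte_mul_pinfty; [rewrite lee_fin powR_ge0| |exact: If].
Qed.

(** Only the small values of [f] can keep it out of the smaller exponent [p], so [h] drops the
    values of modulus at most [n.+1%:R^-1]. The error is then uniformly small, and small in L^(p+q)
    by dominated convergence. *)
Lemma Lp_truncation p q f (e del : R) : 0 < p -> 0 < q ->
  measurable_fun [set: X] f -> (Lp_integral mu (p + q) f < +oo)%E ->
  0 < e -> 0 < del ->
  exists h : X -> R, [/\ measurable_fun [set: X] h, (Lp_integral mu p h < +oo)%E,
    (Lp_integral mu (p + q) h < +oo)%E,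
    (Lp_integral mu (p + q) (fun x => (f x - h x)%R) <= e%:E)%E &
    forall x, `|f x - h x| <= del].
Proof.
move=> p0 q0 mf If e0 del0.
have pq0 : 0 < p + q by rewrite addr_gt0.
have mnf := measurable_norm mf.
pose A (n : nat) := [set x | n.+1%:R^-1 < `|f x|].
have mA n : measurable (A n) by exact: (measurable_gt_set _ mnf).
have fhE n x : f x - f x * \1_(A n) x = f x * \1_(~` A n) x.
  by rewrite !indicE in_setC; case: (x \in A n); rewrite ?mulr1 ?mulr0 ?subrr ?subr0.
have cv : (\int[mu]_x (`|f x * \1_(~` A n) x| `^ (p + q))%:E)%E @[n --> \oo] -->
    (\int[mu]_x (cst 0 x))%E.
  apply: (@dominated_cvg _ _ _ mu _ measurableT _ _ (fun x => (`|f x| `^ (p + q))%:E)) => //.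
  - move=> n; apply: measurable_EFin; apply: measurable_norm_powR.
    by apply: measurable_funM => //; apply: measurable_indic; exact: measurableC.
  - move=> x _; apply: cvg_near_cst.
    have [fx0|fx0] := eqVneq (f x) 0.
      by apply: nearW => n; rewrite fx0 mul0r normr0 powR0// gt_eqF.
    exists (Num.bound `|f x|^-1) => // n /= nx.
    rewrite indicE in_setC mem_set ?mulr0 ?normr0 ?powR0 ?gt_eqF//.
    rewrite /A/= -[ltRHS]invrK ltf_pV2 ?posrE ?invr_gt0 ?normr_gt0//.
    apply: (lt_le_trans (archi_boundP _)); rewrite ?invr_ge0// ler_nat.
    exact: leq_trans nx _.
  - apply/integrableP; split; first exact/measurable_EFin/measurable_norm_powR.
    rewrite (_ : (\int[mu]_(x in _) _)%E = Lp_integral mu (p + q) f)//.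
    by apply: eq_integral => x _; rewrite gee0_abs// lee_fin powR_ge0.
  - move=> n x _; rewrite gee0_abs ?lee_fin ?powR_ge0//.
    rewrite indicE; case: (x \in _); rewrite ?mulr1// mulr0 normr0 powR0 ?powR_ge0//.
    by rewrite gt_eqF.
rewrite integral0 in cv.
have [n [nd nI]] : exists n : nat, n.+1%:R^-1 <= del /\
    (\int[mu]_x (`|f x * \1_(~` A n) x| `^ (p + q))%:E <= e%:E)%E.
  apply: contrapT => nex.
  have : (e%:E <= 0)%E.
    rewrite -(cvg_lim _ cv)//; apply: lime_ge; first by apply/cvg_ex; eexists; exact: cv.
    exists (Num.bound del^-1) => // n /= nx.
    rewrite leNgt; apply/negP => h; apply: nex; exists n; split; last exact: ltW.
    rewrite -[leRHS]invrK lef_pV2 ?posrE ?invr_gt0//.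
    apply: ltW; apply: (lt_le_trans (archi_boundP _)); rewrite ?invr_ge0 ?(ltW del0)// ler_nat.
    exact: leq_trans nx _.
  by rewrite lee_fin leNgt e0.
exists (fun x => f x * \1_(A n) x); split.
- by apply: measurable_funM => //; exact: measurable_indic.
- apply: (@le_lt_trans _ _ ((n.+1%:R `^ q)%:E * Lp_integral mu (p + q) f)%E).
    rewrite /Lp_integral -ge0_integralZl_EFin ?powR_ge0//; last first.
      exact/measurable_EFin/measurable_norm_powR.
    apply: le_integral_ge0 => x _; first by rewrite lee_fin powR_ge0.
    rewrite -EFinM lee_fin indicE; case: (boolP (x \in A n)) => [/set_mem xA|_]; last first.
      by rewrite mulr0 normr0 powR0 ?gt_eqF// mulr_ge0 ?powR_ge0.
    rewrite mulr1 powRD; last by rewrite gt_eqF.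
    rewrite mulrCA ler_peMr ?powR_ge0// -powRM//.
    rewrite -[leLHS](_ : 1 `^ q = 1); last by rewrite powR1.
    apply: ge0_ler_powR; rewrite ?nnegrE ?(ltW q0)// ?mulr_ge0//.
    by rewrite -ler_pdivrMl// mulr1 ltW.
  by apply: lte_mul_pinfty => //; rewrite lee_fin powR_ge0.
- apply: le_lt_trans If; apply: Lp_integral_restrict_le.
  by rewrite gt_eqF.
- by under eq_fun do rewrite fhE.
- move=> x; rewrite fhE; apply: le_trans nd.
  rewrite indicE in_setC; have [|] := boolP (x \in A n).
    by rewrite mulr0 normr0.
  by move/negP; rewrite inE /A/= mulr1 => /negP; rewrite -leNgt.
Qed.

(** Fatou's lemma adapted to eventual domination: if [u k x] tends to a nonzero limit, [|u k x|]
    eventually exceeds half of the modulus of the limit, the form in which it is applied. *)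
Lemma fatou_le (v : nat -> X -> R) (G : X -> R) (M : \bar R) :
  (forall k, measurable_fun [set: X] (v k)) -> (forall k x, 0 <= v k x) ->
  (forall x, 0 <= G x) ->
  (forall x, exists N : nat, forall k, (N <= k)%N -> G x <= v k x) ->
  (forall k, \int[mu]_x (v k x)%:E <= M)%E -> (\int[mu]_x (G x)%:E <= M)%E.
Proof.
move=> mv v0 G0 Gv vM.
apply: (@le_trans _ _ (\int[mu]_x limn_einf (fun k => (v k x)%:E))%E).
  apply: le_integral_ge0 => x _; first by rewrite lee_fin.
  have [N NP] := Gv x; rewrite limn_einf_lim; apply: lime_ge.
    exact: is_cvg_einfs.
  exists N => // n /= Nn; apply: le_ereal_inf_tmp => _ [k /= nk <-].
  by rewrite lee_fin; apply: NP; exact: leq_trans nk.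
have := @fatou _ _ _ mu _ measurableT (fun k x => (v k x)%:E) _ _.
move=> /(_ (fun k => @measurable_EFin _ _ _ (v k) setT (mv k))) => h.
apply: le_trans (h _) _; first by move=> k x _; rewrite lee_fin.
rewrite limn_einf_lim; apply: lime_le; first exact: is_cvg_einfs.
apply: nearW => n; apply: le_trans (vM n).
by apply: ereal_inf_lbound; exists n => /=.
Qed.

(* Summability of the weighted norms of the increments forces geometric decay of
   the increments almost everywhere. *)
Lemma cvg_of_fast_increments (r M : R) (u : nat -> X -> R) : 0 < r ->
  (forall k, measurable_fun [set: X] (u k)) ->
  (forall k, Lp_integral mu r (fun x => (u k.+1 x - u k x)%R) <=
     (M / (2 ^+ k.+1 * (2 ^+ k) `^ r))%:E)%E ->
  exists E : set X, [/\ measurable E, mu (~` E) = 0%E &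
    forall x, E x -> cvgn (fun k => u k x)].
Proof.
move=> r0 mu_ Iu.
pose D k x := u k.+1 x - u k x.
have mD k : measurable_fun [set: X] (D k) by exact: measurable_funB.
pose w k : R := (2 ^+ k) `^ r.
have w0 k : 0 <= w k by exact: powR_ge0.
pose W x := (\sum_(0 <= k <oo) (w k * `|D k x| `^ r)%:E)%E.
have mterm k : measurable_fun [set: X] ((EFin \o (fun x => w k * `|D k x| `^ r)) : X -> \bar R).
  by apply: measurable_EFin; apply: measurable_funM => //; exact: measurable_norm_powR.
have term0 k x : (0 <= (w k * `|D k x| `^ r)%:E)%E.
  by rewrite lee_fin mulr_ge0 ?powR_ge0.
have mW : measurable_fun [set: X] W.
  exact: (@ge0_emeasurable_sum _ _ _ setT (fun k x => (w k * `|D k x| `^ r)%:E) predT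
    (fun k x _ _ => term0 k x) (fun k _ => mterm k)).
have W0 x : (0 <= W x)%E by apply: nneseries_ge0 => k _ _; exact: term0.
(* After weighting, the [k]-th increment contributes [M / 2 ^ k.+1], and these sum to [M]. *)
have IW : (\int[mu]_x W x <= M%:E)%E.
  rewrite /W integral_nneseries//.
  have h := @cvg_geometric_eseries_half R M 0.
  rewrite expr0 divr1 in h; rewrite -(cvg_lim _ h)//.
  apply: lee_nneseries => k _; first by move=> _; apply: integral_ge0.
  under eq_integral do rewrite EFinM.
  rewrite ge0_integralZl_EFin//; last exact/measurable_EFin/measurable_norm_powR.
  apply: (@le_trans _ _ ((w k)%:E * (M / (2 ^+ k.+1 * (2 ^+ k) `^ r))%:E)%E).
    by apply: lee_wpmul2l; [rewrite lee_fin|exact: Iu].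
  rewrite -EFinM lee_fin /w addn1 natrX le_eqVlt; apply/orP; left; apply/eqP.
  have wn0 : (2 ^+ k) `^ r != 0 :> R by rewrite gt_eqF// powR_gt0// exprn_gt0.
  by field; rewrite wn0 expf_neq0.
exists [set x | (W x < +oo)%E]; split.
- by rewrite -[X in measurable X]setTI; exact: emeasurable_fun_infty_o.
- have : mu.-integrable setT W.
    apply/integrableP; split=> //.
    under eq_integral do rewrite gee0_abs//.
    by apply: le_lt_trans IW _; rewrite ltry.
  move=> /(integrable_ae measurableT)[A [mA A0 hA]].
  apply/eqP; rewrite eq_le measure_ge0 andbT -A0; apply: le_measure; rewrite ?inE//.
    rewrite -[X in measurable (~` X)]setTI; apply: measurableC.
    exact: emeasurable_fun_infty_o.
  move=> x /= Wx; apply: hA => /= /(_ I); rewrite ge0_fin_numE//.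
- move=> x /= Wx.
  have Wfin : W x \is a fin_num by rewrite ge0_fin_numE.
  have W'0 : 0 <= fine (W x) by exact: fine_ge0.
  pose c := fine (W x) `^ r^-1.
  have c0 : 0 <= c by exact: powR_ge0.
  (* A single term of the series is at most its sum, so [(2 ^ k * |D k x|) ^ r <= W x]. *)
  have Dk k : `|D k x| <= c / 2 ^+ k.
    have : ((w k * `|D k x| `^ r)%:E <= (fine (W x))%:E)%E.
      rewrite fineK//; apply: le_trans (nneseries_lim_ge k.+1 _); last first.
        by move=> n _ _; exact: term0.
      by rewrite big_nat_recr//= leeDr// sume_ge0.
    rewrite lee_fin -powRM ?exprn_ge0// => h.
    rewrite ler_pdivlMr ?exprn_gt0// mulrC /c.
    have -> : 2 ^+ k * `|D k x| = ((2 ^+ k * `|D k x|) `^ r) `^ r^-1.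
      by rewrite -powRrM divff ?gt_eqF// powRr1// mulr_ge0// exprn_ge0.
    by apply: ge0_ler_powR; rewrite ?nnegrE ?invr_ge0 ?(ltW r0) ?powR_ge0.
  have cs : cvgn (series (telescope (fun k => u k x))).
    apply: normed_cvg; apply: (@series_le_cvg _ _ (geometric c 2^-1)).
    + by move=> n; exact: normr_ge0.
    + by move=> n; rewrite /geometric/= mulr_ge0// exprn_ge0.
    + by move=> n; rewrite /geometric/= exprVn; exact: Dk.
    + by apply: is_cvg_geometric_series; rewrite ger0_norm// invf_lt1// ltr1n.
  rewrite (_ : (fun k => u k x) = (fun k => u 0%N x + series (telescope (fun k => u k x)) k)).
    by apply: is_cvgD => //; exact: is_cvg_cst.
  by apply/funext => k; rewrite -eq_sum_telescope.
Qed.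

End lp_density.

(** * Extension of the operator by density *)

Section lp_extension.
Context {R : realType} {d : measure_display} {X : measurableType d}.
Context (mu : {measure set X -> \bar R}).
Context (T : (X -> R) -> (X -> R)) (p q C : R).
Context (p_gt0 : 0 < p) (q_gt0 : 0 < q) (C_ge0 : 0 <= C).
Context (T_measurable : forall f : X -> R, measurable_fun [set: X] f ->
  (Lp_integral mu p f < +oo)%E -> measurable_fun [set: X] (T f)).
Context (T_linear : forall (a : R) (f g : X -> R), measurable_fun [set: X] f ->
  measurable_fun [set: X] g ->
  (Lp_integral mu p f < +oo)%E -> (Lp_integral mu p g < +oo)%E ->
  {ae mu, forall x, T (fun y => a * f y + g y) x = a * T f x + T g x}).
Context (T_bound : forall f : X -> R, measurable_fun [set: X] f ->
  (Lp_integral mu p f < +oo)%E -> (Lp_integral mu (p + q) f < +oo)%E ->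
  (Lp_integral mu (p + q) (T f) <= C%:E * Lp_integral mu (p + q) f)%E).

Definition in_both (h : X -> R) : Prop := [/\ measurable_fun [set: X] h,
  (Lp_integral mu p h < +oo)%E & (Lp_integral mu (p + q) h < +oo)%E].

Let pq_gt0 : 0 < p + q. Proof. exact: addr_gt0. Qed.

Lemma in_both_lincomb (a : R) (f g : X -> R) : in_both f -> in_both g ->
  in_both (fun y => a * f y + g y).
Proof.
move=> [mf pf rf] [mg pg rg]; split; last 2 first.
- exact: Lp_integral_lincomb_fin.
- exact: Lp_integral_lincomb_fin.
- by apply: measurable_funD => //; exact: measurable_funM.
Qed.

Lemma T_difference_le (h k : X -> R) : in_both h -> in_both k ->
  (Lp_integral mu (p + q) (fun x => (T h x - T k x)%R) <=
   C%:E * Lp_integral mu (p + q) (fun x => (h x - k x)%R))%E.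
Proof.
move=> bh bk; have [mh ph rh] := bh; have [mk pk rk] := bk.
have [md pd rd] := in_both_lincomb (-1) bk bh.
have := T_bound md pd rd.
have -> : (fun y => -1 * k y + h y) = (fun y => h y - k y).
  by apply/funext => y; rewrite mulN1r addrC.
rewrite (@Lp_integral_ae_eq _ _ _ mu (p + q) (fun x => T h x - T k x) (T (fun y => h y - k y)))//.
- by apply: measurable_funB; exact: T_measurable.
- apply: T_measurable; first exact: measurable_funB.
  by move: pd; under eq_fun do rewrite mulN1r addrC.
have := T_linear (-1) mk mh pk ph; apply: filterS => x.
have -> : (fun y => -1 * k y + h y) = (fun y => h y - k y).
  by apply/funext => y; rewrite mulN1r addrC.
by move=> ->; rewrite mulN1r addrC.
Qed.

(** One factor [2 ^ (p + q)] comes from the quasi-triangle inequality between two approximants, the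
    other from the half lost in [fatou_le]. *)
Let Kl : R := 2 `^ (p + q) * (C * 2 `^ (p + q)).

Let Kl_ge0 : 0 <= Kl.
Proof. by rewrite !mulr_ge0 ?powR_ge0. Qed.

(* F is the limit in L^(p + q) of T h as h tends to f within L^p and L^(p + q). *)
Definition Lp_limit (f F : X -> R) : Prop := measurable_fun [set: X] F /\
  forall h, in_both h -> (Lp_integral mu (p + q) (fun x => (F x - T h x)%R) <=
    Kl%:E * Lp_integral mu (p + q) (fun x => (f x - h x)%R))%E.

Lemma Lp_limit_exists (f : X -> R) : measurable_fun [set: X] f ->
  (Lp_integral mu (p + q) f < +oo)%E ->
  exists F : X -> R, Lp_limit f F.
Proof.
move=> mf If.
(* The rate that [cvg_of_fast_increments] asks of the increments, up to the constant [M]. *)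
pose eps k : R := (2 ^+ k.+1 * (2 ^+ k) `^ (p + q))^-1.
have eps0 k : 0 < eps k.
  by rewrite invr_gt0 mulr_gt0 ?exprn_gt0// powR_gt0// exprn_gt0.
have /choice[h_ hP] : forall k : nat, exists h, in_both h /\
    (Lp_integral mu (p + q) (fun x => (f x - h x)%R) <= (eps k)%:E)%E.
  move=> k; have [h [mh ph rh fh _]] := Lp_truncation p_gt0 q_gt0 mf If (eps0 k) ltr01.
  by exists h.
have bh k : in_both (h_ k) by case: (hP k).
have fh k : (Lp_integral mu (p + q) (fun x => (f x - h_ k x)%R) <= (eps k)%:E)%E.
  by case: (hP k).
have mh k : measurable_fun [set: X] (h_ k) by case: (bh k).
have mTh k : measurable_fun [set: X] (T (h_ k)).
  by case: (bh k) => mk pk _; exact: T_measurable.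
have mfh h : in_both h -> measurable_fun [set: X] (fun x => f x - h x).
  by move=> [mh' _ _]; exact: measurable_funB.
have e2 n : (0 : R) < 2 ^+ n by rewrite exprn_gt0.
have epsS k : eps k.+1 <= eps k.
  rewrite /eps; set a := _ * _; set b := _ * _.
  have b0 : 0 < b by rewrite mulr_gt0 ?powR_gt0 ?e2.
  have a0 : 0 < a by rewrite mulr_gt0 ?powR_gt0 ?e2.
  rewrite lef_pV2 ?posrE; [|exact: a0|exact: b0].
  apply: ler_pM; [exact: ltW (e2 _)|exact: powR_ge0| |].
    by apply: ler_weXn2l; rewrite ?ler1n.
  apply: ge0_ler_powR; rewrite ?nnegrE; [exact: ltW|exact: ltW (e2 _)|exact: ltW (e2 _)|].
  by apply: ler_weXn2l; rewrite ?ler1n.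
have epsV k : eps k <= k.+1%:R^-1.
  rewrite /eps; set a := _ * _.
  have a0 : 0 < a by rewrite mulr_gt0 ?powR_gt0 ?e2.
  rewrite lef_pV2 ?posrE; [|exact: a0|by rewrite ltr0n].
  rewrite /a -[leLHS]mulr1; apply: ler_pM; rewrite ?ler01 ?ler0n//.
    by rewrite -natrX ler_nat ltnW// ltn_expl.
  rewrite -[leLHS](_ : 1 `^ (p + q) = 1); last by rewrite powR1.
  apply: ge0_ler_powR; rewrite ?nnegrE; [exact: ltW|exact: ler01|exact: ltW (e2 _)|].
  by rewrite -natrX ler1n expn_gt0.
have diff h k : in_both h ->
    (Lp_integral mu (p + q) (fun x => (T (h_ k) x - T h x)%R) <=
      (C * 2 `^ (p + q))%:E * (Lp_integral mu (p + q) (fun x => (f x - h x)%R) + (eps k)%:E))%E.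
  move=> bh'; apply: le_trans (T_difference_le (bh k) bh') _.
  rewrite EFinM -muleA; apply: lee_wpmul2l; first by rewrite lee_fin.
  have := Lp_integralB_le mu pq_gt0 (mfh _ bh') (mfh _ (bh k)).
  rewrite (_ : (fun x => f x - h x - (f x - h_ k x)) = (fun x => h_ k x - h x)); last first.
    by apply/funext => x; ring.
  move=> /le_trans; apply; apply: lee_wpmul2l; first by rewrite lee_fin powR_ge0.
  by apply: leeD2l; exact: fh.
have CC0 : 0 <= C * 2 `^ (p + q) by rewrite mulr_ge0 ?powR_ge0.
have incr k : (Lp_integral mu (p + q) (fun x => (T (h_ k.+1) x - T (h_ k) x)%R) <=
    (C * 2 `^ (p + q) * 2 / (2 ^+ k.+1 * (2 ^+ k) `^ (p + q)))%:E)%E.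
  apply: (le_trans (diff (h_ k) k.+1 (bh k))).
  rewrite -/(eps k) -[X in (_ <= X%:E)%E]mulrA [X in (_ <= X)%E]EFinM.
  apply: lee_wpmul2l; first by rewrite lee_fin.
  rewrite mulr2n mulrDl mul1r EFinD; apply: leeD; first exact: fh.
  by rewrite lee_fin.
have [E [mE E0 cE]] := cvg_of_fast_increments pq_gt0 mTh incr.
(* Cutting off to the convergence set makes the limit exist at every point, hence measurable,
   without changing the integrals. *)
pose u k x := T (h_ k) x * \1_E x.
have mu_ k : measurable_fun [set: X] (u k).
  by apply: measurable_funM => //; exact: measurable_indic.
have cu x : cvgn (fun k => u k x).
  rewrite /u indicE; have [xE|_] := boolP (x \in E).
    by under eq_fun do rewrite mulr1; apply: cE; exact: set_mem.
  by under eq_fun do rewrite mulr0; exact: is_cvg_cst.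
pose F x := limn (fun k => u k x).
have mF : measurable_fun [set: X] F.
  by apply: (measurable_fun_cvg mu_) => x _; exact: cu.
exists F; split=> // h bh'; have mTh' : measurable_fun [set: X] (T h).
  by case: bh' => mh' ph' _; exact: T_measurable.
have uae k : {ae mu, forall x, u k x - T h x = T (h_ k) x - T h x}.
  exists (~` E); split=> //; first exact: measurableC.
  move=> x ux xE; apply: ux; rewrite /= /u indicE.
  by rewrite (_ : (x \in E) = true) ?mulr1//; exact: mem_set.
have bound K k : (K <= k)%N -> (Lp_integral mu (p + q) (fun x => (u k x - T h x)%R) <=
    (C * 2 `^ (p + q))%:E * (Lp_integral mu (p + q) (fun x => (f x - h x)%R) + (eps K)%:E))%E.
  move=> Kk; rewrite (@Lp_integral_ae_eq _ _ _ mu _ _ (fun x => T (h_ k) x - T h x))//.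
  - apply: (le_trans (diff h k bh')); apply: lee_wpmul2l; first by rewrite lee_fin.
    apply: leeD2l; rewrite lee_fin; move: Kk; elim: k => [|k IH].
      by rewrite leqn0 => /eqP->.
    by rewrite leq_eqVlt => /orP[/eqP->//|]; rewrite ltnS => /IH; exact: le_trans.
  - exact: measurable_funB.
  - exact: measurable_funB.
set I := Lp_integral mu (p + q) (fun x => f x - h x).
apply: (@le_trans _ _ ((2 `^ (p + q))%:E * ((C * 2 `^ (p + q))%:E * I))%E); last first.
  by rewrite /Kl muleA -EFinM.
have r2 : 0 < 2 `^ (p + q) :> R by rewrite powR_gt0.
rewrite /Kl; set A := C * _ in CC0 diff incr bound *.
have half K : (\int[mu]_x (`|F x - T h x| `^ (p + q) / 2 `^ (p + q))%:E <=
    A%:E * (I + (eps K)%:E))%E.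
  apply: (@fatou_le _ _ _ mu (fun k x => `|u (k + K)%N x - T h x| `^ (p + q))).
  - by move=> k; apply: measurable_norm_powR; exact: measurable_funB.
  - by move=> k x; exact: powR_ge0.
  - by move=> x; rewrite divr_ge0 ?powR_ge0.
  - move=> x; have [Fx|Fx] := eqVneq (F x) (T h x).
      exists 0%N => k _; rewrite Fx subrr normr0 powR0 ?mul0r ?powR_ge0//.
      by rewrite gt_eqF.
    have del0 : 0 < `|F x - T h x| / 2 by rewrite divr_gt0// normr_gt0 subr_eq0.
    have /cvgrPdist_lt /(_ _ del0)[N _ NP] : u k x @[k --> \oo] --> F x by exact: cu.
    exists N => k Nk; have := NP (k + K)%N (leq_trans Nk (leq_addr _ _)).
    rewrite /= => lt; rewrite ler_pdivrMr// -powRM//.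
    apply: ge0_ler_powR; rewrite ?nnegrE ?(ltW pq_gt0) ?mulr_ge0//.
    have := ler_normD (F x - u (k + K)%N x) (u (k + K)%N x - T h x).
    rewrite addrA subrK; lra.
  - by move=> k; apply: bound; exact: leq_addl.
have half' : (\int[mu]_x (`|F x - T h x| `^ (p + q) / 2 `^ (p + q))%:E <= A%:E * I)%E.
  apply/lee_addgt0Pr => e e0.
  have [K AK] : exists K, A * eps K <= e.
    exists (Num.bound (A / e)); apply: (@le_trans _ _ (A / (Num.bound (A / e)).+1%:R)).
      by apply: ler_wpM2l.
    rewrite ler_pdivrMr ?ltr0n// mulrC -ler_pdivrMr//; apply: ltW.
    apply: (lt_le_trans (archi_boundP _)); first by rewrite divr_ge0// ltW.
    by rewrite ler_nat.
  apply: (le_trans (half K)); rewrite ge0_muleDr ?lee_fin ?(ltW (eps0 _)) ?Lp_integral_ge0//.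
  by apply: leeD2l; rewrite -EFinM lee_fin.
have -> : Lp_integral mu (p + q) (fun x => F x - T h x) =
    ((2 `^ (p + q))%:E * \int[mu]_x (`|F x - T h x| `^ (p + q) / 2 `^ (p + q))%:E)%E.
  rewrite -ge0_integralZl_EFin ?(ltW r2)//.
  - by apply: eq_integral => x _; rewrite -EFinM mulrC divfK// gt_eqF.
  - apply: measurable_EFin; apply: measurable_funM => //.
    by apply: measurable_norm_powR; exact: measurable_funB.
by apply: lee_wpmul2l => //; rewrite lee_fin ltW.
Qed.

Lemma Lp_limit_le (f F : X -> R) : measurable_fun [set: X] f -> Lp_limit f F ->
  (Lp_integral mu (p + q) F <= Kl%:E * Lp_integral mu (p + q) f)%E.
Proof.
(* Compare with the approximant 0. Linearity with coefficient -1 writes [T z] as [- T z + T z]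
   almost everywhere, so it vanishes. *)
move=> mf [mF FK]; pose z (_ : X) : R := 0.
have z0 (r : R) : 0 < r -> Lp_integral mu r z = 0%E.
  by move=> r0; apply: Lp_integral_eq0; [rewrite gt_eqF|exact: measurable_cst|exact: aeW].
have bz : in_both z by split; [exact: measurable_cst|rewrite z0 ?ltry|rewrite z0 ?ltry].
have [mz pz _] := bz; have mTz := T_measurable mz pz.
have := FK z bz; have -> : (fun x => f x - z x) = f by apply/funext => x; rewrite subr0.
suff -> : Lp_integral mu (p + q) (fun x => F x - T z x) = Lp_integral mu (p + q) F by [].
apply: Lp_integral_ae_eq; [exact: measurable_funB|exact: mF|].
have := T_linear (-1) mz mz pz pz; apply: filterS => x.
have -> : (fun y => -1 * z y + z y) = z by apply/funext => y; rewrite mulr0 addr0.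
by move=> ->; rewrite mulN1r addNr subr0.
Qed.

Lemma Lp_limit_in_both (f F : X -> R) : in_both f -> Lp_limit f F ->
  {ae mu, forall x, F x = T f x}.
Proof.
move=> bf [mF FK]; have [mf pf _] := bf; have mTf := T_measurable mf pf.
have : Lp_integral mu (p + q) (fun x => F x - T f x) = 0%E.
  apply/eqP; rewrite eq_le Lp_integral_ge0 andbT; apply: le_trans (FK f bf) _.
  rewrite (@Lp_integral_eq0 _ _ _ mu _ (fun x => f x - f x)) ?mule0 ?gt_eqF//.
    exact: measurable_funB.
  by apply: aeW => x; rewrite subrr.
move=> /Lp_integral_eq0_ae; have mB : measurable_fun [set: X] (fun x => F x - T f x).
  exact: measurable_funB.
by move=> /(_ mB); apply: filterS => x /eqP; rewrite subr_eq0 => /eqP.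
Qed.

Lemma Lp_limit_approx (f F : X -> R) (e : R) : measurable_fun [set: X] f ->
  (Lp_integral mu (p + q) f < +oo)%E -> Lp_limit f F -> 0 < e ->
  exists h, [/\ in_both h, (Lp_integral mu (p + q) (fun x => (f x - h x)%R) <= e%:E)%E,
    forall x, `|f x - h x| <= e &
    (Lp_integral mu (p + q) (fun x => (F x - T h x)%R) <= (Kl * e)%:E)%E].
Proof.
move=> mf If [_ FK] e0; have [h [mh ph rh fh he]] := Lp_truncation p_gt0 q_gt0 mf If e0 e0.
have bh : in_both h by [].
by exists h; split=> //; apply: le_trans (FK h bh) _; exact: mule_EFin_le.
Qed.

(** With approximants [h] of [f] and [k] of [g], the limit [H] is compared with [T] at [a * h + k];
    linearity of [T] there bounds the defect [W] by a multiple of [e]. *)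
Lemma Lp_limit_linear (a : R) (f g F G H : X -> R) :
  measurable_fun [set: X] f -> measurable_fun [set: X] g ->
  (Lp_integral mu (p + q) f < +oo)%E -> (Lp_integral mu (p + q) g < +oo)%E ->
  Lp_limit f F -> Lp_limit g G -> Lp_limit (fun y => a * f y + g y) H ->
  {ae mu, forall x, H x = a * F x + G x}.
Proof.
move=> mf mg If Ig LF LG [mH HK]; have [mF _] := LF; have [mG _] := LG.
pose W x := H x - (a * F x + G x).
have mW : measurable_fun [set: X] W.
  by apply: measurable_funB => //; apply: measurable_funD => //; exact: measurable_funM.
have mlc (u v : X -> R) : measurable_fun [set: X] u -> measurable_fun [set: X] v ->
    measurable_fun [set: X] (fun x => a * u x + v x).
  by move=> mu' mv'; apply: measurable_funD => //; exact: measurable_funM.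
pose B : R := 2 `^ (p + q) * (`|a| `^ (p + q) + 1).
have B0 : 0 <= B by rewrite mulr_ge0 ?addr_ge0 ?powR_ge0.
have lc (u v : X -> R) (e : R) : measurable_fun [set: X] u -> measurable_fun [set: X] v ->
    (Lp_integral mu (p + q) u <= e%:E)%E -> (Lp_integral mu (p + q) v <= e%:E)%E ->
    (Lp_integral mu (p + q) (fun x => (a * u x + v x)%R) <= (B * e)%:E)%E.
  move=> mu' mv' Iu Iv.
  have mau : measurable_fun [set: X] (fun x => a * u x) by exact: measurable_funM.
  apply: le_trans (Lp_integralD_le mu pq_gt0 mau mv') _.
  rewrite /B -mulrA EFinM; apply: lee_wpmul2l; first by rewrite lee_fin powR_ge0.
  rewrite mulrDl mul1r EFinD Lp_integralZ//; apply: leeD => //.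
  by apply: mule_EFin_le; [exact: powR_ge0|exact: Iu].
have IW e : 0 < e -> (Lp_integral mu (p + q) W <= (2 `^ (p + q) * (2 * Kl * B) * e)%:E)%E.
  move=> e0.
  have [h [bh fh _ Fh]] := Lp_limit_approx mf If LF e0.
  have [k [bk gk _ Gk]] := Lp_limit_approx mg Ig LG e0.
  have [mh ph _] := bh; have [mk pk _] := bk.
  have bl := in_both_lincomb a bh bk; have [ml pl _] := bl.
  have mTh := T_measurable mh ph; have mTk := T_measurable mk pk.
  have mTl := T_measurable ml pl.
  pose U x := H x - T (fun y => a * h y + k y) x.
  pose V x := a * (F x - T h x) + (G x - T k x).
  have mU : measurable_fun [set: X] U by exact: measurable_funB.
  have mV : measurable_fun [set: X] V by apply: mlc; exact: measurable_funB.
  rewrite (@Lp_integral_ae_eq _ _ _ mu _ W (fun x => U x - V x)) //; last 2 first.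
  - exact: measurable_funB.
  - have := T_linear a mh mk ph pk; apply: filterS => x Tx.
    by rewrite /U /V /W Tx; ring.
  apply: le_trans (Lp_integralB_le mu pq_gt0 mU mV) _.
  rewrite -[X in (_ <= X%:E)%E]mulrA [X in (_ <= X)%E]EFinM.
  apply: lee_wpmul2l; first by rewrite lee_fin powR_ge0.
  have -> : 2 * Kl * B * e = Kl * (B * e) + B * (Kl * e) by ring.
  rewrite EFinD; apply: leeD; last first.
    by apply: lc; [exact: measurable_funB|exact: measurable_funB|exact: Fh|exact: Gk].
  apply: le_trans (HK _ bl) _; apply: (mule_EFin_le Kl_ge0).
  have -> : (fun x => a * f x + g x - (a * h x + k x)) =
      (fun x => a * (f x - h x) + (g x - k x)) by apply/funext => x; ring.
  by apply: lc; [exact: measurable_funB|exact: measurable_funB|exact: fh|exact: gk].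
have W0 : Lp_integral mu (p + q) W = 0%E.
  apply/eqP; rewrite eq_le Lp_integral_ge0 andbT; apply/lee_addgt0Pr => e e0.
  rewrite add0e; set c := 2 `^ _ * _ in IW.
  have c0 : 0 <= c by rewrite !mulr_ge0 ?powR_ge0.
  have c1 : 0 < c + 1 by rewrite ltr_wpDl.
  apply: le_trans (IW (e / (c + 1)) (divr_gt0 e0 c1)) _.
  by rewrite lee_fin mulrCA ger_pMr// ler_pdivrMr// mul1r lerDl.
by have := Lp_integral_eq0_ae mW W0; apply: filterS => x /eqP; rewrite subr_eq0 => /eqP.
Qed.

End lp_extension.

(** * Functions with vanishing mean oscillation, and agreement modulo constants *)

Section constant_difference.
Context {R : realType} {d : measure_display} {X : metricMeasurableType d R}.
Context (mu : {measure set X -> \bar R}).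
Context (borelX : borel_sigma_algebra X).
Context (ball_fin : forall (x : X) (r : R), (mu (ball x r) < +oo)%E).

Lemma measure_gt0_bigcup (A : set X) (F : nat -> set X) : measurable A ->
  (forall n, measurable (F n)) -> A `<=` \bigcup_n F n -> (0 < mu A)%E ->
  exists n : nat, (0 < mu (A `&` F n))%E.
Proof.
move=> mA mF AF A0; apply: contrapT => /forallNP nex.
have null n : mu.-negligible (A `&` F n).
  have mI : measurable (A `&` F n) by exact: measurableI.
  exists (A `&` F n); split=> //.
  by apply/eqP; rewrite eq_le measure_ge0 andbT leNgt; apply/negP/nex.
have nA : mu.-negligible A.
  apply: negligibleS (negligible_bigcup null) => x Ax.
  by have [n _ Fx] := AF x Ax; exists n.
by rewrite (measure_negligible mA nA) ltxx in A0.
Qed.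

Lemma measure_gt0_ball (A : set X) (x : X) : measurable A -> (0 < mu A)%E ->
  exists N : nat, forall n, (N <= n)%N -> (0 < mu (A `&` ball x n%:R))%E.
Proof.
move=> mA A0; have mB n := measurable_metric_ball borelX x n%:R.
have AB : A `<=` \bigcup_n ball x n%:R by rewrite bigcup_ball.
have [N NP] := measure_gt0_bigcup mA mB AB A0.
exists N => n Nn; apply: lt_le_trans NP _; apply: le_measure; rewrite ?inE.
- exact: measurableI.
- exact: measurableI.
- by apply: setIS; apply: le_ball; rewrite ler_nat.
Qed.

(** Any [c] is at distance at least [(b - a) / 2] from all values of [u] on one of the two level
    sets. If both had positive measure, they would do so inside a large ball, whose oscillation
    would then be bounded below independently of [c]. *)
Lemma level_set_zero_one (u : X -> R) (a b : R) : measurable_fun [set: X] u -> a < b ->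
  (forall x r e, 0 < r -> 0 < e -> exists c,
    (\int[mu]_(y in ball x r) `|u y - c|%:E <= e%:E)%E) ->
  mu [set x | u x <= a] = 0%E \/ mu [set x | b <= u x] = 0%E.
Proof.
move=> mu' ab osc; set A := [set x | u x <= a]; set B := [set x | b <= u x].
have mA : measurable A by exact: measurable_le_set.
have mB : measurable B by exact: measurable_ge_set.
apply: contrapT => /not_orP[/eqP A0 /eqP B0].
have {}A0 : (0 < mu A)%E by rewrite lt0e A0 measure_ge0.
have {}B0 : (0 < mu B)%E by rewrite lt0e B0 measure_ge0.
have [x0 _] : A !=set0.
  by apply/set0P; apply: contraTneq A0 => ->; rewrite measure0 ltxx.
have [N1 P1] := measure_gt0_ball x0 mA A0; have [N2 P2] := measure_gt0_ball x0 mB B0.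
pose n := (N1 + N2).+1; pose D := ball x0 (n%:R : R).
have mD : measurable D := measurable_metric_ball borelX x0 n%:R.
have {P1}AD : (0 < mu (A `&` D))%E by apply: P1; rewrite /n; lia.
have {P2}BD : (0 < mu (B `&` D))%E by apply: P2; rewrite /n; lia.
have big (E : set X) (c : R) : measurable E ->
    (forall x, E x -> (b - a) / 2 <= `|u x - c|) ->
    (((b - a) / 2)%:E * mu (E `&` D) <= \int[mu]_(y in D) `|u y - c|%:E)%E.
  move=> mE Ec; have mED : measurable (E `&` D) by exact: measurableI.
  rewrite -integral_cst//.
  apply: (@le_trans _ _ (\int[mu]_(y in E `&` D) `|u y - c|%:E)%E).
    apply: le_integral_ge0 => x [Ex _]; last by rewrite lee_fin; exact: Ec.
    by rewrite lee_fin divr_ge0// subr_ge0 ltW.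
  apply: ge0_subset_integral => //.
  apply: measurable_funTS; apply: measurable_EFin; apply: measurable_norm.
  exact: measurable_funB.
have fin E : (mu (E `&` D) < +oo)%E \/ ~ measurable E.
  have [mE|] := pselect (measurable E); last by right.
  left; apply: le_lt_trans (ball_fin x0 n%:R); apply: le_measure; rewrite ?inE//.
  exact: measurableI.
have {fin}fE E : measurable E -> mu (E `&` D) \is a fin_num.
  by move=> mE; rewrite ge0_fin_numE//; case: (fin E).
pose m := Num.min (fine (mu (A `&` D))) (fine (mu (B `&` D))).
have m0 : 0 < m by rewrite lt_min !fine_gt0 ?AD ?BD ?ltey_eq ?fE.
have d0 : 0 < (b - a) / 2 by rewrite divr_gt0// subr_gt0.
have [c Dc] := osc x0 n%:R ((b - a) / 2 * m / 2) (ltr0Sn _ _) ltac:(by rewrite divr_gt0// mulr_gt0).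
have contra E : measurable E -> m <= fine (mu (E `&` D)) ->
    (forall x, E x -> (b - a) / 2 <= `|u x - c|) -> False.
  move=> mE mlt Ec; have := le_trans (big E c mE Ec) Dc.
  rewrite -(fineK (fE E mE)) -EFinM lee_fin -[leRHS]mulrA ler_pM2l// => h; lra.
have [cab|cab] := leP c ((a + b) / 2).
  apply: (contra B mB); first by rewrite ge_min lexx orbT.
  by move=> x Bx; apply: le_trans (ler_norm _); rewrite /B/= in Bx; lra.
apply: (contra A mA); first by rewrite ge_min lexx.
by move=> x Ax; rewrite distrC; apply: le_trans (ler_norm _); rewrite /A/= in Ax; lra.
Qed.

(** The constant is the supremum of the levels [a] for which [u <= a] is a null set. Below it [L] is
    null by monotonicity, above it [G] is null by [level_set_zero_one]. *)
Lemma ae_cst_oscillation (u : X -> R) : measurable_fun [set: X] u ->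
  (forall x r e, 0 < r -> 0 < e -> exists c,
    (\int[mu]_(y in ball x r) `|u y - c|%:E <= e%:E)%E) ->
  exists c, {ae mu, forall x, u x = c}.
Proof.
move=> mu' osc; pose L a := [set x | u x <= a]; pose G a := [set x | a <= u x].
have mL a : measurable (L a) by exact: measurable_le_set.
have mG a : measurable (G a) by exact: measurable_ge_set.
have zo a b : a < b -> mu (L a) = 0%E \/ mu (G b) = 0%E.
  by move=> ab; apply: level_set_zero_one.
(* If the whole space is null, every level belongs to [S] and the supremum makes no sense. *)
have [X0|/eqP X0] := pselect (mu [set: X] = 0%E).
  by exists 0; exists setT; split.
have {}X0 : (0 < mu [set: X])%E by rewrite lt0e X0 measure_ge0.
have [n Ln] : exists n : nat, (0 < mu (setT `&` L n%:R))%E.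
  apply: measure_gt0_bigcup => // x _; exists (Num.bound `|u x|) => //.
  by rewrite /L/=; apply: le_trans (ler_norm _) (ltW (archi_boundP _)).
have [k Gk] : exists n : nat, (0 < mu (setT `&` G (- n%:R)%R))%E.
  apply: measure_gt0_bigcup => // x _; exists (Num.bound `|u x|) => //.
  rewrite /G/= lerNl; apply: le_trans (ltW (archi_boundP _)) => //.
  by rewrite -normrN ler_norm.
rewrite setTI in Ln; rewrite setTI in Gk.
pose S := [set a | mu (L a) = 0%E].
have Sub a : S a -> a < n%:R.
  move=> Sa; rewrite ltNge; apply/negP => na.
  have : (mu (L n%:R) <= mu (L a))%E.
    by apply: le_measure; rewrite ?inE// => x /= /le_trans; apply.
  by rewrite Sa leNgt Ln.
have Sne : S (- k%:R - 1).
  have : - k%:R - 1 < - k%:R :> R by rewrite ltrBlDr ltrDl.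
  by move=> /zo[//|Gk0]; rewrite Gk0 ltxx in Gk.
have Shs : has_sup S.
  by split; [exists (- k%:R - 1)|exists n%:R => a /Sub/ltW].
pose c := sup S; exists c.
have Lc j : mu (L (c - j.+1%:R^-1)) = 0%E.
  have [a Sa ca] := sup_adherent (ltac:(by rewrite invr_gt0) : 0 < j.+1%:R^-1 :> R) Shs.
  apply/eqP; rewrite eq_le measure_ge0 andbT -[leRHS]Sa.
  by apply: le_measure; rewrite ?inE// => x /= /le_trans; apply; exact: ltW.
have Gc j : mu (G (c + j.+1%:R^-1)) = 0%E.
  have [e e1 e2] : exists2 e, c < e & e < c + j.+1%:R^-1.
    have j0 : 0 < j.+1%:R^-1 :> R by rewrite invr_gt0.
    exists (c + j.+1%:R^-1 / 2); first by rewrite ltrDl divr_gt0.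
    by rewrite ltrD2l ltr_pdivrMr// ltr_pMr// ltr1n.
  have [Le|//] := zo _ _ e2; have := ub_le_sup (proj2 Shs) Le.
  by rewrite leNgt e1.
have nL j : mu.-negligible (L (c - j.+1%:R^-1)) by exists (L (c - j.+1%:R^-1)); split.
have nG j : mu.-negligible (G (c + j.+1%:R^-1)) by exists (G (c + j.+1%:R^-1)); split.
have := negligibleU (negligible_bigcup nL) (negligible_bigcup nG).
apply: negligibleS => x /= /eqP uc; have : 0 < `|u x - c| by rewrite normr_gt0 subr_eq0.
move=> uc0; pose j := Num.bound `|u x - c|^-1.
have jP : j.+1%:R^-1 <= `|u x - c|.
  rewrite -[leRHS]invrK lef_pV2 ?posrE ?invr_gt0//.
  apply: le_trans (ltW (archi_boundP _)) _; first by rewrite invr_ge0.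
  by rewrite ler_nat.
have [cu|cu] := leP c (u x).
  right; exists j => //; rewrite /G/=; move: jP; rewrite ger0_norm ?subr_ge0// lerBrDl; exact.
left; exists j => //; rewrite /L/= lerBrDr addrC -lerBrDr -opprB -ltr0_norm ?subr_lt0//.
Qed.

Lemma integral_ball_norm_le (w : X -> R) (x : X) (t s r e : R) : measurable_fun [set: X] w ->
  1 <= r -> 0 < s -> (Lp_integral mu r w <= e%:E)%E ->
  (\int[mu]_(y in ball x t) `|w y|%:E <=
    s%:E * mu (ball x t) + (e / s `^ (r - 1))%:E)%E.
Proof.
move=> mw r1 s0 Iw; have mB : measurable (ball x t : set X) by exact: measurable_metric_ball.
have sr0 : 0 < s `^ (r - 1) by rewrite powR_gt0.
apply: (@le_trans _ _ (\int[mu]_(y in ball x t) (s%:E +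
    (`|w y| `^ r / s `^ (r - 1))%:E))%E).
  apply: le_integral_ge0 => y _; first by rewrite lee_fin.
  by rewrite -EFinD lee_fin; exact: le_add_powR.
have mwr : measurable_fun [set: X] (EFin \o (fun y => `|w y| `^ r / s `^ (r - 1))).
  apply: measurable_EFin; apply: measurable_funM => //; exact: measurable_norm_powR.
rewrite ge0_integralD//; [|by move=> y _; rewrite lee_fin ltW|
  by move=> y _; rewrite lee_fin divr_ge0 ?powR_ge0|exact: measurable_funTS].
rewrite integral_cst//; apply: leeD2l.
apply: (@le_trans _ _ (\int[mu]_y (`|w y| `^ r / s `^ (r - 1))%:E)%E).
  by apply: ge0_subset_integral => // y _; rewrite lee_fin divr_ge0 ?powR_ge0.
under eq_integral do rewrite mulrC EFinM.
rewrite ge0_integralZl_EFin ?invr_ge0 ?powR_ge0//; last first.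
  exact/measurable_EFin/measurable_norm_powR.
by rewrite mulrC; apply: mule_EFin_le; rewrite ?invr_ge0 ?powR_ge0.
Qed.

(* F - T f = (F - T h) - T (f - h) up to a constant: the first term is small in
   L^r, the second has small mean oscillation because f - h is uniformly small. *)
Lemma eq_mod_cst_approx (lam : X -> R -> R) (rho r Cinf : R)
    (T : (X -> R) -> X -> R) (f F : X -> R) :
  1 <= r -> 0 <= Cinf -> measurable_fun [set: X] f ->
  measurable_fun [set: X] F -> measurable_fun [set: X] (T f) ->
  (forall e, 0 < e -> exists h, [/\ measurable_fun [set: X] h, measurable_fun [set: X] (T h),
    forall x, `|f x - h x| <= e & (Lp_integral mu r (fun x => (F x - T h x)%R) <= e%:E)%E]) ->
  (forall (h : X -> R) s, 0 < s -> measurable_fun [set: X] h -> (forall x, `|h x| <= s) ->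
    measurable_fun [set: X] (T h) /\ RBMO_bound mu lam rho (T h) (Cinf * s)) ->
  (forall (h : X -> R) s, measurable_fun [set: X] h -> (forall x, `|f x - h x| <= s) ->
    eq_mod_cst mu (T (fun x => f x - h x)) (fun x => T f x - T h x)) ->
  eq_mod_cst mu F (T f).
Proof.
move=> r1 Cinf0 mf mF mTf approx bmo lin.
suff [c cP] : exists c, {ae mu, forall x, F x - T f x = c}.
  by exists c; apply: filterS cP => x <-; rewrite addrCA subrr addr0.
apply: ae_cst_oscillation => [|x t e t0 e0]; first exact: measurable_funB.
pose b := fine (mu (ball x t)) + 1; pose b' := fine (mu (ball x (rho * t))) + 1.
have bE y u : (mu (ball y u) <= (fine (mu (ball y u)) + 1)%:E)%E.
  by rewrite EFinD fineK ?leeDl// ge0_fin_numE.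
have b0 : 0 < b by rewrite ltr_wpDl// fine_ge0.
have b'0 : 0 < b' by rewrite ltr_wpDl// fine_ge0.
(* [e] is split in three: [s * b] for the constant part of the L^r term, [e' / s ^ (r - 1)] for its
   integral part, [Cinf * e' * b'] for the oscillation. The added 1 in [b], [b'] and [Cinf + 1]
   keeps the divisors positive. *)
pose s := e / 3 / b; have s0 : 0 < s by rewrite !divr_gt0.
have sr0 : 0 < s `^ (r - 1) by rewrite powR_gt0.
have C1 : 0 < Cinf + 1 by rewrite ltr_wpDl.
pose e' := Num.min (e / 3 * s `^ (r - 1)) (e / 3 / ((Cinf + 1) * b')).
have e'0 : 0 < e' by rewrite lt_min mulr_gt0 ?divr_gt0// mulr_gt0.
have [h [mh mTh fh Fh]] := approx e' e'0.
have mfh : measurable_fun [set: X] (fun x => f x - h x) by exact: measurable_funB.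
have [mTfh [fB [osc _]]] := bmo _ _ e'0 mfh fh.
have [c0 cP] := lin _ _ mh fh.
(* [c0] is the constant by which linearity fails on bounded functions, so that [v] is almost
   everywhere [T (f - h)] minus its ball constant. *)
exists (c0 - fB x t).
have mB : measurable (ball x t : set X) by exact: measurable_metric_ball.
pose w y := F y - T h y; have mw : measurable_fun [set: X] w by exact: measurable_funB.
pose v y := T f y - T h y + c0 - fB x t.
have mv : measurable_fun [set: X] v.
  by apply: measurable_funB => //; apply: measurable_funD => //; exact: measurable_funB.
apply: (@le_trans _ _ (\int[mu]_(y in ball x t) (`|w y|%:E + `|v y|%:E))%E).
  apply: le_integral_ge0 => y _; first by rewrite lee_fin.
  rewrite -EFinD lee_fin (_ : F y - T f y - _ = w y - v y) ?ler_normB//.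
  by rewrite /w /v; ring.
rewrite ge0_integralD//; last 2 first.
- by apply: measurable_funTS; apply: measurable_EFin; exact: measurable_norm.
- by apply: measurable_funTS; apply: measurable_EFin; exact: measurable_norm.
have -> : e = s * b + e / 3 * s `^ (r - 1) / s `^ (r - 1) + e / 3.
  by rewrite mulfK ?gt_eqF// /s divfK ?gt_eqF//; field.
rewrite EFinD; apply: leeD.
  apply: le_trans (integral_ball_norm_le x t mw r1 s0 Fh) _.
  rewrite EFinD; apply: leeD.
    by apply: mule_EFin_le; [exact: ltW|exact: bE].
  by rewrite lee_fin ler_pM2r ?invr_gt0// ge_min lexx.
have vE : (\int[mu]_(y in ball x t) `|v y|%:E =
    \int[mu]_(y in ball x t) `|T (fun x => (f x - h x)%R) y - fB x t|%:E)%E.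
  apply: ge0_ae_eq_integral => //.
  - by apply: measurable_funTS; apply: measurable_EFin; exact: measurable_norm.
  - apply: measurable_funTS; apply: measurable_EFin; apply: measurable_norm.
    exact: measurable_funB.
  - by apply: filterS cP => y Ty _; rewrite Ty.
rewrite vE; apply: le_trans (osc x t t0) _.
apply: (@le_trans _ _ ((Cinf * e') * b')%:E).
  apply: mule_EFin_le; last exact: bE.
  by rewrite mulr_ge0// ltW.
rewrite lee_fin mulrAC; apply: (@le_trans _ _ ((Cinf + 1) * b' * (e / 3 / ((Cinf + 1) * b')))).
  apply: ler_pM; rewrite ?mulr_ge0 ?(ltW e'0) ?(ltW b'0)//.
    by rewrite ler_pM2r// lerDl.
  by rewrite ge_min lexx orbT.
by rewrite mulrC divfK// gt_eqF// mulr_gt0.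
Qed.

End constant_difference.

(** * Translation between [Lfun], norms and integrals *)

Section Lfun_membership.
Context {R : realType} {d : measure_display} {X : measurableType d}.
Context (mu : {measure set X -> \bar R}).
Implicit Types (f g : X -> R) (p : R).

Lemma Lnorm_Lp_integral p f : ('N[mu]_p%:E [EFin \o f] = Lp_integral mu p f `^ p^-1)%E.
Proof.
by rewrite unlock; congr poweR; apply: eq_integral => x _; rewrite /= poweR_EFin.
Qed.

Lemma mfunP f : f \in mfun <-> measurable_fun [set: X] f.
Proof. by rewrite inE; split. Qed.

Lemma in_LfunP (e : \bar R) f : f \in Lfun mu e <->
  measurable_fun [set: X] f /\ ('N[mu]_e [EFin \o f] < +oo)%E.
Proof.
split; first by rewrite inE => /andP[/mfunP mf]; rewrite inE.
by move=> [mf If]; rewrite inE; apply/andP; split; [exact/mfunP|rewrite inE].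
Qed.

Lemma Lfun_LpP p f : 0 < p -> f \in Lfun mu p%:E <->
  measurable_fun [set: X] f /\ (Lp_integral mu p f < +oo)%E.
Proof.
move=> p0; rewrite in_LfunP Lnorm_Lp_integral; split=> -[mf If]; split=> //.
  by apply: (lty_poweRy _ If); rewrite invr_neq0// gt_eqF.
exact: poweR_lty.
Qed.

(** [Num.max c 0] appears because the constant of a bounded operator is not assumed nonnegative, and
    it is raised to a power. *)
Lemma Lp_integral_le_Lnorm p c f g : 0 < p ->
  ('N[mu]_p%:E [EFin \o g] <= c%:E * 'N[mu]_p%:E [EFin \o f])%E ->
  (Lp_integral mu p g <= (Num.max c 0 `^ p)%:E * Lp_integral mu p f)%E.
Proof.
move=> p0; rewrite !Lnorm_Lp_integral => gf.
have pK h : (Lp_integral mu p h = (Lp_integral mu p h `^ p^-1) `^ p)%E.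
  by rewrite -poweRrM mulVf ?gt_eqF// poweRe1// Lp_integral_ge0.
rewrite (pK g) (pK f) -poweR_EFin -poweRM ?poweR_ge0 ?lee_fin ?le_max ?lexx ?orbT//.
apply: gt0_ler_poweR; rewrite ?(ltW p0)// ?in_itv/= ?andbT ?leey ?poweR_ge0 ?mule_ge0 ?lee_fin ?le_max ?lexx ?orbT ?poweR_ge0//.
apply: le_trans gf _; apply: lee_wpmul2r; first exact: poweR_ge0.
by rewrite lee_fin le_max lexx.
Qed.

Lemma Lnorm_le_Lp_integral p c f g : 0 < p -> 0 <= c ->
  (Lp_integral mu p g <= c%:E * Lp_integral mu p f)%E ->
  ('N[mu]_p%:E [EFin \o g] <= (c `^ p^-1)%:E * 'N[mu]_p%:E [EFin \o f])%E.
Proof.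
move=> p0 c0 gf; rewrite !Lnorm_Lp_integral -poweR_EFin -poweRM ?Lp_integral_ge0 ?lee_fin//.
have c0E : (0 <= c%:E)%E by rewrite lee_fin.
apply: gt0_ler_poweR; rewrite ?invr_ge0 ?(ltW p0)//.
- by rewrite in_itv/= leey Lp_integral_ge0.
- by rewrite in_itv/= leey mule_ge0 ?Lp_integral_ge0.
Qed.

Lemma Lfun_inftyP f : f \in Lfun mu +oo%E <-> measurable_fun [set: X] f /\
  exists s : R, {ae mu, forall x, `|f x| <= s}.
Proof.
rewrite in_LfunP unlock; split=> -[mf].
  case: ifPn => [_ /ess_supr_bounded //|X0 _]; split=> //.
  (* For a null space the L^oo norm is 0 by convention, and the whole space serves as exceptional
     set. *)
  exists 0, [set: X]; split=> //; apply/eqP; rewrite eq_le measure_ge0 andbT.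
  by rewrite leNgt.
move=> [s fs]; split=> //; case: ifP => // _.
by apply: (@le_lt_trans _ _ s%:E); rewrite ?ltry//; exact/ess_supP.
Qed.

Lemma Lnorm_infty_le f s : 0 <= s -> (forall x, `|f x| <= s) ->
  ('N[mu]_+oo [EFin \o f] <= s%:E)%E.
Proof.
move=> s0 fs; rewrite unlock; case: ifP => [_|_]; last by rewrite lee_fin.
by apply/ess_supP; apply: aeW => x /=; rewrite lee_fin.
Qed.

End Lfun_membership.

(** * Consequences of the hypotheses on [mu] and [T], and the theorem *)

Section assembly.
Context {R : realType} {d : measure_display} {X : metricMeasurableType d R}.
Context (mu : {measure set X -> \bar R}) (lam : X -> R -> R).
Context (ud : upper_doubling mu lam).

Lemma upper_doubling_ball_fin (x : X) (r : R) : (mu (ball x r) < +oo)%E.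
Proof.
have [r0|r0] := ltP 0 r.
  by apply: le_lt_trans (dominating_measure ud x r0) _; rewrite ltry.
suff -> : ball x r = set0 by rewrite measure0 ltry.
apply/seteqP; split=> // y; rewrite ballE => xy.
by have := le_lt_trans (mdist_ge0 x y) xy; rewrite ltNge r0.
Qed.

Lemma Kcoef_ge0 (x : X) (r s : R) : 0 < r -> (0 <= Kcoef mu lam x r s)%E.
Proof.
move=> r0; apply: adde_ge0 => //; apply: integral_ge0 => y /= /andP[ry _].
by rewrite lee_fin invr_ge0 ltW// (dominating_gt0 ud)// (lt_le_trans r0).
Qed.

Lemma RBMO_bound_le (rho : R) (f : X -> R) (C C' : R) : C <= C' ->
  RBMO_bound mu lam rho f C -> RBMO_bound mu lam rho f C'.
Proof.
move=> CC' [fB [osc diff]]; exists fB; split=> [x r r0|x r y s r0 s0 xy].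
  apply: le_trans (osc x r r0) _; apply: lee_wpmul2r => //.
apply: le_trans (diff x r y s r0 s0 xy) _; apply: lee_wpmul2r => //.
exact: Kcoef_ge0.
Qed.

(** The RBMO norm is an infimum that need not be attained; adding 1 to the constant yields an actual
    bound, as [0 < s]. *)
Lemma RBMO_bound_operator (rho : R) (T : (X -> R) -> X -> R) :
  bounded_linear_Linfty_RBMO mu lam rho T -> exists2 Cinf : R, 0 < Cinf &
    forall (f : X -> R) s, 0 < s -> measurable_fun [set: X] f -> (forall x, `|f x| <= s) ->
      RBMO_bound mu lam rho (T f) (Cinf * s).
Proof.
move=> [_ _ [C HC]]; exists (Num.max C 0 + 1).
  by rewrite ltr_wpDl// le_max lexx orbT.
move=> f s s0 mf fs.
have fL : f \in Lfun mu +oo%E by apply/Lfun_inftyP; split=> //; exists s; exact: aeW.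
have : (RBMO_norm mu lam rho (T f) < ((Num.max C 0 + 1) * s)%:E)%E.
  apply: (@le_lt_trans _ _ (Num.max C 0 * s)%:E); last first.
    by rewrite lte_fin ltr_pM2r// ltrDl.
  apply: le_trans (HC f fL) _.
  apply: (@le_trans _ _ ((Num.max C 0)%:E * 'N[mu]_+oo [EFin \o f])%E).
    by apply: lee_wpmul2r; rewrite ?Lnorm_ge0// lee_fin le_max lexx.
  apply: mule_EFin_le; first by rewrite le_max lexx orbT.
  exact: Lnorm_infty_le (ltW s0) fs.
by move=> /ereal_inf_lt[_ [c cb <-]]; rewrite lte_fin => /ltW cC; exact: RBMO_bound_le cb.
Qed.

End assembly.

Theorem theorem4p3 (R : realType) (d : measure_display)
    (X : metricMeasurableType d R) (mu : {measure set X -> \bar R})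
    (lam : X -> R -> R) (rho p : R) (T : (X -> R) -> (X -> R))
    (borelX : borel_sigma_algebra X)
    (doublingX : geometrically_doubling X)
    (doubling_mu : upper_doubling mu lam)
    (rho_gt1 : 1 < rho) (p_gt1 : 1 < p)
    (T_Lp : bounded_linear_Lp mu p T)
    (T_Linfty : bounded_linear_Linfty_RBMO mu lam rho T)
    (r : R) (p_lt_r : p < r) :
  exists S : (X -> R) -> (X -> R),
    bounded_linear_Lp mu r S /\ extends_to_Lr mu p r T S.
Proof.
have p0 : 0 < p by rewrite (lt_trans ltr01).
have r0 : 0 < r by rewrite (lt_trans p0).
have q0 : 0 < r - p by rewrite subr_gt0.
have rE : p + (r - p) = r by rewrite addrC subrK.
have ball_fin := upper_doubling_ball_fin doubling_mu.
have [N net] := finite_net doublingX.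
(* [alpha] will be [2 ^+ m]: a power of 2 fits both the doubling of [lam] and the nets, whose radii
   are halved. *)
have [m mP] := lt_exp2_ex (7 * rho).
have [Ca [Ca1 lam_dilate]] := dominating_dilate doubling_mu m.
have [T_Lpp T_lin [C0 T_le]] := T_Lp.
have [T_BMO T_linfty _] := T_Linfty.
have [Cinf Cinf0 T_RBMO] := RBMO_bound_operator doubling_mu T_Linfty.
have Cp0 : 0 <= Num.max C0 0 `^ p by exact: powR_ge0.
have T_meas (f : X -> R) : measurable_fun [set: X] f -> (Lp_integral mu p f < +oo)%E ->
    measurable_fun [set: X] (T f).
  by move=> mf If; have /(Lfun_LpP _ _ p0)[] := T_Lpp f (proj2 (Lfun_LpP mu f p0) (conj mf If)).
have T_bd (f : X -> R) : measurable_fun [set: X] f -> (Lp_integral mu p f < +oo)%E ->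
    (Lp_integral mu p (T f) <= (Num.max C0 0 `^ p)%:E * Lp_integral mu p f)%E.
  by move=> mf If; apply: Lp_integral_le_Lnorm => //; apply: T_le; apply/Lfun_LpP.
have T_linear (a : R) (f g : X -> R) : measurable_fun [set: X] f ->
    measurable_fun [set: X] g ->
    (Lp_integral mu p f < +oo)%E -> (Lp_integral mu p g < +oo)%E ->
    {ae mu, forall x, T (fun y => a * f y + g y) x = a * T f x + T g x}.
  by move=> mf mg If Ig; apply: T_lin; apply/Lfun_LpP.
have T_add (f g : X -> R) : measurable_fun [set: X] f -> measurable_fun [set: X] g ->
    (Lp_integral mu p f < +oo)%E -> (Lp_integral mu p g < +oo)%E ->
    {ae mu, forall x, T (fun y => f y + g y) x = T f x + T g x}.
  move=> mf mg If Ig; have := T_linear 1 f g mf mg If Ig; apply: filterS => x.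
  by under eq_fun do rewrite mul1r; rewrite mul1r.
have [C [C_ge0 T_bound]] : exists C : R, 0 <= C /\
    forall f, measurable_fun [set: X] f -> (Lp_integral mu p f < +oo)%E ->
    (Lp_integral mu (p + (r - p)) f < +oo)%E ->
    (Lp_integral mu (p + (r - p)) (T f) <= C%:E * Lp_integral mu (p + (r - p)) f)%E.
  have rho7 : 7 * rho <= 2 ^+ m by exact: ltW.
  have alpha3 : 3 <= 2 ^+ m :> R by lra.
  have NN : 0 <= N%:R ^+ m :> R by rewrite exprn_ge0.
  have beta0 : 0 < 2 * Ca + 2 * N%:R ^+ m by lra.
  (* [beta] is the sum of its two lower bounds, one for large and one for small doubling balls. *)
  apply: (@interpolation_bound _ _ _ mu borelX doublingX (2 ^+ m) (2 * Ca + 2 * N%:R ^+ m)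
    alpha3 beta0 ball_fin lam doubling_mu Ca Ca1 _ lam_dilate N m erefl _ net rho (ltW rho_gt1)
    rho7 T p _ Cinf (ltW p_gt1) Cp0 Cinf0 T_meas T_bd T_add T_RBMO _ q0).
    lra.
  lra.
(* Outside L^r the value 0 is arbitrary; it makes the choice of [S] total. *)
have lim (f : X -> R) : exists F : X -> R, measurable_fun [set: X] f ->
    (Lp_integral mu (p + (r - p)) f < +oo)%E -> Lp_limit mu T p (r - p) C f F.
  have [[mf If]|nf] := pselect (measurable_fun [set: X] f /\
      (Lp_integral mu (p + (r - p)) f < +oo)%E).
    by have [F FP] := Lp_limit_exists p0 q0 C_ge0 T_meas T_linear T_bound mf If; exists F.
  by exists (fun=> 0) => mf If; case: nf.
have [S SP] := choice lim; rewrite rE in T_bound lim SP; exists S.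
pose K := 2 `^ r * (C * 2 `^ r).
have K0 : 0 <= K by rewrite !mulr_ge0 ?powR_ge0.
have S_le (f : X -> R) : measurable_fun [set: X] f -> (Lp_integral mu r f < +oo)%E ->
    (Lp_integral mu r (S f) <= K%:E * Lp_integral mu r f)%E.
  move=> mf If; have := Lp_limit_le p0 q0 T_meas T_linear mf (SP f mf If).
  by rewrite rE.
split; first split.
- move=> f /(Lfun_LpP _ _ r0)[mf If]; apply/(Lfun_LpP _ _ r0); split.
    by case: (SP f mf If).
  by apply: (le_lt_trans (S_le f mf If)); apply: lte_mul_pinfty; rewrite ?lee_fin.
- move=> a f g /(Lfun_LpP _ _ r0)[mf If] /(Lfun_LpP _ _ r0)[mg Ig].
  have mh : measurable_fun [set: X] (fun y => a * f y + g y).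
    by apply: measurable_funD => //; exact: measurable_funM.
  have Ih := Lp_integral_lincomb_fin a r0 mf mg If Ig.
  by apply: (Lp_limit_linear p0 q0 C_ge0 T_meas T_linear mf mg _ _ (SP _ mf If) (SP _ mg Ig)
    (SP _ mh Ih)); rewrite rE.
- exists (K `^ r^-1) => f /(Lfun_LpP _ _ r0)[mf If].
  exact: Lnorm_le_Lp_integral (S_le f mf If).
split=> f.
  move=> /(Lfun_LpP _ _ p0)[mf pf] /(Lfun_LpP _ _ r0)[_ If].
  by apply: (Lp_limit_in_both p0 q0 T_meas _ (SP _ mf If)); split; rewrite ?rE.
move=> foo /(Lfun_LpP _ _ r0)[mf If]; have LS := SP _ mf If.
have mT_infty (h : X -> R) : h \in Lfun mu +oo%E -> measurable_fun [set: X] (T h).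
  by move=> /T_BMO[[]].
apply: (@eq_mod_cst_approx _ _ _ mu borelX ball_fin lam rho r Cinf) => //.
- by rewrite ltW// (lt_trans p_gt1).
- exact: ltW.
- by case: LS.
- exact: mT_infty.
- move=> e e0; have K1 : 0 < K + 1 by rewrite ltr_wpDl.
  have e'0 : 0 < e / (K + 1) by rewrite divr_gt0.
  have e'e : e / (K + 1) <= e by rewrite ler_pdivrMr// ler_peMr ?(ltW e0)// lerDr.
  have [|h [[mh ph rh] fh fe Sh]] := Lp_limit_approx p0 q0 C_ge0 mf _ LS e'0.
    by rewrite rE.
  exists h; split=> //; first exact: T_meas.
    by move=> x; apply: le_trans (fe x) e'e.
  rewrite rE in Sh; apply: le_trans Sh _; rewrite lee_fin -/K mulrCA ger_pMr//.
  by rewrite ler_pdivrMr// mul1r lerDl.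
- move=> h s s0 mh hs; split; last exact: T_RBMO.
  by apply: mT_infty; apply/Lfun_inftyP; split=> //; exists s; exact: aeW.
- move=> h s mh fhs; have [_ [t ft]] := proj1 (Lfun_inftyP mu f) foo.
  (* [h] inherits essential boundedness from [f] because [f - h] is bounded everywhere; this is
     where uniform approximation enters. *)
  have hoo : h \in Lfun mu +oo%E.
    apply/Lfun_inftyP; split=> //; exists (t + s); apply: filterS ft => x ft.
    have := ler_normB (f x) (f x - h x); rewrite opprB addrCA subrr addr0 => /le_trans; apply.
    exact: lerD.
  have [c cP] := T_linfty (-1) h f hoo foo; exists c; apply: filterS cP => x.
  have -> : (fun y => -1 * h y + f y) = (fun y => f y - h y).
    by apply/funext => y; rewrite mulN1r addrC.
  by move=> ->; rewrite mulN1r [- _ + _]addrC.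
Qed.
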